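(* Let $\alpha>0$ and suppose that the family $\mu^{(k)}$, $k\in\mathbb{N}_0$, is in the mean Nevai class $M^{(C,\alpha)}(\Sigma_{l_a,l_b})$ of the Cesàro method $(C,\alpha)$ with limits $$\Sigma_{l_a,l_b}=\delta_{0,l_a}\,2^{-l_b}\binom{\frac{\alpha+l_b}{2}}{\frac{\alpha}{2}}^{-1}.$$ Then the equilibrium measure $\mu_\Sigma$ (the weak limit of the measures $\bar{\mu}_n$, $\mathrm{d}\bar{\mu}_n=\sum_{k=0}^n\sigma_{n,k}^{(C,\alpha)}(p_k^{(n-k)}(x))^2\,\mathrm{d}\mu^{(n-k)}$, which exists) is given by $$\mathrm{d}\mu_\Sigma=\frac{1}{m^{(\alpha/2)}}\chi_{[-1,1]}(x)(1-x^2)^{\frac{\alpha-1}{2}}\,\mathrm{d}x,$$ with the normalization $m^{(\alpha/2)}=\int_{-1}^1(1-x^2)^{\frac{\alpha-1}{2}}\,\mathrm{d}x=\pi 2^{1-\alpha}\binom{\alpha-1}{\frac{\alpha}{2}}$. In particular, if $f$ is a continuous function on $[-1,1]$, we have the following weak limits: $$\lim_{n\to\infty}\sum_{k=0}^n\frac{\binom{n-k+\alpha-1}{n-k}}{\binom{n+\alpha}{n}}\int_{-1}^1 f(x)|p_k^{(n-k)}(x)|^2\,\mathrm{d}\mu^{(n-k)}(x)=\frac{1}{m^{(\alpha/2)}}\int_{-1}^1 f(x)(1-x^2)^{\frac{\alpha-1}{2}}\,\mathrm{d}x,$$ $$\lim_{n\to\infty}\sum_{k=0}^n\frac{\binom{n-k+\alpha-1}{n-k}}{\binom{n+\alpha+1}{n}}\int_{-1}^1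 f(x)K_k^{(n-k)}(x,x)\,\mathrm{d}\mu^{(n-k)}(x)=\frac{1}{m^{(\alpha/2)}}\int_{-1}^1 f(x)(1-x^2)^{\frac{\alpha-1}{2}}\,\mathrm{d}x,$$ $$\lim_{n\to\infty}\sum_{k=0}^n\frac{\binom{n-k+\alpha-1}{n-k}}{\binom{n+\alpha+1}{n}}\sum_{j=1}^{k+1}f(x_{k+1,j}^{(n-k)})=\frac{1}{m^{(\alpha/2)}}\int_{-1}^1 f(x)(1-x^2)^{\frac{\alpha-1}{2}}\,\mathrm{d}x.$$
   Context: Orthogonal polynomials. $\mathbb{N}=\{1,2,\dots\}$ and $\mathbb{N}_0=\mathbb{N}\cup\{0\}$. $\mu^{(k)}$, $k\in\mathbb{N}_0$, is a family of non-negative finite Borel measures on $\mathbb{R}$, each supported on a bounded interval and having infinite support. For each $k$, $p_l^{(k)}$, $l\in\mathbb{N}_0$, is the polynomial of degree $l$ with positive leading coefficient such that $(p_l^{(k)})_{l\ge 0}$ is orthonormal with respect to $\langle f,g\rangle^{(k)}=\int_{\mathbb{R}} f\overline{g}\,\mathrm{d}\mu^{(k)}$. With $p_{-1}^{(k)}=0$ they satisfy $x p_l^{(k)}(x)=b_{l+1}^{(k)}p_{l+1}^{(k)}(x)+a_l^{(k)}p_l^{(k)}(x)+b_l^{(k)}p_{l-1}^{(k)}(x)$ for $l\in\mathbb{N}_0$, with $a_l^{(k)}\in\mathbb{R}$ and $b_{l+1}^{(k)}>0$; by convention $b_0^{(k)}=0$. The Christoffel-Darboux kernel is $K_n^{(k)}(x,y)=\sum_{l=0}^n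 p_l^{(k)}(x)p_l^{(k)}(y)$. For $n\ge 1$, $x_{n,j}^{(k)}$, $1\le j\le n$, denotes the $j$th smallest root of $p_n^{(k)}$. Cesàro method. For $\alpha>0$ the weights of $(C,\alpha)$ are $\sigma_{n,k}^{(C,\alpha)}=\binom{n-k+\alpha-1}{n-k}/\binom{n+\alpha}{n}$, $0\le k\le n$. Binomial coefficients with real arguments are $\binom{x}{y}=\frac{\Gamma(x+1)}{\Gamma(y+1)\Gamma(x-y+1)}$. $\delta_{0,l_a}$ is the Kronecker delta and $\chi_I$ the characteristic function of $I$. Mean Nevai class. With $\sigma_{n,k}=\sigma_{n,k}^{(C,\alpha)}$, the family $\mu^{(k)}$, $k\in\mathbb{N}_0$, is in $M^{(C,\alpha)}(\Sigma_{l_a,l_b})$, where $(\Sigma_{l_a,l_b})_{l_a,l_b\in\mathbb{N}_0}$ are (finite) real numbers, if (i) $\sup_{n,k\in\mathbb{N}_0}|a_n^{(k)}|<\infty$ and $\sup_{n,k\in\mathbb{N}_0}|b_n^{(k)}|<\infty$; (ii) $\lim_{n\to\infty}\sum_{k=0}^n\sigma_{n,k}|a_{k+l}^{(n-k)}-a_k^{(n-k)}|=0$ and $\lim_{n\to\infty}\sum_{k=0}^n\sigma_{n,k}|b_{k+l}^{(n-k)}-b_k^{(n-k)}|=0$ for all $l\in\mathbb{N}$; (iii) $\lim_{n\to\infty}\sum_{k=0}^n\sigma_{n,k}(a_k^{(n-k)})^{l_a}(b_k^{(n-k)})^{l_b}=\Sigma_{l_a,l_b}$ for all $l_a,l_b\in\mathbb{N}_0$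 (a zeroth power equals $1$).
   Formalization: In the third limit the zeros may lie outside [-1,1], where f is undefined; there f is replaced by an arbitrary extension of f to the real line that is bounded on bounded sets (for example any continuous extension, or extension by zero). *)

(* Defs.v *)
From HB Require Import structures.
From mathcomp Require Import all_boot all_order all_algebra.
From mathcomp Require Import all_classical all_reals all_analysis.
From mathcomp Require Import measurable_realfun polyrcf.

Set Implicit Arguments.
Unset Strict Implicit.
Unset Printing Implicit Defensive.

Import Order.TTheory GRing.Theory Num.Theory.
Import numFieldNormedType.Exports.

Local Open Scope classical_set_scope.
Local Open Scope ring_scope.

(** Families are indexed with the measure first: [p k l] is $p_l^{(k)}$ and
    [a k n], [b k n] are $a_n^{(k)}$, $b_n^{(k)}$. *)

Section BorelMeasures.
Context {R : realType}.

Definition measure_support (mu : {measure set (measurableTypeR R) -> \bar R})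
    : set R :=
  [set x | forall U : set R, open U -> U x -> (0 < mu U)%E].

Definition admissible_measure
    (mu : {finite_measure set (measurableTypeR R) -> \bar R}) : Prop :=
  (exists c d : R, mu (~` `[c, d]) = 0%E) /\ infinite_set (measure_support mu).

Definition weakly_converges
    (nu_ : nat -> {measure set (measurableTypeR R) -> \bar R})
    (nu : {measure set (measurableTypeR R) -> \bar R}) : Prop :=
  forall f : R -> R, continuous f -> bounded_fun f ->
    \int[nu_ n]_x f x @[n --> \oo] --> \int[nu]_x f x.

End BorelMeasures.

Section OrthogonalPolynomials.
Context {R : realType}.

Definition orthonormal_polynomials
    (mu : {finite_measure set (measurableTypeR R) -> \bar R})
    (p : nat -> {poly R}) : Prop :=
  (forall l, size (p l) = l.+1 /\ 0 < lead_coef (p l)) /\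
  (forall l m, (\int[mu]_x ((p l).[x] * (p m).[x])%:E = ((l == m)%:R)%:E)%E).

Definition recurrence_coefficients (p : nat -> {poly R}) (a b : nat -> R)
    : Prop :=
  [/\ b 0 = 0, (forall l, 0 < b l.+1) &
      forall l, 'X * p l = b l.+1 *: p l.+1 + a l *: p l
                           + b l *: (if l is l'.+1 then p l' else 0)].

Definition CD_kernel (p : nat -> {poly R}) (n : nat) (x y : R) : R :=
  \sum_(l < n.+1) (p l).[x] * (p l).[y].

(** [rootsR] lists the real roots in increasing order and is numbered from 0:
    for [1 <= j <= n] this is the [j]th smallest root of [p n]. *)
Definition ordered_root (p : nat -> {poly R}) (n j : nat) : R :=
  (rootsR (p n))`_j.-1.

End OrthogonalPolynomials.

Section CesaroMethod.
Context {R : realType}.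

(** Euler's integral, meaningful for [0 < x]; only such arguments occur below. *)
Definition Gamma (x : R) : R :=
  \int[lebesgue_measure]_(t in `]0, +oo[) (t `^ (x - 1) * expR (- t)).

Definition rbinom (x y : R) : R :=
  Gamma (x + 1) / (Gamma (y + 1) * Gamma (x - y + 1)).

Definition cesaro (alpha : R) (n k : nat) : R :=
  rbinom ((n - k)%:R + alpha - 1) (n - k)%:R / rbinom (n%:R + alpha) n%:R.

Lemma Gamma_ge0 x : 0 <= Gamma x.
Proof. by apply: Rintegral_ge0 => t _; rewrite mulr_ge0 ?powR_ge0 ?expR_ge0. Qed.

Lemma rbinom_ge0 x y : 0 <= rbinom x y.
Proof. by rewrite divr_ge0 ?mulr_ge0 ?Gamma_ge0. Qed.

Lemma cesaro_ge0 alpha n k : 0 <= cesaro alpha n k.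
Proof. by rewrite divr_ge0 ?rbinom_ge0. Qed.

Definition mean_nevai_class (alpha : R) (a b : nat -> nat -> R)
    (Sigma : nat -> nat -> R) : Prop :=
  [/\ (exists M : R, forall n k, `|a k n| <= M),
      (exists M : R, forall n k, `|b k n| <= M),
      (forall l, (0 < l)%N ->
        (\sum_(k < n.+1) cesaro alpha n k * `|a (n - k)%N (k + l)%N - a (n - k)%N k|)
          @[n --> \oo] --> (0 : R) /\
        (\sum_(k < n.+1) cesaro alpha n k * `|b (n - k)%N (k + l)%N - b (n - k)%N k|)
          @[n --> \oo] --> (0 : R)) &
      forall la lb,
        (\sum_(k < n.+1) cesaro alpha n k * (a (n - k)%N k ^+ la * b (n - k)%N k ^+ lb))
          @[n --> \oo] --> Sigma la lb].

End CesaroMethod.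

Section SquareDensity.
Context {R : realType}.
Variables (mu : {measure set (measurableTypeR R) -> \bar R}) (p : {poly R}).

Definition square_density (A : set (measurableTypeR R)) : \bar R :=
  (\int[mu]_(x in A) (p.[x] ^+ 2)%:E)%E.

Let square_density0 : square_density set0 = 0%E.
Proof. exact: integral_set0. Qed.

Let square_density_ge0 A : (0 <= square_density A)%E.
Proof. by apply: integral_ge0 => x _; rewrite lee_fin sqr_ge0. Qed.

Let square_density_sigma_additive : semi_sigma_additive square_density.
Proof.
apply: semi_sigma_additive_nng_induced => [|x]; last by rewrite lee_fin sqr_ge0.
apply/measurable_EFinP; apply: measurable_funX.
by apply: continuous_measurable_fun; exact: continuous_horner.
Qed.

HB.instance Definition _ := isMeasure.Build _ _ _ square_density
  square_density0 square_density_ge0 square_density_sigma_additive.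

End SquareDensity.

Section MeanMeasure.
Context {R : realType}.
Variables (alpha : R).
Variables (mu : nat -> {finite_measure set (measurableTypeR R) -> \bar R}).
Variables (p : nat -> nat -> {poly R}) (n : nat).

(** [msum m n.+1] is the sum of the measures [m 0], ..., [m n]. *)
Definition mean_measure : set (measurableTypeR R) -> \bar R :=
  msum (fun k => mscale (NngNum (cesaro_ge0 alpha n k))
                        (square_density (mu (n - k)%N) (p (n - k)%N k))) n.+1.

HB.instance Definition _ := Measure.on mean_measure.

End MeanMeasure.

Section EquilibriumMeasure.
Context {R : realType}.
Variable alpha : R.

(** The junk values of [powR] at negative bases and at 0 occur only outside
    [-1, 1] and at its endpoints, a null set. *)
Definition equilibrium_weight (x : R) : R :=
  (1 - x ^+ 2) `^ ((alpha - 1) / 2).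

Definition equilibrium_mass : R :=
  \int[lebesgue_measure]_(x in `[-1, 1]) equilibrium_weight x.

Definition equilibrium_density (x : R) : R :=
  equilibrium_mass^-1 * (\1_(`[-1, 1] : set R) x * equilibrium_weight x).

Definition equilibrium_measure (A : set (measurableTypeR R)) : \bar R :=
  (\int[lebesgue_measure]_(x in A) (equilibrium_density x)%:E)%E.

Let equilibrium_density_ge0 x : 0 <= equilibrium_density x.
Proof.
rewrite mulr_ge0 ?mulr_ge0 ?powR_ge0 ?indicE// invr_ge0.
by apply: Rintegral_ge0 => t _; exact: powR_ge0.
Qed.

Let equilibrium_measure0 : equilibrium_measure set0 = 0%E.
Proof. exact: integral_set0. Qed.

Let equilibrium_measure_ge0 A : (0 <= equilibrium_measure A)%E.
Proof. by apply: integral_ge0 => x _; rewrite lee_fin. Qed.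

Let equilibrium_measure_sigma_additive : semi_sigma_additive equilibrium_measure.
Proof.
apply: semi_sigma_additive_nng_induced => [|x]; last by rewrite lee_fin.
apply/measurable_EFinP; apply: measurable_funM => //.
apply: measurable_funM; first exact: measurable_indic.
apply: (measurableT_comp (measurable_powR _)).
by apply: measurable_funB => //; exact: measurable_funX.
Qed.

HB.instance Definition _ := isMeasure.Build _ _ _ equilibrium_measure
  equilibrium_measure0 equilibrium_measure_ge0 equilibrium_measure_sigma_additive.

End EquilibriumMeasure.

(* Main.v *)
Require Import Defs.
From mathcomp Require Import all_boot all_order all_algebra.
From mathcomp Require Import all_classical all_reals all_analysis.
From mathcomp Require Import measurable_realfun polyrcf.
From mathcomp Require Import ring lra zify.

Set Implicit Arguments.
Unset Strict Implicit.
Unset Printing Implicit Defensive.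

Import Order.TTheory GRing.Theory Num.Theory.
Import numFieldNormedType.Exports.

Local Open Scope classical_set_scope.
Local Open Scope ring_scope.

(** A measure on a bounded set is determined by its moments, and the moments of
    the mean measures are combinatorial quantities of the recurrence coefficients.

    With respect to the basis [p i], multiplication by [x] is the Jacobi matrix
    with diagonal [a i] and off-diagonal [b i], so the [m]th moment of
    [(p i k) ^ 2 d(mu i)] is the diagonal entry [(k, k)] of its [m]th power, a
    sum over paths of [m] steps around [k]. On average the coefficients vary slowly,
    hence all indices along a path may be replaced by [k]; monomials containing a
    power of [a i k] disappear in the mean and there remain, for even [m], the
    binomial([m], [m / 2]) paths with as many steps up as down, each of weight
    [b i k ^ m] ([jacobi_diagonal_mean]), and for odd [m] none. By hypothesis
    the mean of [b i k ^ m] is explicit, and the product is the [m]th moment of the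
    normalized weight [(1 - x ^ 2) ^ ((alpha - 1) / 2)]: both obey the recursion
    which for the moments results from an integration by parts
    ([walks_equilibrium_moment]).

    The bounded coefficients confine all the measures, and all the roots, to one
    segment [`[- L, L]] ([support_bound], [op_root_le]), which may be larger than
    [`[-1, 1]]. A function continuous on [`[-1, 1]] and merely bounded on the rest of
    [`[- L, L]] is squeezed between two polynomials with nearly equal equilibrium
    integrals: Bernstein polynomials approximate a continuous extension, and a
    term [2 B x ^ (2 N)] takes care of the outside at little cost, the even moments
    tending to 0 ([polynomial_sandwich]). As all the means in question are monotone,
    their limits on polynomials determine their limits on such functions
    ([equilibrium_squeeze]). This gives the weak limit and the first formula.

    Summing the Cesaro means over partial sums raises the order of the method by one
    ([averaged_partial_sums_cvg]), whence the formula for the kernel. For the roots,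
    Gauss quadrature shows that their [m]th power sum differs from the sum of the
    first diagonal entries of the [m]th power of the Jacobi matrix by at most a
    constant ([power_sum_roots]), and bounded errors vanish in the average
    ([averaged_perturbation]).

    For the mass, integration by parts gives the ratio of its values at [alpha + 2]
    and [alpha]. The claimed expression satisfies the same relation, and the
    quotient of the two, being 2-periodic and asymptotically invariant under shifts,
    is constant; this is the argument by which log-convexity characterizes the Gamma
    function. Its value is read off at [alpha = 2], half a disk
    ([equilibrium_mass_formula]). *)

(** * Limits of sequences and the Gamma function *)

Section IntegrationTools.
Context {R : realType}.
Notation leb := (@lebesgue_measure R).

(** Monotone convergence; a uniform bound on the truncated integrals is what
    gives integrability on [D]. *)
Lemma Rintegral_exhaustion (f : R -> R) (F : (set R)^nat) (D : set R) (M : R) :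
  measurable_fun [set: R] f -> (forall x, D x -> 0 <= f x) ->
  nondecreasing_seq F -> (forall n, measurable (F n)) -> \bigcup_n F n = D ->
  (forall n, leb.-integrable (F n) (EFin \o f)) ->
  (forall n, \int[leb]_(x in F n) f x <= M) ->
  leb.-integrable D (EFin \o f) /\
  \int[leb]_(x in F n) f x @[n --> \oo] --> \int[leb]_(x in D) f x.
Proof.
move=> mf f0 ndF mF FD iF bF.
have mEf A : measurable_fun A (EFin \o f).
  by apply/measurable_EFinP; exact: measurable_funTS.
have cvF : (\int[leb]_(x in F n) (f x)%:E)%E @[n --> \oo] -->
    (\int[leb]_(x in D) (f x)%:E)%E.
  rewrite -FD; apply: ge0_nondecreasing_set_cvg_integral => //.
  - by move=> i; exact/measurable_EFinP/measurable_funTS.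
  - by move=> i x Fx; rewrite lee_fin f0// -FD; exists i.
have FE n : (\int[leb]_(x in F n) (f x)%:E)%E = (\int[leb]_(x in F n) f x)%:E.
  by rewrite /Rintegral fineK//; apply: integrable_fin_num; [exact: mF|exact: iF].
have leM : (\int[leb]_(x in D) (f x)%:E <= M%:E)%E.
  rewrite -(cvg_lim _ cvF)//; apply: lime_le; first by apply/cvg_ex; eexists; exact: cvF.
  by apply: nearW => n; rewrite FE lee_fin.
have mD : measurable D by rewrite -FD; exact: bigcup_measurable.
have iD : leb.-integrable D (EFin \o f).
  apply/integrableP; split; first exact: mEf.
  have -> : (\int[leb]_(x in D) `|(EFin \o f) x|)%E = (\int[leb]_(x in D) (f x)%:E)%E.
    apply: eq_integral => x /set_mem Dx; rewrite gee0_abs// lee_fin f0//.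
  by rewrite (le_lt_trans leM)// ltry.
split => //; apply: fine_cvg; rewrite fineK; first exact: cvF.
by apply: integrable_fin_num; [exact: mD|exact: iD].
Qed.

Lemma cvgn_eq (u : R^nat) (a b : R) :
  u n @[n --> \oo] --> a -> u n @[n --> \oo] --> b -> a = b.
Proof. by move=> ua ub; apply: (cvg_unique _ ua ub); exact: Rhausdorff. Qed.

Lemma cvgnD (u v : R^nat) (a b : R) : u n @[n --> \oo] --> a ->
  v n @[n --> \oo] --> b -> (u n + v n) @[n --> \oo] --> a + b.
Proof. exact: cvgD. Qed.

Lemma cvgnB (u v : R^nat) (a b : R) : u n @[n --> \oo] --> a ->
  v n @[n --> \oo] --> b -> (u n - v n) @[n --> \oo] --> a - b.
Proof. exact: cvgB. Qed.

Lemma cvgnM (u v : R^nat) (a b : R) : u n @[n --> \oo] --> a ->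
  v n @[n --> \oo] --> b -> (u n * v n) @[n --> \oo] --> a * b.
Proof. exact: cvgM. Qed.

Lemma cvgnZ (c : R) (u : R^nat) (a : R) : u n @[n --> \oo] --> a ->
  (c * u n) @[n --> \oo] --> c * a.
Proof. by move=> ua; apply: cvgnM => //; exact: cvg_cst. Qed.
Arguments cvgnZ c {u a} _.

Lemma cvgn_ext (u v : R^nat) (a : R) : u =1 v ->
  u n @[n --> \oo] --> a -> v n @[n --> \oo] --> a.
Proof. by move=> /funext ->. Qed.

Lemma cvgn_cst (a : R) : (fun=> a) n @[n --> \oo] --> a.
Proof. exact: cvg_cst. Qed.
Arguments cvgn_cst a : clear implicits.

Lemma cvgnX (u : R^nat) (a : R) k : u n @[n --> \oo] --> a ->
  (u n ^+ k) @[n --> \oo] --> a ^+ k.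
Proof.
move=> ua; elim: k => [|k IH]; first by under eq_fun do rewrite expr0; rewrite expr0; exact: cvg_cst.
by under eq_fun do rewrite exprS; rewrite exprS; exact: cvgnM.
Qed.
Arguments cvgnX {u a} k _.

Lemma cvgnV (u : R^nat) (a : R) : a != 0 -> u n @[n --> \oo] --> a ->
  (u n)^-1 @[n --> \oo] --> a^-1.
Proof. by move=> a0 ua; apply: cvgV. Qed.

Lemma cvgn_le (u : R^nat) (a b : R) : u n @[n --> \oo] --> a ->
  (forall n, u n <= b) -> a <= b.
Proof.
move=> ua ub; rewrite -(cvg_lim (@Rhausdorff R) ua); apply: limr_le; last exact: nearW.
by apply/cvg_ex; exists a.
Qed.

Lemma cvgn_ge (u : R^nat) (a b : R) : u n @[n --> \oo] --> a ->
  (forall n, b <= u n) -> b <= a.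
Proof.
move=> ua ub; rewrite -lerN2; apply: (@cvgn_le (fun n => - u n)); first exact: cvgN.
by move=> n; rewrite lerN2.
Qed.

Lemma squeezen (l u v : R^nat) (a : R) : (forall n, l n <= v n <= u n) ->
  l n @[n --> \oo] --> a -> u n @[n --> \oo] --> a -> v n @[n --> \oo] --> a.
Proof. by move=> h; apply: squeeze_cvgr; exact: nearW. Qed.

Lemma cvg_invn (c d : R) : 0 < c -> 0 < d ->
  ((c + d * n%:R)^-1) @[n --> \oo] --> (0 : R).
Proof.
move=> c0 d0; pose m := Num.min c d.
have m0 : 0 < m by rewrite lt_min c0 d0.
apply: (@squeezen (fun=> 0) (fun n => m^-1 * harmonic n)).
- move=> n; have k : m * n.+1%:R <= c + d * n%:R.
    rewrite -natr1 mulrDr mulr1 addrC lerD// ?ge_min ?lexx//.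
    by rewrite ler_wpM2r// ge_min lexx orbT.
  have k0 : 0 < m * n.+1%:R by rewrite mulr_gt0.
  rewrite invr_ge0 (le_trans (ltW k0) k)/= /harmonic/= -invfM.
  by rewrite lef_pV2 ?posrE// (lt_le_trans k0).
- exact: cvg_cst.
- by have := cvgnZ m^-1 (@cvg_harmonic R); rewrite mulr0; apply.
Qed.

Lemma FTC_segment (f F : R -> R) (a b : R) : a < b ->
  (forall x, a <= x <= b -> is_derive x 1 F (f x)) ->
  (forall x, a <= x <= b -> {for x, continuous f}) ->
  leb.-integrable `[a, b] (EFin \o f) /\
  \int[leb]_(x in `[a, b]) f x = F b - F a.
Proof.
move=> ab dF cf.
have cF x : a <= x <= b -> {for x, continuous F}.
  move=> xab; have dx := dF _ xab.
  by apply/differentiable_continuous/derivable1_diffP; exact: ex_derive.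
have wf : {within `[a, b], continuous f}.
  apply: continuous_in_subspaceT => x; rewrite inE/= in_itv/= => xab.
  exact: cf.
split; first by apply: continuous_compact_integrable => //; exact: segment_compact.
have ab' : a <= a <= b by rewrite lexx ltW.
have ab2 : a <= b <= b by rewrite lexx ltW.
rewrite /Rintegral (continuous_FTC2 (F := F))//.
- split.
  + move=> x; rewrite in_itv/= => /andP[xa xb].
    have xab : a <= x <= b by rewrite !ltW.
    by have dx := dF _ xab; exact: ex_derive.
  + exact/cvg_at_right_filter/cF.
  + exact/cvg_at_left_filter/cF.
- move=> x; rewrite in_itv/= => /andP[xa xb].
  have xab : a <= x <= b by rewrite !ltW.
  by have dx := dF _ xab; rewrite derive1E derive_val.
Qed.

End IntegrationTools.
Arguments cvgnZ {R} c {u a} _.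
Arguments cvgn_cst {R} a.
Arguments cvgnX {R u a} k _.

Section GammaFunction.
Context {R : realType}.
Notation leb := (@lebesgue_measure R).

Definition gamma_integrand (x t : R) : R := t `^ (x - 1) * expR (- t).

Lemma gamma_integrand_ge0 x t : 0 <= gamma_integrand x t.
Proof. by rewrite mulr_ge0 ?powR_ge0 ?expR_ge0. Qed.

Lemma measurable_gamma_integrand x : measurable_fun [set: R] (gamma_integrand x).
Proof.
apply: measurable_funM => //.
by apply: measurableT_comp => //.
Qed.

Lemma continuous_gamma_integrand (x t : R) : 0 < t ->
  {for t, continuous (gamma_integrand x)}.
Proof.
move=> t0; apply: differentiable_continuous; apply/derivable1_diffP.
apply: derivableM; first by apply: derivable_powR; rewrite in_itv/= t0.
exact: ex_derive.
Qed.

Lemma integrable_gamma_integrand_segment (x u v : R) : 0 < u ->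
  leb.-integrable `[u, v] (EFin \o gamma_integrand x).
Proof.
move=> u0; apply: continuous_compact_integrable; first exact: segment_compact.
apply: continuous_in_subspaceT => t; rewrite inE/= in_itv/= => /andP[ut _].
by apply: continuous_gamma_integrand; exact: lt_le_trans ut.
Qed.

(** Integration of the derivative of [t `^ x * expR (- t)]. *)
Lemma gamma_parts_segment (x u v : R) : 0 < u -> u < v ->
  x * \int[leb]_(t in `[u, v]) gamma_integrand x t =
  \int[leb]_(t in `[u, v]) gamma_integrand (x + 1) t +
  v `^ x * expR (- v) - u `^ x * expR (- u).
Proof.
move=> u0 uv.
pose f t := x * gamma_integrand x t - gamma_integrand (x + 1) t.
have dF t : u <= t <= v -> is_derive t 1 (fun t => t `^ x * expR (- t)) (f t).
  move=> /andP[ut _]; have t0 := lt_le_trans u0 ut.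
  have d1 := is_derive1_powR x t0.
  have d2 : is_derive t 1 (fun t => expR (- t)) (- expR (- t)).
    have := is_derive1_comp (is_derive_expR (- t)) (is_deriveNid t 1).
    by rewrite mulrN1.
  apply: (is_derive_eq (is_deriveM d1 d2)).
  rewrite /f /gamma_integrand addrK /GRing.scale/=.
  by ring.
have cf t : u <= t <= v -> {for t, continuous f}.
  move=> /andP[ut _]; have t0 := lt_le_trans u0 ut.
  apply: continuousB; last exact: continuous_gamma_integrand.
  by apply: continuousM; [exact: cvg_cst|exact: continuous_gamma_integrand].
have [_] := FTC_segment uv dF cf.
have ig y := @integrable_gamma_integrand_segment y u v u0.
rewrite RintegralB//=; last exact: (integrableZl _ x (ig x)).
rewrite RintegralZl//.
by move=> /eqP; rewrite subr_eq => /eqP ->; ring.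
Qed.

(** The bound [y <= expR y] at [y = t / (2 x)] lets half of the exponential
    absorb the power. *)
Lemma gamma_integrand_le (x t : R) : 0 < x -> 0 < t ->
  gamma_integrand (x + 1) t <= (2 * x) `^ x * expR (- (t / 2)).
Proof.
move=> x0 t0; rewrite /gamma_integrand addrK.
have [y -> y0] : exists2 y, t = 2 * x * y & 0 <= y.
  exists (t / (2 * x)); last by rewrite divr_ge0 ?mulr_ge0 ?ltW.
  by rewrite mulrC divfK// mulf_neq0// gt_eqF.
have x20 : 0 <= 2 * x by rewrite mulr_ge0 ?ltW.
rewrite powRM// -mulrA ler_wpM2l ?powR_ge0//.
have yx : y `^ x <= expR (x * y).
  rewrite mulrC expRM; apply: ge0_ler_powR; rewrite ?nnegrE ?expR_ge0 ?(ltW x0)//.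
  by apply: le_trans (expR_ge1Dx y); rewrite lerDr.
apply: (@le_trans _ _ (expR (x * y) * expR (- (2 * x * y)))).
  by rewrite ler_wpM2r ?expR_ge0.
by rewrite -expRD ler_expR; lra.
Qed.

Lemma gamma_set_segments :
  \bigcup_n [set` `[(n.+2%:R)^-1 : R, n.+2%:R]] = `]0, +oo[%classic.
Proof.
apply/seteqP; split => [x [n _] /=|x /=]; rewrite !in_itv/= ?andbT.
  by move=> /andP[+ _]; apply: lt_le_trans; rewrite invr_gt0.
move=> x0; exists (Num.truncn x + Num.truncn x^-1)%N => //=; rewrite in_itv/=.
have x1 : 0 <= x by rewrite ltW.
have xV : 0 <= x^-1 by rewrite invr_ge0.
apply/andP; split; last first.
  by rewrite (le_trans (ltW (truncnS_gt _)))// ler_nat ltnW// !ltnS leq_addr.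
rewrite -[leRHS]invrK lef_pV2 ?posrE ?invr_gt0//.
by rewrite (le_trans (ltW (truncnS_gt _)))// ler_nat ltnW// !ltnS leq_addl.
Qed.

Let seg (n : nat) : set R := [set` `[(n.+2%:R)^-1 : R, n.+2%:R]].

Lemma gamma_seg_gt0 n : (0 : R) < (n.+2%:R)^-1.
Proof. by rewrite invr_gt0. Qed.

Lemma gamma_seg_lt n : (n.+2%:R)^-1 < n.+2%:R :> R.
Proof. by rewrite (@lt_trans _ _ 1)// ?invf_lt1// ltr1n. Qed.

Lemma gamma_seg_nondecreasing : nondecreasing_seq seg.
Proof.
move=> n m nm; rewrite subsetEset /seg => x /=; rewrite !in_itv/=.
move=> /andP[ux xv]; apply/andP; split.
  by apply: le_trans ux; rewrite lef_pV2 ?posrE// ler_nat; lia.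
by apply: (le_trans xv); rewrite ler_nat; lia.
Qed.

Lemma integral_seg_le (x : R) n : 0 < x ->
  \int[leb]_(t in seg n) gamma_integrand (x + 1) t <= 2 * (2 * x) `^ x.
Proof.
move=> x0; set K := (2 * x) `^ x.
have K0 : 0 <= K by exact: powR_ge0.
pose f (t : R) := K * expR (- (t / 2)).
have dE (t : R) : is_derive t 1 (fun t => expR (- (t / 2))) (- (expR (- (t / 2)) / 2)).
  have h : is_derive t 1 (fun t : R => - (t / 2)) (- (1 / 2)).
    apply: is_deriveN; have := is_deriveZ (2^-1 : R) (is_derive_id t (1:R)).
    rewrite /GRing.scale/= mulrC; congr (is_derive _ _ _ _).
    by apply/funext => y; rewrite /= mulrC.
  have := @is_derive1_comp R expR (fun t => - (t / 2)) _ _ _ (is_derive_expR (- (t / 2))) h.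
  by rewrite mulrN mul1r.
have dF (t : R) : (n.+2%:R)^-1 <= t <= n.+2%:R ->
    is_derive t 1 (fun t : R => - (2 * K) * expR (- (t / 2))) (f t).
  move=> _; apply: (is_derive_eq (is_deriveZ _ (dE t))).
  by rewrite /f /GRing.scale/=; field.
have cf (t : R) : (n.+2%:R)^-1 <= t <= n.+2%:R -> {for t, continuous f}.
  move=> _; apply: continuousM; first exact: cvg_cst.
  apply: differentiable_continuous; apply/derivable1_diffP.
  by have d := dE t; exact: ex_derive.
have [ig Ig] := FTC_segment (gamma_seg_lt n) dF cf.
apply: (@le_trans _ _ (\int[leb]_(t in seg n) f t)).
  apply: le_Rintegral => //.
  - exact: measurable_itv.
  - by apply: integrable_gamma_integrand_segment; exact: gamma_seg_gt0.
  - move=> t; rewrite /seg /= in_itv/= => /andP[ut _].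
    by apply: gamma_integrand_le => //; apply: lt_le_trans ut; exact: gamma_seg_gt0.
rewrite Ig.
have e1 : expR (- ((n.+2%:R)^-1 / 2)) <= 1 :> R.
  by rewrite expR_le1 oppr_le0 divr_ge0// ltW// gamma_seg_gt0.
have e2 : 0 <= expR (- (n.+2%:R / 2)) :> R by exact: expR_ge0.
by rewrite -mulrBr mulNr -mulrN ler_piMr ?mulr_ge0//; lra.
Qed.

Lemma gamma_end_le (x : R) n : 0 < x ->
  n.+2%:R `^ x * expR (- n.+2%:R) <= 2 * (2 * x) `^ x * harmonic n :> R.
Proof.
move=> x0; have := @gamma_integrand_le x n.+2%:R x0 (ltr0Sn _ _).
rewrite /gamma_integrand addrK => /le_trans; apply.
rewrite [leRHS]mulrAC [leRHS]mulrC ler_wpM2l ?powR_ge0// expRN.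
rewrite /harmonic/= -[leRHS]invrK lef_pV2 ?posrE ?expR_gt0 ?invr_gt0 ?mulr_gt0 ?invr_gt0//.
apply: le_trans (expR_ge1Dx _).
by rewrite invfM invrK -[n.+2]addn1 -[n.+1]addn1 !natrD; lra.
Qed.

(** Truncating away from 0 and from infinity makes the fundamental theorem of
    calculus available; integration by parts turns the possible singularity at 0
    into the boundedness of the integral of order [x + 1]. *)
Lemma Gamma_exhaustion (x : R) : 0 < x ->
  leb.-integrable `]0, +oo[ (EFin \o gamma_integrand x) /\
  \int[leb]_(t in seg n) gamma_integrand x t @[n --> \oo] --> Gamma x.
Proof.
move=> x0; apply: (@Rintegral_exhaustion R _ _ _ (x^-1 * (2 * (2 * x) `^ x + 2 * (2 * x) `^ x))).
- exact: measurable_gamma_integrand.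
- by move=> t _; exact: gamma_integrand_ge0.
- exact: gamma_seg_nondecreasing.
- by move=> n; exact: measurable_itv.
- exact: gamma_set_segments.
- by move=> n; apply: integrable_gamma_integrand_segment; exact: gamma_seg_gt0.
move=> n; rewrite ler_pdivlMl// gamma_parts_segment ?gamma_seg_gt0 ?gamma_seg_lt//.
rewrite -addrA lerD ?integral_seg_le// lerBlDr.
apply: (le_trans (gamma_end_le n x0)); rewrite -[leLHS]addr0 lerD//.
  rewrite ler_piMr ?mulr_ge0 ?powR_ge0//.
  by rewrite /harmonic/= invf_le1// ler1n.
Qed.

Lemma GammaS (x : R) : 0 < x -> Gamma (x + 1) = x * Gamma x.
Proof.
move=> x0; have x10 : 0 < x + 1 by rewrite addr_gt0.
have [_ c1] := Gamma_exhaustion x10; have [_ c0] := Gamma_exhaustion x0.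
have cv : (n.+2%:R `^ x * expR (- n.+2%:R) : R) @[n --> \oo] --> 0.
  apply: (@squeeze_cvgr _ _ _ _ (cst 0) (fun n => 2 * (2 * x) `^ x * harmonic n)).
  - by apply: nearW => n; rewrite gamma_end_le// andbT mulr_ge0 ?powR_ge0 ?expR_ge0.
  - exact: cvg_cst.
  - by rewrite -[X in _ --> X](mulr0 (2 * (2 * x) `^ x)); apply: cvgMr; exact: cvg_harmonic.
have cu : (n.+2%:R^-1 `^ x * expR (- n.+2%:R^-1) : R) @[n --> \oo] --> 0.
  have uc : (n.+2%:R^-1 `^ x : R) @[n --> \oo] --> 0.
    have /cvg_at_rightP := @powR_cvg0 R x x0; apply; split; first exact: gamma_seg_gt0.
    by have := @cvg_harmonic R; rewrite -cvg_shiftS.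
  apply: (@squeeze_cvgr _ _ _ _ (cst 0) (fun n => n.+2%:R^-1 `^ x)) => //.
  - by apply: nearW => n; rewrite mulr_ge0 ?powR_ge0 ?expR_ge0//= ler_piMr ?powR_ge0.
  - exact: cvg_cst.
apply: (@cvgn_eq R (fun n => x * \int[leb]_(t in seg n) gamma_integrand x t)).
  under eq_fun do rewrite gamma_parts_segment ?gamma_seg_gt0 ?gamma_seg_lt//.
  by have h := cvgB (cvgD c1 cv) cu; rewrite addr0 subr0 in h; apply: h.
by apply: cvgM => //; exact: cvg_cst.
Qed.

Lemma Gamma1 : Gamma 1 = 1 :> R.
Proof.
have [_ c1] := Gamma_exhaustion (@ltr01 R).
have I1 n : \int[leb]_(t in seg n) gamma_integrand 1 t =
    expR (- n.+2%:R^-1) - expR (- n.+2%:R).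
  have [|t|_ ->] := @FTC_segment R (gamma_integrand 1) (fun t => - expR (- t)) _ _ (gamma_seg_lt n).
  - move=> t _; have := is_derive1_comp (is_derive_expR (- t)) (is_deriveNid t 1).
    rewrite mulrN1 => /is_deriveN; rewrite opprK /gamma_integrand subrr powRr0 mul1r.
    exact.
  - move=> /andP[ut _]; apply: continuous_gamma_integrand.
    exact: lt_le_trans (gamma_seg_gt0 n) ut.
  by rewrite opprK addrC.
have cN (u : nat -> R) (l : R) : u n @[n --> \oo] --> l -> expR (- u n) @[n --> \oo] --> expR (- l).
  move=> /cvgN ul; apply: (@cvg_comp _ _ _ (fun n => - u n) expR _ (nbhs (- l))) => //.
  exact: continuous_expR.
have cv : (expR (- n.+2%:R) : R) @[n --> \oo] --> 0.
  by have := @cvgn_expR R; rewrite -(cvg_shiftn 2); under eq_fun do rewrite addn2.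
have cu : (expR (- n.+2%:R^-1) : R) @[n --> \oo] --> expR (- 0).
  by apply: cN; have := @cvg_harmonic R; rewrite -cvg_shiftS.
apply: (cvgn_eq c1); under eq_fun do rewrite I1.
rewrite oppr0 expR0 in cu.
by have := cvgB cu cv; rewrite subr0; apply.
Qed.

Lemma Gamma_gt0 (x : R) : 0 < x -> 0 < Gamma x.
Proof.
move=> x0; suff big (y : R) : 1 <= y -> 0 < Gamma y.
  have x10 : 1 <= x + 1 by rewrite lerDr ltW.
  by have := big _ x10; rewrite GammaS// pmulr_rgt0.
move=> y1; have y0 := lt_le_trans ltr01 y1; have [ig _] := Gamma_exhaustion y0.
apply: (@lt_le_trans _ _ (\int[leb]_(t in `[1, 2]) expR (- t))).
  have ab12 : (1 : R) < 2 by rewrite ltr1n.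
  have [|t _|_ ->] := @FTC_segment R (fun t => expR (- t)) (fun t => - expR (- t)) 1 2 ab12.
  - move=> t _; have := is_derive1_comp (is_derive_expR (- t)) (is_deriveNid t 1).
    by rewrite mulrN1 => /is_deriveN; rewrite opprK.
  - by apply: continuous_comp; [exact: opp_continuous|exact: continuous_expR].
  by rewrite opprK addrC subr_gt0 ltr_expR ltrN2.
apply: (@le_trans _ _ (\int[leb]_(t in `[1, 2]) gamma_integrand y t)).
  apply: le_Rintegral => //.
  - apply: continuous_compact_integrable; first exact: segment_compact.
    apply: continuous_subspaceT => t.
    by apply: continuous_comp; [exact: opp_continuous|exact: continuous_expR].
  - exact: integrable_gamma_integrand_segment.
  - move=> t; rewrite /= in_itv/= => /andP[t1 _].
    rewrite ler_peMl ?expR_ge0// -[leLHS](powRr0 t).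
    by rewrite ler_powR// subr_ge0.
rewrite /Gamma /Rintegral; apply: fine_le.
- apply: integrable_fin_num => //; exact: integrable_gamma_integrand_segment.
- by apply: integrable_fin_num => //; exact: ig.
apply: ge0_subset_integral => //.
- by apply/measurable_EFinP; apply: measurable_funTS; exact: measurable_gamma_integrand.
- by move=> t _; rewrite lee_fin gamma_integrand_ge0.
- by move=> t; rewrite /= !in_itv/= andbT => /andP[t1 _]; apply: lt_le_trans t1.
Qed.

(** Convexity of [log Gamma] between [x] and [x + 1]: integrate the weighted
    arithmetic-geometric inequality for [t] and [x]. *)
Lemma Gamma_add_le (x s : R) : 0 < x -> 0 < s < 1 ->
  Gamma (x + s) <= x `^ s * Gamma x.
Proof.
move=> x0 /andP[s0 s1].
have xs0 : 0 < x + s by rewrite addr_gt0.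
have x10 : 0 < x + 1 by rewrite addr_gt0.
have [i0 _] := Gamma_exhaustion x0; have [i1 _] := Gamma_exhaustion x10.
have [ixs _] := Gamma_exhaustion xs0.
have amgm (t : R) : 0 < t -> t `^ s <= x `^ s * (1 - s) + x `^ s / x * s * t.
  move=> t0; have y0 : 0 <= t / x by rewrite divr_ge0 ?(ltW t0) ?(ltW x0).
  have s'0 : 0 < 1 - s by rewrite subr_gt0.
  have := @conjugate_powR R ((t / x) `^ s) 1 s^-1 (1 - s)^-1 (powR_ge0 _ _) ler01.
  rewrite !invr_gt0 !invrK subrKC => /(_ s0 s'0 erefl).
  rewrite -powRrM divff ?gt_eqF// powRr1// powR1 mul1r mulr1.
  rewrite -(ler_pM2l (powR_gt0 s x0)) -powRM ?(ltW x0)//.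
  rewrite mulrCA divff ?gt_eqF// mulr1 => /le_trans; apply.
  by rewrite le_eqVlt; apply/orP; left; apply/eqP; ring.
have le1 : Gamma (x + s) <= \int[leb]_(t in `]0, +oo[)
    (x `^ s * (1 - s) * gamma_integrand x t + x `^ s / x * s * gamma_integrand (x + 1) t).
  apply: le_Rintegral => //.
  - by apply: (integrableD _ (integrableZl _ _ i0) (integrableZl _ _ i1)).
  move=> t; rewrite /= in_itv/= andbT => t0.
  rewrite /gamma_integrand addrK.
  have -> : t `^ x = t * t `^ (x - 1) by rewrite mulr_powRB1// ltW.
  have -> : x + s - 1 = x - 1 + s by ring.
  rewrite (@powRD R t (x - 1) s); last first.
    by apply/implyP => _; rewrite gt_eqF.
  have := amgm t t0.
  have k0 : 0 <= t `^ (x - 1) * expR (- t) by rewrite mulr_ge0 ?powR_ge0 ?expR_ge0.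
  move=> /(ler_wpM2r k0) h.
  have -> : t `^ (x - 1) * t `^ s * expR (- t) =
    t `^ s * (t `^ (x - 1) * expR (- t)) by ring.
  apply: (le_trans h).
  by rewrite le_eqVlt; apply/orP; left; apply/eqP; ring.
apply: (le_trans le1); rewrite RintegralD//; last 2 first.
- exact: (integrableZl _ _ i0).
- exact: (integrableZl _ _ i1).
rewrite !RintegralZl// -!/(Gamma _) GammaS//.
rewrite le_eqVlt; apply/orP; left; apply/eqP; field.
by rewrite gt_eqF.
Qed.

End GammaFunction.

(** * Moments and mass of the equilibrium weight *)

Section EquilibriumMoments.
Context {R : realType}.
Notation leb := (@lebesgue_measure R).
Implicit Types (alpha x : R).

Definition moment_integrand alpha (j : nat) (x : R) : R :=
  x ^+ j * equilibrium_weight alpha x.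

Definition wmoment alpha (j : nat) : R :=
  \int[leb]_(x in `]-1, 1[) moment_integrand alpha j x.

(** The weight is smooth on each [`[- rad n, rad n]], and these segments exhaust
    [`]-1, 1[]. *)
Definition rad (n : nat) : R := 1 - (n.+2%:R)^-1.
Definition rad_seg (n : nat) : set R := [set` `[- rad n, rad n]].

Lemma rad_gt0 n : 0 < rad n.
Proof. by rewrite subr_gt0 invf_lt1// ltr1n. Qed.

Lemma rad_lt1 n : rad n < 1.
Proof. by rewrite ltrBlDr ltrDl invr_gt0. Qed.

Lemma cvg_rad : rad n @[n --> \oo] --> (1 : R).
Proof.
have := @cvg_harmonic R; rewrite -cvg_shiftS => h.
by have := cvgB (cvg_cst (1 : R)) h; rewrite subr0; apply.
Qed.

Lemma bigcup_rad_segments : \bigcup_n rad_seg n = `]-1, 1[%classic.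
Proof.
apply/seteqP; split => [x [n _]|x]; rewrite /rad_seg /= !in_itv/=.
  by move=> /andP[h1 h2]; have := rad_lt1 n; lra.
move=> /andP[h1 h2].
have x1 : 0 < 1 - `|x| by rewrite subr_gt0 ltr_norml h1 h2.
exists (Num.truncn (1 - `|x|)^-1) => //=; rewrite in_itv/= -ler_norml.
rewrite /rad lerBrDr addrC -lerBrDr -[leRHS]invrK lef_pV2 ?posrE ?invr_gt0//.
by rewrite (le_trans (ltW (truncnS_gt _)))// ler_nat.
Qed.

Lemma rad_seg_nondecreasing : nondecreasing_seq rad_seg.
Proof.
move=> n m nm; rewrite subsetEset /rad_seg => x /=; rewrite !in_itv/= -!ler_norml.
move=> /le_trans; apply; rewrite /rad lerD2l lerN2 lef_pV2 ?posrE// ler_nat; lia.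
Qed.

Lemma onemsqr_gt0 n x : - rad n <= x <= rad n -> 0 < 1 - x ^+ 2.
Proof. by have := rad_lt1 n; have := rad_gt0 n; nra. Qed.

Lemma measurable_moment_integrand alpha j :
  measurable_fun [set: R] (moment_integrand alpha j).
Proof.
apply: measurable_funM; first exact: measurable_funX.
apply: (measurableT_comp (measurable_powR _)).
by apply: measurable_funB => //; exact: measurable_funX.
Qed.

Lemma is_derive_exprn j x : is_derive x 1 (fun x : R => x ^+ j) (j%:R * x ^+ j.-1).
Proof.
have := is_deriveX j (is_derive_id x (1 : R)).
have -> : (fun x : R => x ^+ j) = (id : R -> R) ^+ j by apply/funext => y; rewrite exprfctE.
by rewrite /GRing.scale/= mulr1.
Qed.

Lemma is_derive_onemsqr_powR (b x : R) : 0 < 1 - x ^+ 2 ->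
  is_derive x 1 (fun x : R => (1 - x ^+ 2) `^ b)
    (b * (1 - x ^+ 2) `^ (b - 1) * - (2 * x)).
Proof.
move=> x1; have h : is_derive x 1 (fun x : R => 1 - x ^+ 2) (- (2 * x)).
  have := is_deriveB (is_derive_cst (1 : R) x (1 : R)) (is_derive_exprn 2 x).
  by rewrite sub0r expr1.
exact: (@is_derive1_comp R (fun y => y `^ b) (fun x => 1 - x ^+ 2) x _ _ (is_derive1_powR b x1) h).
Qed.

Lemma continuous_moment_integrand alpha j x : 0 < 1 - x ^+ 2 ->
  {for x, continuous (moment_integrand alpha j)}.
Proof.
move=> x1; apply: continuousM; first exact: exprn_continuous.
apply: differentiable_continuous; apply/derivable1_diffP.
by have d := is_derive_onemsqr_powR ((alpha - 1) / 2) x1; exact: ex_derive.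
Qed.

Lemma integrable_moment_seg alpha j n :
  leb.-integrable (rad_seg n) (EFin \o moment_integrand alpha j).
Proof.
apply: continuous_compact_integrable; first exact: segment_compact.
apply: continuous_in_subspaceT => t /set_mem; rewrite /rad_seg/= in_itv/= => tn.
by apply: continuous_moment_integrand; exact: onemsqr_gt0 tn.
Qed.

(** Integration of the derivative of [x ^ i (1 - x ^ 2) ^ ((alpha + 1) / 2)]. *)
Lemma moment_parts_seg alpha i n :
  i%:R * \int[leb]_(x in rad_seg n) moment_integrand alpha i.-1 x -
  (i%:R + alpha + 1) * \int[leb]_(x in rad_seg n) moment_integrand alpha i.+1 x =
  (rad n ^+ i - (- rad n) ^+ i) * (1 - rad n ^+ 2) `^ ((alpha + 1) / 2).
Proof.
pose f x := i%:R * moment_integrand alpha i.-1 x -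
            (i%:R + alpha + 1) * moment_integrand alpha i.+1 x.
pose F (x : R) := x ^+ i * (1 - x ^+ 2) `^ ((alpha + 1) / 2).
have ab : - rad n < rad n by have := rad_gt0 n; lra.
have bb : (alpha + 1) / 2 - 1 = (alpha - 1) / 2 by field.
have dF x : - rad n <= x <= rad n -> is_derive x 1 F (f x).
  move=> /onemsqr_gt0 x1.
  have d := is_deriveM (is_derive_exprn i x) (is_derive_onemsqr_powR ((alpha + 1) / 2) x1).
  apply: (is_derive_eq d).
  rewrite /f /moment_integrand /GRing.scale/= bb -/(equilibrium_weight alpha x).
  have -> : (1 - x ^+ 2) `^ ((alpha + 1) / 2) = (1 - x ^+ 2) * equilibrium_weight alpha x.
    rewrite -[in LHS](subrK 1 ((alpha + 1) / 2)) bb powRD; last first.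
      by apply/implyP => _; rewrite gt_eqF.
    by rewrite powRr1 ?(ltW x1)// mulrC.
  case: i {f F d} => [|i] /=; first by rewrite !expr0; field.
  by rewrite !exprS -natr1; field.
have cf x : - rad n <= x <= rad n -> {for x, continuous f}.
  move=> /onemsqr_gt0 x1; apply: continuousB; (apply: continuousM; first exact: cvg_cst);
    exact: continuous_moment_integrand.
have [_] := FTC_segment ab dF cf.
have im k := @integrable_moment_seg alpha k n.
have ms : measurable (rad_seg n : set (measurableTypeR R)) by exact: measurable_itv.
rewrite -/(rad_seg n) RintegralB//; last 2 first.
- exact: (integrableZl ms _ (im i.-1)).
- exact: (integrableZl ms _ (im i.+1)).
rewrite (RintegralZl _ ms (im i.-1)) (RintegralZl _ ms (im i.+1)) => ->.
by rewrite /F sqrrN mulrBl.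
Qed.

(** With [S] and [T] the truncated moments of order 0 and 2, the difference
    [S - T] integrates [(1 - x ^ 2) ^ ((alpha + 1) / 2) <= 1], while integration
    by parts yields [(alpha + 2) T <= S]. *)
Lemma wmoment0_seg_le alpha n : 0 < alpha ->
  \int[leb]_(x in rad_seg n) moment_integrand alpha 0%N x <= 4.
Proof.
move=> a0.
have ms : measurable (rad_seg n : set (measurableTypeR R)) by exact: measurable_itv.
have im k := @integrable_moment_seg alpha k n.
have r0 := rad_gt0 n; have r1 := rad_lt1 n.
set S := (X in X <= _); pose T := \int[leb]_(x in rad_seg n) moment_integrand alpha 2 x.
have ST : S - T <= 2.
  rewrite -(RintegralB ms (im 0%N) (im 2)).
  apply: (@le_trans _ _ (\int[leb]_(x in rad_seg n) (1 : R))).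
    apply: le_Rintegral => //.
    - exact: (integrableB ms (im 0%N) (im 2)).
    - apply: continuous_compact_integrable; first exact: segment_compact.
      by apply: continuous_subspaceT => x; exact: cvg_cst.
    move=> x; rewrite /rad_seg/= in_itv/= => /onemsqr_gt0 x1.
    rewrite /moment_integrand expr0 -mulrBl /equilibrium_weight.
    rewrite -{1}(powRr1 (ltW x1)) -powRD; last first.
      by apply/implyP => _; rewrite gt_eqF.
    rewrite -[leRHS](powRr0 (1 - x ^+ 2)) ger_powR ?x1//=.
      by rewrite lerBlDr lerDl sqr_ge0.
    lra.
  have := @Rintegral_cst _ _ R leb (rad_seg n) ms 1. rewrite /= => ->.
  rewrite mul1r [leb _]lebesgue_measure_itv/= lte_fin.
  by rewrite ifT/=; lra.
have := moment_parts_seg alpha 1 n.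
rewrite -/S -/T mul1r !expr1 opprK => TS.
have : 0 <= (rad n + rad n) * (1 - rad n ^+ 2) `^ ((alpha + 1) / 2).
  by rewrite mulr_ge0 ?powR_ge0//; lra.
rewrite -TS -[1%:R]/1 => TS'.
suff : (alpha + 1) * S <= (alpha + 1) * 4 by rewrite ler_pM2l// addr_gt0.
have := ler_wpM2l (_ : 0 <= alpha + 2) ST; rewrite addr_ge0 ?(ltW a0)// => /(_ isT).
by rewrite mulrBr; lra.
Qed.

(** For [j > 0] the integrand may change sign, but becomes nonnegative once the
    integrand of order 0, which dominates it, is added. *)
Lemma moment_exhaustion alpha j : 0 < alpha ->
  leb.-integrable `]-1, 1[ (EFin \o moment_integrand alpha j) /\
  \int[leb]_(x in rad_seg n) moment_integrand alpha j x @[n --> \oo] --> wmoment alpha j.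
Proof.
move=> a0.
have mD : measurable (`]-1, 1[%classic : set (measurableTypeR R)) by exact: measurable_itv.
have ms n : measurable (rad_seg n : set (measurableTypeR R)) by exact: measurable_itv.
have w0 x : 0 <= equilibrium_weight alpha x by exact: powR_ge0.
have [i0 c0] : leb.-integrable `]-1, 1[ (EFin \o moment_integrand alpha 0%N) /\
  \int[leb]_(x in rad_seg n) moment_integrand alpha 0%N x @[n --> \oo] --> wmoment alpha 0.
  apply: (@Rintegral_exhaustion R _ _ _ 4).
  - exact: measurable_moment_integrand.
  - by move=> x _; rewrite /moment_integrand expr0 mul1r.
  - exact: rad_seg_nondecreasing.
  - by [].
  - exact: bigcup_rad_segments.
  - by move=> n; exact: integrable_moment_seg.
  - by move=> n; exact: wmoment0_seg_le.
pose f x := moment_integrand alpha j x + moment_integrand alpha 0%N x.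
have xj x : `]-1, 1[%classic x -> `|x ^+ j| <= 1.
  rewrite /= in_itv/= => x1; rewrite normrX exprn_ile1//.
  by rewrite ler_norml; move: x1 => /andP[/ltW -> /ltW ->].
have f0 x : `]-1, 1[%classic x -> 0 <= f x <= 2 * moment_integrand alpha 0%N x.
  move=> /xj; rewrite ler_norml => /andP[h1 h2].
  rewrite /f /moment_integrand expr0 -mulrDl mulrA mulr1 mulr_ge0//=; last by lra.
  by rewrite ler_wpM2r//; lra.
have sD n : rad_seg n `<=` `]-1, 1[%classic.
  by rewrite -bigcup_rad_segments; exact: bigcup_sup.
have mf : measurable_fun [set: R] f.
  by apply: measurable_funD; exact: measurable_moment_integrand.
have iseg n : leb.-integrable (rad_seg n) (EFin \o f).
  exact: (integrableD (ms n) (integrable_moment_seg alpha j n) (integrable_moment_seg alpha 0%N n)).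
have [ifD cf] : leb.-integrable `]-1, 1[ (EFin \o f) /\
  \int[leb]_(x in rad_seg n) f x @[n --> \oo] --> \int[leb]_(x in `]-1, 1[) f x.
  apply: (@Rintegral_exhaustion R _ _ _ (2 * 4)) => //.
  - by move=> x /f0 /andP[].
  - exact: rad_seg_nondecreasing.
  - exact: bigcup_rad_segments.
  - move=> n; apply: (@le_trans _ _ (\int[leb]_(x in rad_seg n) (2 * moment_integrand alpha 0%N x))).
      apply: le_Rintegral => //; first exact: (integrableZl (ms n) 2 (integrable_moment_seg alpha 0%N n)).
      by move=> x /sD /f0 /andP[].
    rewrite (RintegralZl _ (ms n) (integrable_moment_seg alpha 0%N n)) ler_wpM2l//.
    exact: wmoment0_seg_le.
have jE : moment_integrand alpha j = (fun x => f x - moment_integrand alpha 0%N x).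
  by apply/funext => x; rewrite /f addrK.
rewrite /wmoment jE; split; first exact: (integrableB mD ifD i0).
rewrite (RintegralB mD ifD i0).
under eq_fun do rewrite (RintegralB (ms _) (iseg _) (integrable_moment_seg alpha 0%N _)).
exact: cvgB.
Qed.

Lemma cvg_onemsqr_powR (b : R) : 0 < b ->
  ((1 - rad n ^+ 2) `^ b) @[n --> \oo] --> (0 : R).
Proof.
move=> b0; have /cvg_at_rightP := @powR_cvg0 R _ b0; apply; split.
  by move=> n; have := rad_gt0 n; have := rad_lt1 n; nra.
have c := cvgnM cvg_rad cvg_rad; rewrite mulr1 in c.
by have := cvgnB (cvg_cst (1 : R)) c; rewrite subrr; apply.
Qed.

Lemma wmoment_rec alpha i : 0 < alpha ->
  i%:R * wmoment alpha i.-1 = (i%:R + alpha + 1) * wmoment alpha i.+1.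
Proof.
move=> a0; apply/eqP; rewrite -subr_eq0; apply/eqP.
have [_ c1] := moment_exhaustion i.-1 a0; have [_ c2] := moment_exhaustion i.+1 a0.
have h := cvgnB (cvgnZ i%:R c1) (cvgnZ (i%:R + alpha + 1) c2).
apply: (@cvgn_eq R (fun n => i%:R * \int[leb]_(x in rad_seg n) moment_integrand alpha i.-1 x -
  (i%:R + alpha + 1) * \int[leb]_(x in rad_seg n) moment_integrand alpha i.+1 x)); first exact: h.
under eq_fun do rewrite moment_parts_seg.
have p0 : 0 < (alpha + 1) / 2 by rewrite divr_gt0// addr_gt0.
have cp := cvg_onemsqr_powR p0.
have cX := cvgnX i cvg_rad.
have cN : (- rad n) ^+ i @[n --> \oo] --> ((-1) ^+ i : R).
  by apply: cvgnX; apply: cvgN; exact: cvg_rad.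
by have := cvgnM (cvgnB cX cN) cp; rewrite mulr0; apply.
Qed.

Lemma wmoment_odd alpha j : 0 < alpha -> odd j -> wmoment alpha j = 0.
Proof.
move=> a0; elim/ltn_ind: j => -[|[|j]] // IH oj.
  have := @wmoment_rec alpha 0 a0; rewrite mul0r add0r => /esym/eqP.
  by rewrite mulf_eq0 gt_eqF ?addr_gt0//= => /eqP.
have := @wmoment_rec alpha j.+1 a0; rewrite IH//= ?mulr0; last by move: oj; rewrite /= negbK.
move=> /esym/eqP; rewrite mulf_eq0 gt_eqF/= ?addr_gt0// ?ltr0Sn//.
by move=> /eqP.
Qed.

Lemma wmoment_ge0 alpha j : 0 < alpha -> 0 <= wmoment alpha j.*2.
Proof.
move=> a0; apply: Rintegral_ge0 => x _.
by rewrite mulr_ge0 ?powR_ge0// -mul2n exprM exprn_ge0 ?sqr_ge0.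
Qed.

(** Raising [alpha] by 2 multiplies the weight by [1 - x ^ 2], so that [wmoment_rec]
    applies. *)
Lemma wmomentD2 alpha : 0 < alpha ->
  wmoment (alpha + 2) 0 = (alpha + 1) / (alpha + 2) * wmoment alpha 0.
Proof.
move=> a0; have a2 : 0 < alpha + 2 by rewrite addr_gt0.
have mD : measurable (`]-1, 1[%classic : set (measurableTypeR R)) by exact: measurable_itv.
have [i0 _] := moment_exhaustion 0 a0; have [i2 _] := moment_exhaustion 2 a0.
have : wmoment (alpha + 2) 0 = wmoment alpha 0 - wmoment alpha 2.
  rewrite /wmoment -(RintegralB mD i0 i2); apply: eq_Rintegral => x.
  move=> /set_mem; rewrite /= in_itv/= => x1.
  have x2 : 0 < 1 - x ^+ 2 by move: x1 => /andP[]; nra.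
  rewrite /moment_integrand expr0 -mulrBl mul1r /equilibrium_weight.
  have -> : (alpha + 2 - 1) / 2 = (alpha - 1) / 2 + 1 by field.
  rewrite powRD; last by apply/implyP => _; rewrite gt_eqF.
  by rewrite (powRr1 (ltW x2)) mulrC.
have := wmoment_rec 1 a0; rewrite mul1r /= -[1%:R]/1 => e1 e2.
apply: (mulfI (lt0r_neq0 a2)); rewrite e2 mulrBr.
have -> : (alpha + 2) * wmoment alpha 2 = wmoment alpha 0 by rewrite e1; congr (_ * _); ring.
by field; rewrite gt_eqF.
Qed.

Lemma wmoment_noninc alpha beta : 0 < alpha -> alpha <= beta ->
  wmoment beta 0 <= wmoment alpha 0.
Proof.
move=> a0 ab; have b0 := lt_le_trans a0 ab.
have mD : measurable (`]-1, 1[%classic : set (measurableTypeR R)) by exact: measurable_itv.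
have [i0 _] := moment_exhaustion 0 a0; have [i2 _] := moment_exhaustion 0 b0.
apply: le_Rintegral => // x; rewrite /= in_itv/= => x1.
have x2 : 0 < 1 - x ^+ 2 by move: x1 => /andP[]; nra.
rewrite /moment_integrand expr0 !mul1r /equilibrium_weight ger_powR//; last by lra.
by rewrite x2 lerBlDr lerDl sqr_ge0.
Qed.

Lemma wmoment10 : wmoment 1 0 = 2.
Proof.
rewrite /wmoment; transitivity (\int[leb]_(x in `]-1, 1[) (1 : R)).
  apply: eq_Rintegral => x _.
  by rewrite /moment_integrand expr0 mul1r /equilibrium_weight subrr mul0r powRr0.
have mD : measurable (`]-1, 1[%classic : set (measurableTypeR R)) by exact: measurable_itv.
have := @Rintegral_cst _ _ R leb _ mD 1; rewrite /= => ->.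
rewrite mul1r [leb _]lebesgue_measure_itv/= lte_fin ifT/=; last by lra.
by rewrite opprK.
Qed.

Lemma equilibrium_massE alpha : 0 < alpha -> equilibrium_mass alpha = wmoment alpha 0.
Proof.
move=> a0; have [i0 _] := moment_exhaustion 0 a0.
have E : equilibrium_weight alpha = moment_integrand alpha 0.
  by apply/funext => x; rewrite /moment_integrand expr0 mul1r.
have mf (A : set (measurableTypeR R)) : measurable A -> measurable_fun A (EFin \o moment_integrand alpha 0).
  by move=> mA; apply/measurable_EFinP; apply: measurable_funTS; exact: measurable_moment_integrand.
rewrite /equilibrium_mass E /wmoment /Rintegral integral_itv_bndoo//.
by apply: mf; exact: measurable_itv.
Qed.

(** [wmomentD2] starting from [wmoment 1 0 = 2] reaches all odd integers; the
    others follow by monotonicity. *)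
Lemma wmoment0_gt0 alpha : 0 < alpha -> 0 < wmoment alpha 0.
Proof.
move=> a0; have odd_gt0 N : 0 < wmoment (1 + 2 * N%:R) 0.
  elim: N => [|N IH]; first by rewrite mulr0 addr0 wmoment10.
  have x0 : 0 < 1 + 2 * N%:R :> R by rewrite ltr_wpDr// mulr_ge0.
  rewrite -[N.+1%:R]natr1 mulrDr mulr1 addrA (wmomentD2 x0).
  by rewrite mulr_gt0// divr_gt0// addr_gt0.
apply: (lt_le_trans (odd_gt0 (Num.truncn alpha))); apply: wmoment_noninc; first exact: a0.
apply: (le_trans (ltW (truncnS_gt alpha))); rewrite -natr1.
by have := ler0n R (Num.truncn alpha); lra.
Qed.

End EquilibriumMoments.

Section EquilibriumMass.
Context {R : realType}.
Implicit Types (alpha x s : R).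

(** The reverse bound comes from [Gamma_add_le] for the step from [x + s] to
    [x + 1]. *)
Lemma Gamma_add_ge x s : 0 < x -> 0 < s < 1 ->
  x / (x + s) * (x `^ s * Gamma x) <= Gamma (x + s).
Proof.
move=> x0 /andP[s0 s1]; have xs0 : 0 < x + s by rewrite addr_gt0.
have h : Gamma (x + s + (1 - s)) <= (x + s) `^ (1 - s) * Gamma (x + s).
  by apply: Gamma_add_le => //; lra.
have e : x + s + (1 - s) = x + 1 by ring.
rewrite e GammaS// in h.
have p0 := powR_gt0 (1 - s) xs0.
rewrite -(ler_pM2l p0); apply: le_trans h.
rewrite !mulrA ler_wpM2r ?(ltW (Gamma_gt0 x0))//.
have -> : (x + s) `^ (1 - s) * x / (x + s) * x `^ s =
    x * (x / (x + s)) `^ s.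
  rewrite powRM ?invr_ge0 ?(ltW x0) ?(ltW xs0)// -powR_inv1 ?(ltW xs0)// -powRrM mulN1r.
  have -> : (x + s) `^ (1 - s) = (x + s) * (x + s) `^ (- s).
    rewrite powRD ?powRr1 ?(ltW xs0)//.
    by apply/implyP => _; rewrite gt_eqF.
  rewrite powR_inv1 ?(ltW xs0)//; field.
  by rewrite gt_eqF.
rewrite ler_piMr ?(ltW x0)// -[leRHS](powRr0 (x / (x + s))) ger_powR ?(ltW s0)//.
by rewrite divr_gt0//= ler_pdivrMr// mul1r lerDl ltW.
Qed.

Lemma Gamma_ratio_cvg (c d s : R) : 0 < c -> 0 < d -> 0 < s < 1 ->
  (Gamma (c + d * n%:R + s) / ((c + d * n%:R) `^ s * Gamma (c + d * n%:R)))
    @[n --> \oo] --> (1 : R).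
Proof.
move=> c0 d0 s01; have x0 n : 0 < c + d * n%:R by rewrite ltr_wpDr// mulr_ge0// ltW.
have p0 n : 0 < (c + d * n%:R) `^ s * Gamma (c + d * n%:R).
  by rewrite mulr_gt0 ?powR_gt0 ?Gamma_gt0.
apply: (@squeezen _ (fun n => 1 - s * (c + s + d * n%:R)^-1) (fun=> 1)).
- move=> n; rewrite ler_pdivrMr// mul1r Gamma_add_le// andbT ler_pdivlMr//.
  apply: le_trans (Gamma_add_ge (x0 n) s01); rewrite ler_wpM2r ?(ltW (p0 n))//.
  have xs : 0 < c + d * n%:R + s by rewrite addr_gt0//; case/andP: s01.
  rewrite le_eqVlt; apply/orP; left; apply/eqP; field.
  by rewrite gt_eqF//; lra.
- have h := cvgnB (cvg_cst (1 : R)) (cvgnZ s (@cvg_invn R (c + s) d _ d0)).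
  rewrite mulr0 subr0 in h; apply: h.
  by rewrite addr_gt0//; case/andP: s01.
- exact: cvg_cst.
Qed.

(** The mass claimed for the equilibrium weight, divided by [2 * pi]. *)
Definition mass_formula alpha : R :=
  2 `^ (- alpha) * Gamma alpha / (Gamma (alpha / 2 + 1) * Gamma (alpha / 2)).

Lemma mass_formula_gt0 alpha : 0 < alpha -> 0 < mass_formula alpha.
Proof.
move=> a0; have a2 : 0 < alpha / 2 by rewrite divr_gt0.
by rewrite divr_gt0 ?mulr_gt0 ?powR_gt0 ?Gamma_gt0// addr_gt0.
Qed.

Lemma mass_formulaD2 alpha : 0 < alpha ->
  mass_formula (alpha + 2) = (alpha + 1) / (alpha + 2) * mass_formula alpha.
Proof.
move=> a0; have a2 : 0 < alpha / 2 by rewrite divr_gt0.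
rewrite /mass_formula.
have -> : (alpha + 2) / 2 = alpha / 2 + 1 by field.
have -> : alpha + 2 = alpha + 1 + 1 by ring.
rewrite (@GammaS _ (alpha + 1)) ?addr_gt0// (@GammaS _ (alpha / 2 + 1)) ?addr_gt0//.
rewrite (GammaS a0) (GammaS a2).
have -> : (2 : R) `^ (- (alpha + 1 + 1)) = 2 `^ (- alpha) / 4.
  have -> : - (alpha + 1 + 1) = - alpha + (- 2%:R) by ring.
  rewrite powRD ?pnatr_eq0 ?implybT// powR_invn//.
  by congr (_ / _); rewrite expr2 -natrM.
have g := gt_eqF (Gamma_gt0 a2).
move: g; move: (Gamma (alpha / 2)) (Gamma alpha) (2 `^ (- alpha)) => A B C g.
have h1 : alpha + 1 + 1 != 0 by rewrite gt_eqF// !addr_gt0.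
have h2 : alpha != 0 by rewrite gt_eqF.
have h3 : alpha + 2 != 0 by rewrite gt_eqF// addr_gt0.
by field; rewrite g ?h1 ?h2 ?h3.
Qed.

Lemma wmoment_mass_formula alpha N : 0 < alpha ->
  wmoment (alpha + 2 * N%:R) 0 / mass_formula (alpha + 2 * N%:R) =
  wmoment alpha 0 / mass_formula alpha.
Proof.
move=> a0; elim: N => [|N <-]; first by rewrite mulr0 addr0.
have b0 : 0 < alpha + 2 * N%:R by rewrite ltr_wpDr// mulr_ge0.
rewrite -[N.+1%:R]natr1 mulrDr mulr1 addrA (wmomentD2 b0) (mass_formulaD2 b0).
have := gt_eqF (mass_formula_gt0 b0); move: (mass_formula _) (wmoment _ _) => T W T0.
field; rewrite T0; lra.
Qed.

(** By [Gamma_ratio_cvg] every Gamma factor contributes a power of its argument,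
    and these powers cancel up to a factor tending to 1. *)
Lemma mass_formula_ratio_cvg alpha s : 0 < alpha -> 0 < s < 1 ->
  (mass_formula (alpha + 2 * n%:R + s) / mass_formula (alpha + 2 * n%:R))
     @[n --> \oo] --> (1 : R).
Proof.
move=> a0 s01; have s201 : 0 < s / 2 < 1 by lra.
have a2 : 0 < alpha / 2 by rewrite divr_gt0.
have a21 : 0 < alpha / 2 + 1 by rewrite addr_gt0.
have c1 := @Gamma_ratio_cvg alpha 2 s a0 (ltr0Sn _ _) s01.
have c2 := @Gamma_ratio_cvg (alpha / 2) 1 (s / 2) a2 ltr01 s201.
have c3 := @Gamma_ratio_cvg (alpha / 2 + 1) 1 (s / 2) a21 ltr01 s201.
pose q (n : nat) : R := ((alpha + 2 * n%:R) / (alpha + 2 * n%:R + 2)) `^ (s / 2).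
have x0 n : 0 < alpha + 2 * n%:R by rewrite ltr_wpDr// mulr_ge0.
have cq : q n @[n --> \oo] --> (1 : R).
  have y01 n : 0 < (alpha + 2 * n%:R) / (alpha + 2 * n%:R + 2) <= 1.
    have h := x0 n; have h2 : 0 < alpha + 2 * n%:R + 2 by rewrite addr_gt0.
    by rewrite divr_gt0//= ler_pdivrMr// mul1r lerDl.
  apply: (@squeezen _ (fun n => 1 - 2 * (alpha + 2 + 2 * n%:R)^-1) (fun=> 1)).
  - move=> n; apply/andP; split; last first.
      rewrite -[leRHS](powRr0 ((alpha + 2 * n%:R) / (alpha + 2 * n%:R + 2))) ger_powR//; lra.
    apply: (@le_trans _ _ ((alpha + 2 * n%:R) / (alpha + 2 * n%:R + 2))).
      rewrite le_eqVlt; apply/orP; left; apply/eqP; field.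
      by rewrite gt_eqF//; have := x0 n; lra.
    by apply: ger1_powR => //; lra.
  - have h := cvgnB (cvg_cst (1 : R)) (cvgnZ 2 (@cvg_invn R (alpha + 2) 2 _ (ltr0Sn _ _))).
    by rewrite mulr0 subr0 in h; apply: h; rewrite addr_gt0.
  - exact: cvg_cst.
have c := cvgnM (cvgnM c1 cq) (cvgnM (cvgnV (oner_neq0 _) c2) (cvgnV (oner_neq0 _) c3)).
rewrite invr1 !mulr1 in c; move: c; apply: cvg_trans; apply: near_eq_cvg; apply: nearW => n.
rewrite /q /mass_formula; set b := alpha + 2 * n%:R.
have b0 : 0 < b := x0 n.
have b2 : 0 < b / 2 by rewrite divr_gt0.
have -> : alpha / 2 + 1 * n%:R = b / 2 by rewrite /b; field.
have -> : alpha / 2 + 1 + 1 * n%:R = b / 2 + 1 by rewrite /b; field.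
have -> : (b + s) / 2 = b / 2 + s / 2 by field.
have -> : b / 2 + s / 2 + 1 = b / 2 + 1 + s / 2 by ring.
have -> : b / (b + 2) = (b / 2) / (b / 2 + 1).
  have h2 : b + 2 != 0 by rewrite gt_eqF// addr_gt0.
  by field; rewrite ?h2.
have b21 : 0 < b / 2 + 1 by rewrite addr_gt0.
have -> : b `^ s = 2 `^ s * ((b / 2) `^ (s / 2) * (b / 2) `^ (s / 2)).
  rewrite -powRD; last by apply/implyP => _; rewrite gt_eqF.
  have -> : s / 2 + s / 2 = s by field.
  by rewrite -powRM ?(ltW b2)//; congr (_ `^ _); field.
rewrite (@powRM _ (b / 2) (b / 2 + 1)^-1) ?invr_ge0 ?(ltW b2) ?(ltW b21)//.
have -> : (b / 2 + 1)^-1 `^ (s / 2) = ((b / 2 + 1) `^ (s / 2))^-1.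
  by rewrite -powR_inv1 ?(ltW b21)// -powRrM mulN1r powRN.
have -> : - (b + s) = - b + - s by ring.
rewrite powRD ?pnatr_eq0 ?implybT// (powRN 2 s).
have s0 : 0 < s by case/andP: s01.
have g1 := gt_eqF (Gamma_gt0 b0); have g2 := gt_eqF (Gamma_gt0 b2).
have g3 := gt_eqF (Gamma_gt0 b21).
have g4 : Gamma (b / 2 + s / 2) == 0 = false by rewrite gt_eqF// Gamma_gt0// addr_gt0// divr_gt0.
have g5 : Gamma (b / 2 + 1 + s / 2) == 0 = false by rewrite gt_eqF// Gamma_gt0// addr_gt0// divr_gt0.
have p1 := gt_eqF (powR_gt0 s (ltr0Sn R 1)); have p2 := gt_eqF (powR_gt0 (- b) (ltr0Sn R 1)).
have p3 := gt_eqF (powR_gt0 (s / 2) b2); have p4 := gt_eqF (powR_gt0 (s / 2) b21).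
move: g1 g2 g3 g4 g5 p1 p2 p3 p4.
move: (Gamma b) (Gamma (b / 2)) (Gamma (b / 2 + 1)) (Gamma (b / 2 + s / 2)).
move: (Gamma (b / 2 + 1 + s / 2)) (Gamma (b + s)) (2 `^ s) (2 `^ (- b)).
move: ((b / 2) `^ (s / 2)) ((b / 2 + 1) `^ (s / 2)) => A B C D E F G H I J.
by move=> g1 g2 g3 g4 g5 g6 g7 g8 g9; field; rewrite g1 g2 g3 g4 g5 g6 g7 g8 g9.
Qed.

Local Opaque wmoment mass_formula.

(** The quotient is 2-periodic, and along [alpha + 2 n] a shift by [s] does not
    change it asymptotically: both the mass, which is monotone in [alpha] and
    obeys [wmomentD2], and [mass_formula] have shift ratios tending to 1. *)
Lemma mass_quotient_shift alpha s : 0 < alpha -> 0 < s < 1 ->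
  wmoment (alpha + s) 0 / mass_formula (alpha + s) =
  wmoment alpha 0 / mass_formula alpha.
Proof.
move=> a0 s01; have s0 : 0 < s by case/andP: s01.
have as0 : 0 < alpha + s by rewrite addr_gt0.
have x0 n : 0 < alpha + 2 * n%:R by rewrite ltr_wpDr// mulr_ge0.
set Q' := LHS; set Q := RHS.
have Q0 : Q != 0 by rewrite mulf_neq0 ?invr_eq0 ?gt_eqF ?wmoment0_gt0 ?mass_formula_gt0.
suff h : Q' / Q = 1 by rewrite -[LHS](divfK Q0) h mul1r.
apply: (@cvgn_eq R (fun=> Q' / Q)); first exact: cvg_cst.
have cw : (wmoment (alpha + 2 * n%:R + s) 0 / wmoment (alpha + 2 * n%:R) 0)
    @[n --> \oo] --> (1 : R).
  apply: (@squeezen _ (fun n => 1 - (alpha + 2 + 2 * n%:R)^-1) (fun=> 1)).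
  - move=> n; have := x0 n => b0; have w0 := wmoment0_gt0 b0.
    rewrite ler_pdivrMr// mul1r wmoment_noninc ?lerDl ?(ltW s0)// andbT ler_pdivlMr//.
    have -> : 1 - (alpha + 2 + 2 * n%:R)^-1 =
       (alpha + 2 * n%:R + 1) / (alpha + 2 * n%:R + 2).
      by field; rewrite gt_eqF//; lra.
    rewrite -(wmomentD2 b0); apply: wmoment_noninc; first by rewrite addr_gt0.
    by case/andP: s01 => _; lra.
  - have h := cvgnB (cvg_cst (1 : R)) (@cvg_invn R (alpha + 2) 2 _ (ltr0Sn _ _)).
    by rewrite subr0 in h; apply: h; rewrite addr_gt0.
  - exact: cvg_cst.
have c := cvgnM cw (cvgnV (oner_neq0 _) (mass_formula_ratio_cvg a0 s01)).
rewrite invr1 mulr1 in c; move: c; apply: cvg_trans; apply: near_eq_cvg; apply: nearW => n.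
have e1 := wmoment_mass_formula n as0; have e2 := wmoment_mass_formula n a0.
rewrite (addrAC alpha s) in e1; rewrite /Q' /Q -e1 -e2.
have w1 := gt_eqF (wmoment0_gt0 (x0 n)); have t1 := gt_eqF (mass_formula_gt0 (x0 n)).
have xs0 : 0 < alpha + 2 * n%:R + s by rewrite addr_gt0.
have t2 := gt_eqF (mass_formula_gt0 xs0).
move: w1 t1 t2; move: (wmoment _ _) (wmoment _ _) (mass_formula _) (mass_formula _) => A B C D h1 h3 h4.
by field; rewrite h1 h3 h4.
Qed.

Lemma mass_quotient_const alpha beta : 0 < alpha -> alpha < beta ->
  wmoment beta 0 / mass_formula beta = wmoment alpha 0 / mass_formula alpha.
Proof.
move=> a0 ab; pose K := (Num.truncn (beta - alpha)).+1.
have [s s01 ->] : exists2 s, 0 < s < 1 & beta = alpha + s * K%:R.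
  have K0 : (0 : R) < K%:R by rewrite ltr0n.
  exists ((beta - alpha) / K%:R); last by rewrite divfK ?gt_eqF//; ring.
  by rewrite divr_gt0 ?subr_gt0//= ltr_pdivrMr// mul1r truncnS_gt.
have x0 k : 0 < alpha + s * k%:R by rewrite ltr_wpDr// mulr_ge0//; case/andP: s01 => /ltW.
elim: K => [|k IH]; first by rewrite mulr0 addr0.
have -> : alpha + s * k.+1%:R = alpha + s * k%:R + s by rewrite -[k.+1%:R]natr1; ring.
by rewrite (mass_quotient_shift (x0 k) s01).
Qed.

Local Transparent wmoment mass_formula.

(** Half the area of the unit disk. *)
Lemma wmoment20 : wmoment 2 0 = pi / 2 :> R.
Proof.
have [_ c0] := @moment_exhaustion R 2 0 (ltr0Sn _ _).
pose F x := (x * (1 - x ^+ 2) `^ 2^-1 + asin x) / 2.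
have I n : \int[lebesgue_measure]_(x in @rad_seg R n) moment_integrand 2 0 x =
    @rad R n * (1 - rad n ^+ 2) `^ 2^-1 + asin (rad n).
  have r1 := @rad_lt1 R n; have r0 := @rad_gt0 R n.
  have ab : - @rad R n < rad n by rewrite -subr_gt0 opprK addr_gt0.
  have [||_ ->] := @FTC_segment R (moment_integrand 2 0) F _ _ ab.
  - move=> x xr; have x0 := onemsqr_gt0 xr.
    have x3 : -1 < x < 1 by move: xr => /andP[x1 x2]; apply/andP; split; lra.
    have da := is_derive1_asin x3.
    have dp := is_deriveM (is_derive_id x (1 : R)) (is_derive_onemsqr_powR 2^-1 x0).
    have d := is_deriveD dp da.
    have dF : F = (fun y => 2^-1 * ((id : R -> R) * (fun y => (1 - y ^+ 2) `^ 2^-1) + asin : R -> R) y).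
      by apply/funext => y; rewrite /F mulrC.
    rewrite dF; apply: (is_derive_eq (is_deriveZ 2^-1 d)).
    rewrite /GRing.scale/= /moment_integrand expr0 mul1r /equilibrium_weight.
    have -> : (2 - 1) / 2 = 2^-1 :> R by field.
    have -> : (1 - x ^+ 2) `^ (2^-1 - 1) = (1 - x ^+ 2) `^ 2^-1 / (1 - x ^+ 2).
      by rewrite powRB ?powRr1 ?(ltW x0)//; apply/implyP => _; rewrite gt_eqF.
    rewrite -powR12_sqrt ?(ltW x0)//.
    have p0 := gt_eqF (powR_gt0 2^-1 x0).
    have pp : (1 - x ^+ 2) `^ 2^-1 * (1 - x ^+ 2) `^ 2^-1 = 1 - x ^+ 2.
      rewrite -powRD; last by apply/implyP => _; rewrite gt_eqF.
      by rewrite -[X in _ = X]powRr1 ?(ltW x0)//; congr (_ `^ _); field.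
    have -> : (1 - x ^+ 2) `^ 2^-1 / (1 - x ^+ 2) = ((1 - x ^+ 2) `^ 2^-1)^-1.
      by rewrite -{2}pp; field; rewrite p0.
    have -> : ((1 - x ^+ 2) `^ 2^-1)^-1 = (1 - x ^+ 2) `^ 2^-1 / (1 - x ^+ 2).
      by rewrite -{3}pp; field; rewrite p0.
    by field; rewrite gt_eqF.
  - by move=> x /(@onemsqr_gt0 R n); exact: continuous_moment_integrand.
  have asinN : asin (- rad n) = - asin (@rad R n).
    have r01 : -1 <= @rad R n <= 1 by rewrite (ltW r1) (le_trans _ (ltW r0))// lerN10.
    rewrite -{1}[rad n]asinK ?in_itv//= -sinN sinK// in_itv/= lerN2 lerNl.
    by rewrite asin_geNpi2 ?asin_lepi2.
  by rewrite /F sqrrN asinN; field.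
have h0 : (0 : R) < 2^-1 by rewrite invr_gt0.
have ca : asin (@rad R n) @[n --> \oo] --> wmoment 2 0.
  have h := cvgnB c0 (cvgnM (@cvg_rad R) (cvg_onemsqr_powR h0)).
  rewrite mulr0 subr0 in h; move: h; under eq_fun do rewrite I addrAC subrr add0r.
  exact.
have rin n : -1 <= @rad R n <= 1.
  by have := @rad_gt0 R n; have := @rad_lt1 R n; lra.
have Lin : wmoment 2 0 \in `[- (pi / 2), pi / 2 : R].
  rewrite in_itv/=; apply/andP; split.
  - by apply: (cvgn_ge ca) => n; exact: asin_geNpi2.
  - by apply: (cvgn_le ca) => n; exact: asin_lepi2.
have sL : sin (wmoment 2 0) = 1 :> R.
  have h : sin (asin (@rad R n)) @[n --> \oo] --> sin (wmoment 2 0 : R).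
    by apply: (@cvg_comp _ _ _ (fun n => asin (@rad R n)) (@sin R) _ (nbhs (wmoment 2 0))) => //; exact: continuous_sin.
  apply: (cvgn_eq h); under eq_fun do rewrite asinK ?in_itv/= ?rin//.
  exact: cvg_rad.
rewrite -[LHS](sinK Lin) sL -[X in asin X](@sin_pihalf R) sinK//.
by rewrite in_itv/= lexx andbT; have := @pi_gt0 R; lra.
Qed.

(** The quotient of the mass by [mass_formula] does not depend on [alpha], and is
    known at [alpha = 2]. *)
Lemma equilibrium_mass_formula alpha : 0 < alpha ->
  equilibrium_mass alpha = pi * 2 `^ (1 - alpha) * rbinom (alpha - 1) (alpha / 2).
Proof.
move=> a0; rewrite equilibrium_massE//.
have T2 : mass_formula 2 = 4^-1 :> R.
  rewrite /mass_formula divff ?pnatr_eq0// (@GammaS _ 1)// Gamma1 !mulr1 divr1.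
  by rewrite powR_invn//; congr (_^-1); rewrite expr2 -natrM.
have key : wmoment alpha 0 / mass_formula alpha = 2 * pi.
  have e2 : wmoment 2 0 / mass_formula 2 = 2 * pi :> R by rewrite T2 wmoment20; field.
  rewrite -e2; have [a2|a2|->//] := ltgtP alpha 2.
  - by rewrite -(mass_quotient_const a0 a2).
  - by rewrite (mass_quotient_const _ a2).
have t0 := gt_eqF (mass_formula_gt0 a0).
have -> : wmoment alpha 0 = 2 * pi * mass_formula alpha by rewrite -key divfK ?t0.
rewrite /rbinom subrK /mass_formula.
have -> : alpha - 1 - alpha / 2 + 1 = alpha / 2 by field.
rewrite powRD ?pnatr_eq0 ?implybT// powRr1//; ring.
Qed.

End EquilibriumMass.

(** * Cesaro numbers and Cesaro means *)

Section CesaroNumbers.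
Context {R : realType}.
Implicit Types (alpha beta : R).

(** Classically written [A_n^beta]; the Cesaro weights of order [alpha] are
    [A_(n-k)^(alpha-1) / A_n^alpha]. *)
Definition cesaro_number beta (n : nat) : R := rbinom (n%:R + beta) n%:R.

Lemma cesaro_numberE beta n : cesaro_number beta n =
  Gamma (n%:R + (beta + 1)) / (Gamma (n%:R + 1) * Gamma (beta + 1)).
Proof.
rewrite /cesaro_number /rbinom addrA; have -> : n%:R + beta - n%:R = beta by ring.
by [].
Qed.

Lemma cesaro_number0 beta : -1 < beta -> cesaro_number beta 0 = 1.
Proof.
move=> b1; have b10 : 0 < beta + 1 by rewrite -ltrBlDr sub0r.
by rewrite cesaro_numberE !add0r Gamma1 mul1r divff// gt_eqF// Gamma_gt0.
Qed.

Lemma cesaro_number_gt0 beta n : -1 < beta -> 0 < cesaro_number beta n.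
Proof.
move=> b1; have b10 : 0 < beta + 1 by rewrite -ltrBlDr sub0r.
by rewrite cesaro_numberE divr_gt0 ?mulr_gt0 ?Gamma_gt0// ltr_wpDl.
Qed.

Lemma cesaro_numberS beta n : -1 < beta -> cesaro_number beta n.+1 =
  (n%:R + beta + 1) / n.+1%:R * cesaro_number beta n.
Proof.
move=> b1; have b10 : 0 < beta + 1 by rewrite -ltrBlDr sub0r.
have nb0 : 0 < n%:R + (beta + 1) by rewrite ltr_wpDl.
have n10 : (0 : R) < n%:R + 1 by rewrite ltr_wpDl.
rewrite !cesaro_numberE.
have -> : n.+1%:R + (beta + 1) = n%:R + (beta + 1) + 1 by rewrite -[n.+1%:R]natr1; ring.
have -> : n.+1%:R + 1 = n%:R + 1 + 1 :> R by rewrite -[n.+1%:R]natr1.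
rewrite (GammaS nb0) (GammaS n10) -[n.+1%:R]natr1.
have g1 := gt_eqF (Gamma_gt0 b10); have g2 := gt_eqF (Gamma_gt0 n10).
have h : n%:R + 1 != 0 :> R by rewrite gt_eqF.
move: g1 g2; move: (Gamma (beta + 1)) (Gamma (n%:R + 1)) (Gamma (n%:R + (beta + 1))).
by move=> A B C g1 g2; field; rewrite g1 g2 h.
Qed.

Lemma cesaro_numberD1 beta n : -1 < beta -> cesaro_number (beta + 1) n =
  (n%:R + beta + 1) / (beta + 1) * cesaro_number beta n.
Proof.
move=> b1; have b10 : 0 < beta + 1 by rewrite -ltrBlDr sub0r.
have nb0 : 0 < n%:R + (beta + 1) by rewrite ltr_wpDl.
have n10 : (0 : R) < n%:R + 1 by rewrite ltr_wpDl.
rewrite !cesaro_numberE addrA.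
rewrite (GammaS nb0) (GammaS b10).
have g1 := gt_eqF (Gamma_gt0 b10); have g2 := gt_eqF (Gamma_gt0 n10).
have h : beta + 1 != 0 :> R by rewrite gt_eqF.
move: g1 g2; move: (Gamma (beta + 1)) (Gamma (n%:R + 1)) (Gamma (n%:R + (beta + 1))).
by move=> A B C g1 g2; field; rewrite g1 g2 h.
Qed.

Lemma cesaro_number_sum beta n : -1 < beta ->
  \sum_(k < n.+1) cesaro_number beta k = cesaro_number (beta + 1) n.
Proof.
move=> b1; have b10 : 0 < beta + 1 by rewrite -ltrBlDr sub0r.
have b11 : -1 < beta + 1 by rewrite (lt_trans _ b10)// oppr_lt0.
elim: n => [|n IH]; first by rewrite big_ord1 !cesaro_number0.
rewrite big_ord_recr/= IH (cesaro_numberS _ b11) (cesaro_numberS _ b1) (cesaro_numberD1 _ b1).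
have h : beta + 1 != 0 :> R by rewrite gt_eqF.
have n1 : n.+1%:R != 0 :> R by rewrite pnatr_eq0.
by rewrite -[n.+1%:R]natr1 in n1 *; field; rewrite h n1.
Qed.

Lemma cesaroE alpha n k :
  Defs.cesaro alpha n k = cesaro_number (alpha - 1) (n - k) / cesaro_number alpha n.
Proof. by rewrite /Defs.cesaro /cesaro_number addrA. Qed.

Lemma cesaro_ratio_cvg beta : -1 < beta ->
  (cesaro_number beta n / cesaro_number (beta + 1) n) @[n --> \oo] --> (0 : R).
Proof.
move=> b1; have b10 : 0 < beta + 1 by rewrite -ltrBlDr sub0r.
have h := cvgnZ (beta + 1) (cvg_invn b10 (@ltr01 R)); rewrite mulr0 in h.
apply: (cvgn_ext _ h) => n.
rewrite (cesaro_numberD1 _ b1) mul1r.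
have c0 := gt_eqF (cesaro_number_gt0 n b1).
have n0 : n%:R + beta + 1 != 0 by rewrite -addrA gt_eqF// ltr_wpDl.
have n0' : beta + 1 + n%:R != 0 by rewrite addrC addrA.
have b10' : beta + 1 != 0 :> R by rewrite gt_eqF.
by move: c0; move: (cesaro_number _ _) => A c0; field; rewrite ?c0 ?n0 ?n0' ?b10'.
Qed.

Lemma cesaro_step_cvg beta : -1 < beta ->
  (cesaro_number beta n / cesaro_number beta n.+1) @[n --> \oo] --> (1 : R).
Proof.
move=> b1; have b10 : 0 < beta + 1 by rewrite -ltrBlDr sub0r.
have h := cvgnB (cvgn_cst (1 : R)) (cvgnZ beta (cvg_invn b10 (@ltr01 R))).
rewrite mulr0 subr0 in h.
apply: (cvgn_ext _ h) => n.
rewrite (cesaro_numberS _ b1) mul1r -[n.+1%:R]natr1.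
have c0 := gt_eqF (cesaro_number_gt0 n b1).
have n0 : n%:R + beta + 1 != 0 by rewrite -addrA gt_eqF// ltr_wpDl.
have n0' : beta + 1 + n%:R != 0 by rewrite addrC addrA.
have b10' : n%:R + 1 != 0 :> R by rewrite gt_eqF// ltr_wpDl.
by move: c0; move: (cesaro_number _ _) => A c0; field; rewrite ?c0 ?n0 ?n0' ?b10'.
Qed.

End CesaroNumbers.

Section CesaroMeans.
Context {R : realType}.
Variable alpha : R.
Hypothesis alpha_gt0 : 0 < alpha.
Implicit Types (u v : nat -> nat -> R).

Let a1 : -1 < alpha - 1. Proof. by rewrite ltrBrDr addrC subrr. Qed.
Let a0 : -1 < alpha. Proof. by rewrite (lt_trans _ alpha_gt0)// oppr_lt0. Qed.
Let a11 : alpha - 1 + 1 = alpha. Proof. by rewrite subrK. Qed.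

(** The mean of the array [u] along the antidiagonal [i + k = n]; [i] indexes
    the measure and [k] the degree. *)
Definition cesaro_mean u (n : nat) : R :=
  \sum_(k < n.+1) Defs.cesaro alpha n k * u (n - k)%N k.

Lemma cesaro_mean_le u v n : (forall i k, u i k <= v i k) ->
  cesaro_mean u n <= cesaro_mean v n.
Proof. by move=> uv; apply: ler_sum => k _; rewrite ler_wpM2l ?cesaro_ge0. Qed.

Lemma cesaro_meanD u v n :
  cesaro_mean (fun i k => u i k + v i k) n = cesaro_mean u n + cesaro_mean v n.
Proof. by rewrite /cesaro_mean -big_split/=; apply: eq_bigr => k _; rewrite mulrDr. Qed.

Lemma cesaro_meanZ c u n :
  cesaro_mean (fun i k => c * u i k) n = c * cesaro_mean u n.
Proof. by rewrite /cesaro_mean mulr_sumr; apply: eq_bigr => k _; rewrite mulrCA. Qed.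

Lemma cesaro_mean_norm_le u n :
  `|cesaro_mean u n| <= cesaro_mean (fun i k => `|u i k|) n.
Proof.
apply: le_trans (ler_norm_sum _ _ _) _; apply: ler_sum => k _.
by rewrite normrM (ger0_norm (cesaro_ge0 _ _ _)).
Qed.

(** Dropping the first column of [u] changes the mean by a term of weight
    [alpha / (n + 1 + alpha)] and a factor [A_n / A_(n+1)]. *)
Lemma cesaro_mean_shift1 u (L M : R) : (forall i k, `|u i k| <= M) ->
  cesaro_mean (fun i k => u i k.+1) n @[n --> \oo] --> L ->
  cesaro_mean u n @[n --> \oo] --> L.
Proof.
move=> uM cL; rewrite -cvg_shiftS.
pose e n := cesaro_number (alpha - 1) n.+1 / cesaro_number alpha n.+1 * u n.+1 0%N.
pose r n := cesaro_number alpha n / cesaro_number alpha n.+1.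
have E n : cesaro_mean u n.+1 = e n + r n * cesaro_mean (fun i k => u i k.+1) n.
  rewrite {1}/cesaro_mean big_ord_recl/= subn0 cesaroE subn0; congr (_ + _).
  rewrite /cesaro_mean mulr_sumr; apply: eq_bigr => k _.
  rewrite /bump/= add1n subSS !cesaroE subSS /r.
  have := gt_eqF (cesaro_number_gt0 n a0); move: (cesaro_number alpha n) => A h.
  have := gt_eqF (cesaro_number_gt0 n.+1 a0); move: (cesaro_number alpha n.+1) => B h'.
  by move: (u _ _) (cesaro_number _ _) => C D; field; rewrite h h'.
have ce : e n @[n --> \oo] --> 0.
  have c := cesaro_ratio_cvg a1; rewrite a11 -cvg_shiftS in c.
  have cM := cvgnZ M c; rewrite mulr0 in cM.
  have cM' := cvgnZ (- M) c; rewrite mulr0 in cM'.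
  apply: (squeezen _ cM' cM) => n.
  have w0 : 0 <= cesaro_number (alpha - 1) n.+1 / cesaro_number alpha n.+1.
    by rewrite ltW// divr_gt0 ?cesaro_number_gt0.
  by rewrite mulNr -ler_norml /e normrM mulrC (ger0_norm w0) ler_wpM2r.
under eq_fun do rewrite E.
have := cvgnD ce (cvgnM (cesaro_step_cvg a0) cL).
by rewrite mul1r add0r; apply.
Qed.

(** Lets the Jacobi entries be studied only at indices [k >= s], away from the
    boundary of the Jacobi matrix. *)
Lemma cesaro_mean_shift u (L M : R) s : (forall i k, `|u i k| <= M) ->
  cesaro_mean (fun i k => u i (k + s)%N) n @[n --> \oo] --> L ->
  cesaro_mean u n @[n --> \oo] --> L.
Proof.
elim: s u => [|s IH] u uM cL.
  by apply: (cvgn_ext _ cL) => n; apply: eq_bigr => k _; rewrite addn0.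
apply: (cesaro_mean_shift1 uM); apply: IH => [i k|]; first exact: uM.
by apply: (cvgn_ext _ cL) => n; apply: eq_bigr => k _; rewrite addnS.
Qed.

(** Stable under sums and under products with bounded arrays, so that errors can
    be carried through the Jacobi recursion. *)
Definition mean_null u := cesaro_mean (fun i k => `|u i k|) n @[n --> \oo] --> (0 : R).

Lemma mean_nullD u v : mean_null u -> mean_null v -> mean_null (fun i k => u i k + v i k).
Proof.
move=> cu cv; have c := cvgnD cu cv; rewrite addr0 in c.
apply: (squeezen _ _ c); last exact: cvg_cst.
move=> n; rewrite sumr_ge0 /=; last by move=> k _; rewrite mulr_ge0 ?cesaro_ge0.
by rewrite -cesaro_meanD; apply: cesaro_mean_le => i k; exact: ler_normD.
Qed.

Lemma mean_nullM u v (M : R) : mean_null u -> (forall i k, `|v i k| <= M) ->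
  mean_null (fun i k => u i k * v i k).
Proof.
move=> cu vM; have c := cvgnZ M cu; rewrite mulr0 in c.
apply: (squeezen _ _ c); last exact: cvg_cst.
move=> n; rewrite sumr_ge0 /=; last by move=> k _; rewrite mulr_ge0 ?cesaro_ge0.
by rewrite -cesaro_meanZ; apply: cesaro_mean_le => i k; rewrite normrM mulrC ler_wpM2r.
Qed.

Lemma mean_null_cvg u v (L : R) : mean_null (fun i k => u i k - v i k) ->
  cesaro_mean v n @[n --> \oo] --> L -> cesaro_mean u n @[n --> \oo] --> L.
Proof.
move=> cn cv.
have cN := cvgnZ (-1) cn; rewrite mulr0 in cN.
have cd : (cesaro_mean u n - cesaro_mean v n) @[n --> \oo] --> 0.
  apply: (squeezen _ cN cn) => n.
  rewrite mulN1r -ler_norml.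
  have -> : cesaro_mean u n - cesaro_mean v n = cesaro_mean (fun i k => u i k - v i k) n.
    rewrite /cesaro_mean -sumrB; apply: eq_bigr => k _.
    by rewrite mulrBr.
  exact: cesaro_mean_norm_le.
have := cvgnD cd cv; rewrite add0r; under eq_fun do rewrite subrK.
exact.
Qed.

End CesaroMeans.

(** * Integrals of polynomials and powers of Jacobi matrices *)

Section CompactlySupportedMeasure.
Context {R : realType} (mu : {finite_measure set (measurableTypeR R) -> \bar R}).
Variables (L : R).
Hypothesis muL : mu (~` `[- L, L]) = 0%E.
Local Notation seg := (`[- L, L]%classic : set (measurableTypeR R)).

Lemma integrable_supported (h : measurableTypeR R -> R) (B : R) :
  measurable_fun [set: measurableTypeR R] h ->
  (forall x : R, - L <= x <= L -> `|h x| <= B) ->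
  mu.-integrable [set: measurableTypeR R] (EFin \o h).
Proof.
move=> mh hB; have ms : measurable seg by exact: measurable_itv.
apply/(negligible_integrable (measurableC ms) measurableT _ muL).
  exact/measurable_EFinP.
rewrite setTD setCK; apply: measurable_bounded_integrable => //.
- by rewrite -ge0_fin_numE// fin_num_measure.
- exact: measurable_funTS.
- exists B; split; first exact: num_real.
  move=> x Bx y; rewrite /= in_itv/= => /hB /le_trans; apply; exact: ltW.
Qed.

Lemma Rintegral_supported (h : measurableTypeR R -> R) (B : R) :
  measurable_fun [set: measurableTypeR R] h ->
  (forall x : R, - L <= x <= L -> `|h x| <= B) ->
  \int[mu]_x h x = \int[mu]_(x in `[- L, L]) h x.
Proof.
move=> mh hB; have ms : measurable seg by exact: measurable_itv.
rewrite /Rintegral (negligible_integral (measurableC ms) measurableT _ muL)//.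
  by rewrite setTD setCK.
exact: integrable_supported hB.
Qed.

Lemma le_Rintegral_supported (h1 h2 : measurableTypeR R -> R) (B1 B2 : R) :
  measurable_fun [set: measurableTypeR R] h1 ->
  measurable_fun [set: measurableTypeR R] h2 ->
  (forall x : R, - L <= x <= L -> `|h1 x| <= B1) ->
  (forall x : R, - L <= x <= L -> `|h2 x| <= B2) ->
  (forall x : R, - L <= x <= L -> h1 x <= h2 x) ->
  \int[mu]_x h1 x <= \int[mu]_x h2 x.
Proof.
move=> m1 m2 b1 b2 h12; have ms : measurable seg by exact: measurable_itv.
rewrite (Rintegral_supported m1 b1) (Rintegral_supported m2 b2).
have i1 := integrable_supported m1 b1; have i2 := integrable_supported m2 b2.
apply: le_Rintegral => //.
- by apply: (integrableS measurableT ms _ i1).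
- by apply: (integrableS measurableT ms _ i2).
Qed.

End CompactlySupportedMeasure.

Section PolynomialFunctional.
Context {R : realType}.

Lemma measurable_horner (q : {poly R}) :
  measurable_fun [set: measurableTypeR R] (fun x : measurableTypeR R => q.[x]).
Proof. by apply: continuous_measurable_fun; exact: continuous_horner. Qed.

Lemma horner_bounded (q : {poly R}) (c d : R) :
  exists B : R, forall x : R, c <= x <= d -> `|q.[x]| <= B.
Proof.
have [B HB] := poly_itv_bound q c d.
by exists B => x xcd; apply: HB.
Qed.

Definition poly_int (mu : {finite_measure set (measurableTypeR R) -> \bar R})
  (q : {poly R}) : R := \int[mu]_x q.[x].

Variable mu : {finite_measure set (measurableTypeR R) -> \bar R}.
Hypothesis mu_adm : exists c d : R, mu (~` `[c, d]) = 0%E.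

Lemma symmetric_support : exists L : R, mu (~` `[- L, L]) = 0%E.
Proof.
have [c [d mucd]] := mu_adm; exists (Num.max `|c| `|d|).
apply/eqP; rewrite -measure_le0 -mucd; apply: le_measure; rewrite ?inE.
- by apply: measurableC; exact: measurable_itv.
- by apply: measurableC; exact: measurable_itv.
apply: subsetC => x; rewrite /= !in_itv/= => /andP[cx xd]; rewrite -ler_norml.
rewrite le_max; have [x0|x0] := leP 0 x.
  by apply/orP; right; rewrite ger0_norm// (le_trans xd)// ler_norm.
apply/orP; left; rewrite ltr0_norm//; apply: le_trans (_ : - c <= _); first by rewrite lerN2.
by rewrite -normrN ler_norm.
Qed.

Lemma integrable_horner (q : {poly R}) :
  mu.-integrable [set: measurableTypeR R] (EFin \o (fun x => q.[x])).
Proof.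
have [L muL] := symmetric_support; have [B hB] := horner_bounded q (- L) L.
exact: (integrable_supported muL (measurable_horner q) hB).
Qed.

Local Notation I := (poly_int mu).

Lemma poly_intD q r : I (q + r) = I q + I r.
Proof.
rewrite /poly_int; under eq_Rintegral do rewrite hornerD.
by rewrite (RintegralD measurableT (integrable_horner q) (integrable_horner r)).
Qed.

Lemma poly_intZ c q : I (c *: q) = c * I q.
Proof.
rewrite /poly_int; under eq_Rintegral do rewrite hornerZ.
by rewrite (RintegralZl _ measurableT (integrable_horner q)).
Qed.

Lemma poly_int0 : I 0 = 0.
Proof. by rewrite -(scale0r 0) poly_intZ mul0r. Qed.

Lemma poly_int_sum (J : Type) (s : seq J) (P : pred J) (F : J -> {poly R}) :
  I (\sum_(j <- s | P j) F j) = \sum_(j <- s | P j) I (F j).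
Proof. exact: (big_morph _ poly_intD poly_int0). Qed.

Variable p : nat -> {poly R}.
Hypothesis p_on : orthonormal_polynomials mu p.

Lemma size_op n : size (p n) = n.+1.
Proof. by have [+ _] := p_on => /(_ n)[]. Qed.

Lemma lead_op_gt0 n : 0 < lead_coef (p n).
Proof. by have [+ _] := p_on => /(_ n)[]. Qed.

Lemma poly_int_op l m : I (p l * p m) = (l == m)%:R.
Proof.
have [_ on] := p_on; rewrite /poly_int /Rintegral.
by under eq_integral do rewrite hornerM; rewrite on.
Qed.

Lemma op_reduce (q : {poly R}) d : size q = d.+1 ->
  exists2 r : {poly R}, (size r <= d)%N &
    q = (lead_coef q / lead_coef (p d)) *: p d + r.
Proof.
move=> sq; set c := _ / _; exists (q - c *: p d); last by rewrite subrKC.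
apply/leq_sizeP => j; rewrite leq_eqVlt => /predU1P[<-|dj].
  rewrite coefB coefZ.
  have -> : q`_d = lead_coef q by rewrite lead_coefE sq.
  have -> : (p d)`_d = lead_coef (p d) by rewrite lead_coefE size_op.
  by rewrite /c divfK ?subrr// gt_eqF// lead_op_gt0.
by rewrite coefB coefZ !nth_default ?mulr0 ?subr0// ?size_op ?sq.
Qed.

(** Expand [q] in the basis [p]. *)
Lemma op_orthogonal (q : {poly R}) n : (size q <= n)%N -> I (q * p n) = 0.
Proof.
move: {2}(size q) (leqnn (size q)) => m; elim: m q => [|m IH] q qm qn.
  by move: qm; rewrite leqn0 size_poly_eq0 => /eqP ->; rewrite mul0r poly_int0.
have [/IH->//|mq] := leqP (size q) m.
have sq : size q = m.+1 by apply/eqP; rewrite eqn_leq qm mq.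
have [r rm ->] := op_reduce sq.
have mn : (m < n)%N by rewrite -sq.
rewrite mulrDl poly_intD -scalerAl poly_intZ poly_int_op IH//; last first.
  exact: leq_trans rm (ltnW mn).
by rewrite ltn_eqF// mulr0 addr0.
Qed.

(** If [q >= 0] integrates to zero then [q] vanishes almost everywhere, hence is
    orthogonal to the [p d] of its own degree, which its leading term forbids. *)
Lemma poly_int_ge0_eq0 (q : {poly R}) : (forall x, 0 <= q.[x]) -> I q = 0 -> q = 0.
Proof.
move=> q0 Iq0; apply/eqP; apply: contraT => qn0.
have mq : measurable_fun [set: measurableTypeR R] (fun x : measurableTypeR R => (q.[x])%:E).
  by apply/measurable_EFinP; exact: measurable_horner.
have /(ae_eq_integral_abs mu measurableT mq) aeq :
    (\int[mu]_x `|(q.[x])%:E| = 0)%E.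
  under eq_integral do rewrite gee0_abs ?lee_fin ?q0//.
  have fi := integrable_fin_num measurableT (integrable_horner q).
  by rewrite -(fineK fi) -[fine _]/(I q) Iq0.
have [d sq] : exists d, size q = d.+1.
  by exists (size q).-1; rewrite prednK// size_poly_gt0.
have : I (q * p d) = 0.
  rewrite /poly_int /Rintegral.
  rewrite (@ae_eq_integral _ _ _ mu setT (cst 0%E))//.
  - by rewrite integral0.
  - by apply/measurable_EFinP; exact: measurable_horner.
  - case: aeq => A [mA A0 hA]; exists A; split => // x /= hx; apply: hA => /= h; apply: hx => _.
    by have /= := h Logic.I => -[]; rewrite hornerM => ->; rewrite mul0r.
have [r rd ->] := op_reduce sq.
rewrite mulrDl poly_intD -scalerAl poly_intZ poly_int_op eqxx mulr1.
rewrite op_orthogonal// addr0 => /eqP.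
by rewrite mulf_eq0 invr_eq0 lead_coef_eq0 (negbTE qn0)/= (gt_eqF (lead_op_gt0 d)).
Qed.

End PolynomialFunctional.

Section JacobiEntries.
Context {R : realType}.
Variable mu : {finite_measure set (measurableTypeR R) -> \bar R}.
Variables (p : nat -> {poly R}) (a b : nat -> R) (M : R).
Hypothesis mu_adm : exists c d : R, mu (~` `[c, d]) = 0%E.
Hypothesis p_on : orthonormal_polynomials mu p.
Hypothesis ab_rec : recurrence_coefficients p a b.
Hypothesis aM : forall l, `|a l| <= M.
Hypothesis bM : forall l, `|b l| <= M.

(** The entry [(k, l)] of the [m]th power of the Jacobi matrix. *)
Definition jacobi_entry (m k l : nat) : R := poly_int mu ('X^m * p k * p l).
Local Notation W := jacobi_entry.

Lemma jacobi_entry0 k l : W 0 k l = (k == l)%:R.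
Proof. by rewrite /jacobi_entry expr0 mul1r poly_int_op. Qed.

(** The recurrence is applied to the factor [p k]. At [k = 0] the default value
    [0.-1 = 0] is harmless, because [b 0 = 0]. *)
Lemma jacobi_entryS m k l : W m.+1 k l =
  b k.+1 * W m k.+1 l + a k * W m k l + b k * W m k.-1 l.
Proof.
have [b0 _ rec] := ab_rec.
rewrite /jacobi_entry exprSr -(mulrA 'X^m) rec.
rewrite !mulrDr !mulrDl !poly_intD// -!scalerAr -!scalerAl !poly_intZ//.
case: k => [|k] /=; last by [].
by rewrite b0 !mul0r.
Qed.

Lemma jacobi_entry_le m k l : `|W m k l| <= (3 * M) ^+ m.
Proof.
have M0 : 0 <= M by exact: le_trans (normr_ge0 _) (aM 0).
elim: m k => [|m IH] k.
  by rewrite jacobi_entry0 expr0 normr_nat; case: (k == l).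
have P x y : `|x| <= M -> `|x * W m y l| <= M * (3 * M) ^+ m.
  by move=> xM; rewrite normrM ler_pM.
rewrite jacobi_entryS exprS.
apply: (le_trans (ler_normD _ _)); apply: (@le_trans _ _ (M * (3 * M) ^+ m + M * (3 * M) ^+ m + M * (3 * M) ^+ m)); last first.
  by rewrite le_eqVlt; apply/orP; left; apply/eqP; ring.
rewrite lerD ?P//; apply: (le_trans (ler_normD _ _)); by rewrite lerD ?P.
Qed.

(** The even moments of [mu] grow at most like [(3 M) ^ m], so by Chebyshev's
    inequality [mu] cannot charge any set on which [|x| >= 3 M + 1]. *)
Lemma support_bound : mu (~` `[- (3 * M + 1), 3 * M + 1]) = 0%E.
Proof.
have M0 : 0 <= M by exact: le_trans (normr_ge0 _) (aM 0).
set L := 3 * M + 1; have L0 : 0 < L by rewrite ltr_wpDl// mulr_ge0.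
set A := ~` _.
have mA : measurable (A : set (measurableTypeR R)) by apply: measurableC; exact: measurable_itv.
pose c := (p 0)`_0.
have p0E : p 0 = c%:P by apply: size1_polyC; rewrite (size_op p_on).
have c0 : c != 0.
  by have := size_op p_on 0%N; rewrite p0E size_polyC; case: (c != 0).
have fA : mu A \is a fin_num by exact: fin_num_measure.
(* Chebyshev's inequality for the power [2 m]; [p 0] is the constant [c]. *)
have key m : fine (mu A) <= ((3 * M / L) ^+ 2) ^+ m / c ^+ 2.
  have i := integrable_horner mu_adm 'X^(2 * m).
  have i' : mu.-integrable A (EFin \o (fun x => ('X^(2 * m) : {poly R}).[x])).
    exact: (integrableS measurableT mA _ i).
  have h1 : L ^+ (2 * m) * fine (mu A) <= poly_int mu 'X^(2 * m).
    rewrite -(Rintegral_cst mu mA); apply: (@le_trans _ _ (\int[mu]_(x in A) ('X^(2 * m) : {poly R}).[x])).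
      apply: le_Rintegral => //; first exact: finite_measure_integrable_cst.
      move=> x; rewrite /A /= in_itv/= => /negP; rewrite -ler_norml -ltNge => Lx.
      rewrite hornerXn !exprM -(real_normK (num_real x)) lerXn2r ?nnegrE ?sqr_ge0//.
      by rewrite lerXn2r ?nnegrE ?(ltW L0)// ltW.
    rewrite /poly_int /Rintegral fine_le ?integrable_fin_num//.
    apply: ge0_subset_integral => //.
      by apply/measurable_EFinP; exact: measurable_horner.
    by move=> x _; rewrite lee_fin hornerXn exprM exprn_ge0 ?sqr_ge0.
  have h2 : c ^+ 2 * poly_int mu 'X^(2 * m) <= (3 * M) ^+ (2 * m).
    have := le_trans (ler_norm _) (jacobi_entry_le (2 * m) 0 0).
    by rewrite /jacobi_entry p0E -mulrA -polyCM mulrC mul_polyC poly_intZ// expr2.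
  have Lm : 0 < L ^+ (2 * m) by rewrite exprn_gt0.
  have cc : 0 < c ^+ 2 by rewrite exprn_even_gt0.
  rewrite ler_pdivlMr// -exprM expr_div_n ler_pdivlMr//; apply: le_trans h2.
  have -> : fine (mu A) * c ^+ 2 * L ^+ (2 * m) = c ^+ 2 * (L ^+ (2 * m) * fine (mu A)) by ring.
  by rewrite ler_wpM2l// ltW.
have r01 : `|(3 * M / L) ^+ 2| < 1.
  rewrite normrX exprn_ilt1//= ger0_norm ?divr_ge0 ?(ltW L0) ?mulr_ge0//.
  by rewrite ltr_pdivrMr// mul1r ltrDl.
have h := cvgnZ (c ^+ 2)^-1 (cvg_expr r01); rewrite mulr0 in h.
have le0 : fine (mu A) <= 0.
  by apply: (cvgn_ge h) => n; rewrite mulrC; exact: key.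
transitivity ((fine (mu A))%:E); first by rewrite fineK.
by congr (_%:E); apply/le_anti; rewrite le0 fine_ge0// measure_ge0.
Qed.

End JacobiEntries.

(** * Convergence of the mean moments *)

Section CentralBinomial.
Context {R : realType}.

(** The number of [m]-step walks from [j] to [l] with steps [1] and [-1],
    as a coefficient of [(1 + X ^ 2) ^ m X ^ j]. *)
Definition walks (m j l : nat) : R := ((1 + 'X^2) ^+ m * 'X^j : {poly R})`_(l + m).

Lemma walks0 j l : walks 0 j l = (j == l)%:R.
Proof. by rewrite /walks expr0 mul1r addn0 coefXn eq_sym. Qed.

Lemma walksS m j l : walks m.+1 j.+1 l = walks m j.+2 l + walks m j l.
Proof.
rewrite /walks addnS -coefD.
have -> : (1 + 'X^2) ^+ m.+1 * 'X^(j.+1) =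
  ((1 + 'X^2) ^+ m * 'X^(j.+2) + (1 + 'X^2) ^+ m * 'X^j) * 'X :> {poly R}.
  by rewrite !exprS; ring.
by rewrite coefMX.
Qed.

Lemma walks_central m : walks m m m = \sum_(i < m.+1) (m == i.*2)%:R *+ 'C(m, i).
Proof.
rewrite /walks coefMXn ltnNge leq_addr/= addnK exprDn coef_sum.
by apply: eq_bigr => i _; rewrite expr1n mul1r -exprM coefMn coefXn mul2n.
Qed.

Lemma walks_odd m : odd m -> walks m m m = 0.
Proof.
move=> om; rewrite walks_central big1// => i _.
have -> : (m == i.*2) = false by apply: contraTF om => /eqP ->; rewrite odd_double.
by rewrite mul0rn.
Qed.

Lemma walks_even h : walks h.*2 h.*2 h.*2 = 'C(h.*2, h)%:R.
Proof.
have hh : (h < h.*2.+1)%N by rewrite ltnS -addnn leq_addr.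
rewrite walks_central (bigD1 (Ordinal hh))//= eqxx big1 ?addr0// => i ih.
rewrite (_ : (h.*2 == i.*2) = false) ?mul0rn//.
by apply: contraNF ih => /eqP /double_inj h2; apply/eqP/val_inj.
Qed.

End CentralBinomial.

Section EquilibriumFunctional.
Context {R : realType}.
Variable alpha : R.
Hypothesis alpha_gt0 : 0 < alpha.
Notation leb := (@lebesgue_measure R).

Definition equilibrium_moment (j : nat) : R := wmoment alpha j / wmoment alpha 0.

Lemma equilibrium_moment0 : equilibrium_moment 0 = 1.
Proof. by rewrite /equilibrium_moment divff// gt_eqF// wmoment0_gt0. Qed.

Lemma equilibrium_moment_odd j : odd j -> equilibrium_moment j = 0.
Proof. by move=> oj; rewrite /equilibrium_moment wmoment_odd// mul0r. Qed.

Lemma equilibrium_momentS h : equilibrium_moment h.+1.*2 =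
  h.*2.+1%:R / (h.*2%:R + alpha + 2) * equilibrium_moment h.*2.
Proof.
have d0 : 0 < h.*2%:R + alpha + 2 by rewrite -addrA ltr_wpDl// addr_gt0.
have := @wmoment_rec R alpha h.*2.+1 alpha_gt0; rewrite /= => e.
have d0' : h.*2%:R + alpha + 2 != 0 by rewrite gt_eqF.
apply: (mulfI d0'); rewrite /equilibrium_moment doubleS.
rewrite [RHS]mulrA [X in _ = X * _]mulrC divfK// !mulrA e; congr (_ * _ / _).
by rewrite -[h.*2.+1%:R]natr1; ring.
Qed.

Lemma equilibrium_moment_ge0 h : 0 <= equilibrium_moment h.*2.
Proof. by rewrite divr_ge0 ?(wmoment_ge0 h alpha_gt0)// ltW// wmoment0_gt0. Qed.

(** The recursion makes the left-hand side nonincreasing in [h]; hence the even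
    moments tend to 0. *)
Lemma equilibrium_moment_sqr_le h :
  equilibrium_moment h.*2 ^+ 2 * (h.*2.+1%:R) <= 1.
Proof.
elim: h => [|h IH]; first by rewrite equilibrium_moment0 expr1n mulr1.
apply: le_trans IH; rewrite equilibrium_momentS exprMn mulrC mulrA.
rewrite [leRHS]mulrC ler_wpM2r ?sqr_ge0//.
have x0 : 0 <= h.*2%:R :> R by [].
have -> : h.+1.*2.+1%:R = h.*2%:R + 3 :> R by rewrite doubleS -addn3 natrD.
rewrite -[h.*2.+1%:R]natr1; move: (h.*2%:R) x0 => x x0.
rewrite expr_div_n mulrA ler_pdivrMr; last first.
  by rewrite exprn_gt0// -addrA ltr_wpDl// addr_gt0.
rewrite -subr_ge0.
have -> : (x + 1) * (x + alpha + 2) ^+ 2 - (x + 3) * (x + 1) ^+ 2 =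
  (x + 1) * (alpha ^+ 2 + 2 * alpha * (x + 2) + 1) by ring.
by rewrite mulr_ge0 ?addr_ge0 ?sqr_ge0 ?mulr_ge0 ?addr_ge0 ?(ltW alpha_gt0).
Qed.

(** Both sides obey the same recursion in [h]. *)
Lemma equilibrium_moment_central h :
  equilibrium_moment h.*2 = 'C(h.*2, h)%:R *
    (2 ^- h.*2 * (rbinom ((alpha + h.*2%:R) / 2) (alpha / 2))^-1).
Proof.
have a2 : 0 < alpha / 2 by rewrite divr_gt0.
have a21 : 0 < alpha / 2 + 1 by rewrite addr_gt0.
have E k : rbinom ((alpha + k.*2%:R) / 2) (alpha / 2) =
    Gamma (alpha / 2 + 1 + k%:R) / (Gamma (alpha / 2 + 1) * Gamma (k%:R + 1)).
  rewrite /rbinom -mul2n natrM.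
  have -> : (alpha + 2 * k%:R) / 2 + 1 = alpha / 2 + 1 + k%:R by field.
  by have -> : (alpha + 2 * k%:R) / 2 - alpha / 2 + 1 = k%:R + 1 by field.
elim: h => [|h IH].
  by rewrite equilibrium_moment0 E addr0 add0r Gamma1 mulr1 divff ?gt_eqF ?Gamma_gt0// expr0 !invr1 !mulr1.
rewrite equilibrium_momentS IH !E.
have C : h.+1%:R * ('C(h.+1.*2, h.+1))%:R = 2 * h.*2.+1%:R * ('C(h.*2, h))%:R :> R.
  have e1 := mul_bin_diag h.*2.+2 h; have e2 := mul_bin_down h.*2.+1 h.
  rewrite /= in e1 e2; have e3 : (h.*2.+1 - h = h.+1)%N by rewrite -addnn subSn ?leq_addr// addnK.
  rewrite e3 in e2; rewrite -!natrM doubleS -e1; congr (_%:R).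
  by rewrite -mulnA e2 (_ : h.*2.+2 = 2 * h.+1)%N ?mulnA// mul2n doubleS.
have h1 : h.+1%:R != 0 :> R by rewrite pnatr_eq0.
have -> : 'C(h.+1.*2, h.+1)%:R = 2 * h.*2.+1%:R * ('C(h.*2, h))%:R / h.+1%:R :> R.
  by rewrite -C mulrAC divff// mul1r.
have x0 : 0 < alpha / 2 + 1 + h%:R by rewrite ltr_wpDr.
have y0 : 0 < h%:R + 1 :> R by rewrite ltr_wpDl.
have -> : alpha / 2 + 1 + h.+1%:R = alpha / 2 + 1 + h%:R + 1 by rewrite -[h.+1%:R]natr1 addrA.
rewrite (GammaS x0) -[h.+1%:R]natr1 (GammaS y0).
have g1 := gt_eqF (Gamma_gt0 x0); have g2 := gt_eqF (Gamma_gt0 y0); have g3 := gt_eqF (Gamma_gt0 a21).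
have x0' := gt_eqF x0; have y0' := gt_eqF y0.
have z0' : (h.*2%:R + alpha + 2 == 0) = false by rewrite gt_eqF// -addrA ltr_wpDl// addr_gt0.
have -> : (2 : R) ^- h.+1.*2 = 2 ^- h.*2 / 4.
  by rewrite doubleS -(addn2 h.*2) exprD invfM; congr (_ * _^-1); rewrite expr2 -natrM.
move: g1 g2 g3; move: (Gamma _) (Gamma _) (Gamma _) ('C(_, _)%:R) (2 ^- _) (h.*2.+1%:R : R) => A B D E' F G.
rewrite -mul2n natrM in z0' *.
move=> g1 g2 g3; field; rewrite ?g1 ?g2 ?g3 ?x0' ?y0' ?z0'.
by rewrite (_ : alpha + 2 + _ = 2 * h%:R + alpha + 2) ?z0'//; ring.
Qed.

Lemma walks_equilibrium_moment m :
  walks m m m * (2 ^- m * (rbinom ((alpha + m%:R) / 2) (alpha / 2))^-1) =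
  equilibrium_moment m.
Proof.
have [om|em] := boolP (odd m); first by rewrite walks_odd// equilibrium_moment_odd// mul0r.
have -> : m = m./2.*2 by rewrite even_halfK.
by rewrite walks_even equilibrium_moment_central.
Qed.

(** The endpoints are left out, because the weight may be singular there. *)
Definition equilibrium_poly (q : {poly R}) : R :=
  (wmoment alpha 0)^-1 *
  \int[leb]_(x in `]-1, 1[) (q.[x] * equilibrium_weight alpha x).

Lemma equilibrium_integrable (h : R -> R) (B : R) :
  measurable_fun (`]-1, 1[%classic : set (measurableTypeR R)) h ->
  (forall x : R, -1 < x < 1 -> `|h x| <= B) ->
  leb.-integrable `]-1, 1[ (EFin \o (fun x => h x * equilibrium_weight alpha x)).
Proof.
move=> mh hB; have [i0 _] := moment_exhaustion 0 alpha_gt0.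
have mD : measurable (`]-1, 1[%classic : set (measurableTypeR R)) by exact: measurable_itv.
have B0 : 0 <= B by apply: le_trans (hB 0 _); rewrite ?oppr_lt0 ?ltr01.
have iB := integrableZl mD B i0.
apply: (le_integrable mD _ _ iB).
- apply/measurable_EFinP; apply: measurable_funM => //.
  have -> : equilibrium_weight alpha = moment_integrand alpha 0.
    by apply/funext => x; rewrite /moment_integrand expr0 mul1r.
  by apply: measurable_funTS; exact: measurable_moment_integrand.
- move=> x; rewrite /= in_itv/= => x1.
  have -> : moment_integrand alpha 0 x = equilibrium_weight alpha x.
    by rewrite /moment_integrand expr0 mul1r.
  rewrite lee_fin !normrM (ger0_norm B0).
  by rewrite ler_wpM2r// hB.
Qed.

Lemma equilibrium_poly_integrable (q : {poly R}) :
  leb.-integrable `]-1, 1[ (EFin \o (fun x => q.[x] * equilibrium_weight alpha x)).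
Proof.
have [B hB] := horner_bounded q (-1) 1.
apply: (@equilibrium_integrable _ B).
  by apply: measurable_funTS; exact: measurable_horner.
by move=> x /andP[x1 x2]; apply: hB; rewrite !ltW.
Qed.

Lemma equilibrium_polyD q r :
  equilibrium_poly (q + r) = equilibrium_poly q + equilibrium_poly r.
Proof.
have mD : measurable (`]-1, 1[%classic : set (measurableTypeR R)) by exact: measurable_itv.
rewrite /equilibrium_poly -mulrDr; congr (_ * _).
rewrite -(RintegralD mD (equilibrium_poly_integrable q) (equilibrium_poly_integrable r)).
by apply: eq_Rintegral => x _; rewrite hornerD mulrDl.
Qed.

Lemma equilibrium_polyZ c q :
  equilibrium_poly (c *: q) = c * equilibrium_poly q.
Proof.
have mD : measurable (`]-1, 1[%classic : set (measurableTypeR R)) by exact: measurable_itv.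
rewrite /equilibrium_poly mulrCA; congr (_ * _).
rewrite -(RintegralZl _ mD (equilibrium_poly_integrable q)).
by apply: eq_Rintegral => x _; rewrite hornerZ mulrA.
Qed.

Lemma equilibrium_polyXn j : equilibrium_poly 'X^j = equilibrium_moment j.
Proof.
rewrite /equilibrium_poly /equilibrium_moment mulrC; congr (_ * _).
by apply: eq_Rintegral => x _; rewrite hornerXn.
Qed.

End EquilibriumFunctional.

Section PolynomialLimits.
Context {R : realType}.

Lemma poly_functional_cvg (F : nat -> {poly R} -> R) (G : {poly R} -> R) :
  (forall n q r, F n (q + r) = F n q + F n r) ->
  (forall n c q, F n (c *: q) = c * F n q) ->
  (forall q r, G (q + r) = G q + G r) -> (forall c q, G (c *: q) = c * G q) ->
  (forall j, F n 'X^j @[n --> \oo] --> G 'X^j) ->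
  forall q, F n q @[n --> \oo] --> G q.
Proof.
move=> FD FZ GD GZ FG q; rewrite -[q]coefK poly_def.
elim: (size q) => [|k IH].
  rewrite big_ord0; have G0 : G 0 = 0 by rewrite -(scale0r 0) GZ mul0r.
  rewrite G0; apply: (cvgn_ext _ (cvgn_cst 0)) => n.
  by rewrite -[in RHS](scale0r 0) FZ mul0r.
rewrite big_ord_recr/= GD GZ.
have h := cvgnD IH (cvgnZ q`_k (FG k)).
by apply: (cvgn_ext _ h) => n; rewrite FD FZ.
Qed.

End PolynomialLimits.

Section MeanMoments.
Context {R : realType}.
Variable alpha : R.
Hypothesis alpha_gt0 : 0 < alpha.
Variables (mu : nat -> {finite_measure set (measurableTypeR R) -> \bar R}).
Variables (p : nat -> nat -> {poly R}) (a b : nat -> nat -> R) (M : R).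
Hypothesis mu_adm : forall k, exists c d : R, mu k (~` `[c, d]) = 0%E.
Hypothesis p_on : forall k, orthonormal_polynomials (mu k) (p k).
Hypothesis ab_rec : forall k, recurrence_coefficients (p k) (a k) (b k).
Hypothesis aM : forall k l, `|a k l| <= M.
Hypothesis bM : forall k l, `|b k l| <= M.
Hypothesis a_null : forall l, (0 < l)%N -> mean_null alpha (fun i k => a i (k + l)%N - a i k).
Hypothesis b_null : forall l, (0 < l)%N -> mean_null alpha (fun i k => b i (k + l)%N - b i k).
Variable s : nat -> R.
Hypothesis ab_mean : forall la lb,
  cesaro_mean alpha (fun i k => a i k ^+ la * b i k ^+ lb) n @[n --> \oo] -->
    (la == 0%N)%:R * s lb.

Local Notation W i := (jacobi_entry (mu i) (p i)).

(** In the mean the Jacobi matrix looks like a Toeplitz matrix with constants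
    [a i k] and [b i k]: expanding an entry of its [m]th power along the recursion,
    all indices may be moved back to [k] at the cost of a null array. A path
    with a diagonal step contributes a factor [a i k], which the limits kill; the
    paths without diagonal steps are the walks counted by [walks m j l], each
    contributing [b i k ^+ m]. The condition [m <= j] keeps them off the boundary. *)
Lemma jacobi_entry_mean m la lb j l : (m <= j)%N ->
  cesaro_mean alpha (fun i k => a i k ^+ la * b i k ^+ lb * W i m (k + j) (k + l)) n
    @[n --> \oo] --> (la == 0%N)%:R * walks m j l * s (lb + m)%N.
Proof.
elim: m la lb j => [|m IH] la lb j mj.
  have h := cvgnZ ((j == l)%:R) (@ab_mean la lb).
  rewrite addn0 walks0 -mulrA mulrCA mulrA; move: h; rewrite mulrA; apply: cvgn_ext => n.
  rewrite -cesaro_meanZ; apply: eq_bigr => k _; congr (_ * _).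
  by rewrite (jacobi_entry0 (p_on _)) eqn_add2l mulrC.
case: j mj => // j mj.
have c1 := @IH la lb.+1 j.+2 (leqW (leqW mj)); have c2 := @IH la.+1 lb j.+1 (leqW mj); have c3 := @IH la lb.+1 j mj.
have M0 : 0 <= M by exact: le_trans (normr_ge0 _) (aM 0 0).
pose c i k := a i k ^+ la * b i k ^+ lb.
have cB i k : `|c i k| <= M ^+ la * M ^+ lb.
  by rewrite normrM !normrX ler_pM ?exprn_ge0// lerXn2r ?nnegrE.
have WB i k y : `|c i k * W i m y (k + l)%N| <= M ^+ la * M ^+ lb * (3 * M) ^+ m.
  by rewrite normrM ler_pM// (jacobi_entry_le (mu_adm i) (p_on i) (ab_rec i) (aM i) (bM i)).
pose v i k := (a i k ^+ la * b i k ^+ lb.+1 * W i m (k + j.+2)%N (k + l)%N +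
   a i k ^+ la.+1 * b i k ^+ lb * W i m (k + j.+1)%N (k + l)%N) +
   a i k ^+ la * b i k ^+ lb.+1 * W i m (k + j)%N (k + l)%N.
(* [v] is the right-hand side of the recursion with its coefficients moved to [k]. *)
apply: (@mean_null_cvg _ _ _ v); last first.
  have h := cvgnD (cvgnD c1 c2) c3.
  rewrite walksS addnS -addSn /=.
  have e : (la == 0)%:R * (walks m j.+2 l + walks m j l) * s (lb.+1 + m)%N =
    (la == 0)%:R * walks m j.+2 l * s (lb.+1 + m)%N + 0%:R * walks m j.+1 l * s (lb + m)%N
     + (la == 0)%:R * walks m j l * s (lb.+1 + m)%N by rewrite !mul0r addr0 -mulrDl -mulrDr.
  rewrite e; move: h; apply: cvgn_ext => n.
  by rewrite -!cesaro_meanD.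
pose d1 i k := (b i (k + j.+2)%N - b i k) * (c i k * W i m (k + j.+2)%N (k + l)%N).
pose d2 i k := (a i (k + j.+1)%N - a i k) * (c i k * W i m (k + j.+1)%N (k + l)%N).
pose d3 i k := (b i (k + j.+1)%N - b i k) * (c i k * W i m (k + j)%N (k + l)%N).
have n1 : mean_null alpha d1 by apply: mean_nullM => //; exact: b_null.
have n2 : mean_null alpha d2 by apply: mean_nullM => //; exact: a_null.
have n3 : mean_null alpha d3 by apply: mean_nullM => //; exact: b_null.
have := mean_nullD (mean_nullD n1 n2) n3.
rewrite /mean_null; apply: cvgn_ext => n; apply: eq_bigr => k _; congr (_ * `|_|).
rewrite (jacobi_entryS (mu_adm _) (ab_rec _)).
have -> : (k + j.+1).+1 = (k + j.+2)%N by rewrite !addnS.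
have -> : (k + j.+1).-1 = (k + j)%N by rewrite addnS.
by rewrite /d1 /d2 /d3 /v /c !exprS; ring.
Qed.

Lemma jacobi_diagonal_mean m :
  cesaro_mean alpha (fun i k => W i m k k) n @[n --> \oo] --> walks m m m * s m.
Proof.
apply: (@cesaro_mean_shift _ _ alpha_gt0 _ _ ((3 * M) ^+ m) m) => [i k|].
  exact: (jacobi_entry_le (mu_adm i) (p_on i) (ab_rec i) (aM i) (bM i)).
have := @jacobi_entry_mean m 0 0 m m (leqnn m); rewrite mul1r add0n; apply: cvgn_ext => n.
by apply: eq_bigr => k _; rewrite !expr0 !mul1r.
Qed.

End MeanMoments.

(** * Roots of orthogonal polynomials *)

Section SignFactorization.
Context {R : realType}.

Lemma no_root_sign (q : {poly R}) : (forall x, ~~ root q x) ->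
  (forall x, 0 <= q.[x]) \/ (forall x, q.[x] <= 0).
Proof.
move=> nr; have key x y : x <= y -> ~ (Num.min q.[x] q.[y] <= 0 <= Num.max q.[x] q.[y]).
  move=> xy h; have [] := @IVT R (fun z => q.[z]) x y 0 xy _ h.
    by apply: continuous_subspaceT => z; exact: continuous_horner.
  by move=> c _ /eqP qc; have := nr c; rewrite /root qc.
have key2 x y : 0 < q.[x] -> q.[y] < 0 -> False.
  move=> qx qy; have yx := lt_trans qy qx; have [xy|/ltW yx'] := leP x y.
    by apply: (key _ _ xy); rewrite ge_min le_max (ltW qx) (ltW qy) orbT.
  by apply: (key _ _ yx'); rewrite ge_min le_max (ltW qx) (ltW qy) orbT.
have [q0|q0] := leP 0 q.[0].
- left=> x; rewrite leNgt; apply/negP => qx; apply: (key2 0 x) => //.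
  by rewrite lt_neqAle q0 andbT eq_sym; exact: nr.
- right=> x; rewrite leNgt; apply/negP => qx; exact: (key2 x 0).
Qed.

(** Pair up the repeated linear factors: what remains of [q] after dividing by
    distinct linear factors can be taken of constant sign. *)
Lemma sign_factorization (q : {poly R}) : q != 0 ->
  exists (s : seq R) (e : {poly R}), [/\ uniq s, q = \prod_(y <- s) ('X - y%:P) * e &
    (forall x, 0 <= e.[x]) \/ (forall x, e.[x] <= 0)].
Proof.
move: {2}(size q) (leqnn (size q)) => m; elim: m q => [|m IH] q qm q0.
  by move: qm q0; rewrite leqn0 size_poly_eq0 => ->.
have [[y qy]|nr] := pselect (exists y, root q y); last first.
  exists [::], q; split => //; first by rewrite big_nil mul1r.
  by apply: no_root_sign => x; apply/negP => rx; apply: nr; exists x.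
have /factor_theorem[q1 qE] := qy.
have q10 : q1 != 0 by apply: contraNneq q0 => q10; rewrite qE q10 mul0r.
have q1m : (size q1 <= m)%N.
  by move: qm; rewrite qE size_Mmonic ?monicXsubC// size_XsubC addn2.
have [s [e [us q1E es]]] := IH q1 q1m q10.
have [ys|ys] := boolP (y \in s); last first.
  exists (y :: s), e; split => //=; first by rewrite ys.
  by rewrite big_cons qE q1E; ring.
exists (rem y s), (('X - y%:P) ^+ 2 * e); split; first exact: rem_uniq.
  rewrite qE q1E (perm_big _ (perm_to_rem ys))/= big_cons expr2; ring.
case: es => es; [left|right] => x; rewrite hornerM horner_exp.
- by rewrite mulr_ge0 ?sqr_ge0.
- by rewrite mulr_ge0_le0 ?sqr_ge0.
Qed.

End SignFactorization.

Section OrthogonalPolynomialRoots.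
Context {R : realType}.
Variable mu : {finite_measure set (measurableTypeR R) -> \bar R}.
Variables (p : nat -> {poly R}) (a b : nat -> R) (M : R).
Hypothesis mu_adm : exists c d : R, mu (~` `[c, d]) = 0%E.
Hypothesis p_on : orthonormal_polynomials mu p.
Hypothesis ab_rec : recurrence_coefficients p a b.
Hypothesis aM : forall l, `|a l| <= M.
Hypothesis bM : forall l, `|b l| <= M.
Local Notation I := (poly_int mu).

Lemma op_neq0 n : p n != 0.
Proof. by rewrite -size_poly_eq0 (size_op p_on). Qed.

(** If [p n] had fewer than [n] roots of odd multiplicity, it would be orthogonal
    to the product of the corresponding linear factors, while their product with
    [p n] has constant sign. *)
Lemma op_split n : exists s : seq R, [/\ uniq s, size s = n &
  forall x, root (p n) x = (x \in s)].
Proof.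
have [s [e [us pE es]]] := sign_factorization (op_neq0 n).
set P := \prod_(y <- s) ('X - y%:P) in pE.
have P0 : P != 0 by rewrite monic_neq0// monic_prod_XsubC.
have e0 : e != 0 by apply: contraNneq (op_neq0 n) => e0; rewrite pE e0 mulr0.
have sP : size P = (size s).+1 by rewrite size_prod_XsubC.
have sz : (size s + size e = n.+1)%N.
  by have := size_op p_on n; rewrite pE size_proper_mul ?sP// mulf_neq0 ?lead_coef_eq0.
have szn : size s = n.
  have [sn|ns] := ltnP (size s) n; last first.
    by apply/eqP; rewrite eqn_leq ns andbT -ltnS -sz -addn1 leq_add2l size_poly_gt0.
  have o : I (P * p n) = 0 by rewrite (op_orthogonal mu_adm p_on)// sP.
  have PE : P * p n = P ^+ 2 * e by rewrite pE mulrA expr2.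
  have Pe0 : P ^+ 2 * e != 0 by rewrite mulf_neq0// expf_neq0.
  case: es => es.
  - have : P ^+ 2 * e = 0.
      apply: (poly_int_ge0_eq0 mu_adm p_on); last by rewrite -PE.
      by move=> x; rewrite hornerM horner_exp mulr_ge0 ?sqr_ge0.
    by move=> h; rewrite h eqxx in Pe0.
  - have : - (P ^+ 2 * e) = 0.
      apply: (poly_int_ge0_eq0 mu_adm p_on).
        by move=> x; rewrite hornerN oppr_ge0 hornerM horner_exp mulr_ge0_le0 ?sqr_ge0.
      by rewrite -PE -scaleN1r (poly_intZ mu_adm) o mulr0.
    by move=> /eqP; rewrite oppr_eq0 (negbTE Pe0).
exists s; split => // x; rewrite pE rootM root_prod_XsubC.
have /size_poly1P[c c0 ->] : size e == 1%N.
  by apply/eqP/(@addnI (size s)); rewrite sz szn addn1.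
by rewrite rootC (negbTE c0) orbF.
Qed.

(** A sum over all roots does not depend on their order. *)
Lemma sum_ordered_roots n (g : R -> R) (s : seq R) : uniq s ->
  (forall x, root (p n) x = (x \in s)) -> size s = n ->
  \sum_(1 <= j < n.+1) g (ordered_root p n j) = \sum_(y <- s) g y.
Proof.
move=> us rs sn.
have pr : perm_eq (rootsR (p n)) s.
  apply: uniq_perm => //.
    by rewrite /rootsR; apply: uniq_roots.
  by move=> x; rewrite -rs -(roots_on_rootsR (op_neq0 n)) in_itv.
have sr : size (rootsR (p n)) = n by rewrite (perm_size pr).
rewrite -(perm_big _ pr)/= [RHS](big_nth 0) sr big_add1/=.
by apply: eq_bigr.
Qed.

(** At a root [x] of [p n] the vector [(p 0 x, ..., p n.-1 x)] is an eigenvector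
    of the truncated Jacobi matrix, whose rows have absolute sum at most [3 M]. *)
Lemma op_root_le n x : root (p n) x -> `|x| <= 3 * M.
Proof.
case: n => [|n] rx.
  have := size_op p_on 0; move=> /eqP /size_poly1P[c c0 pc].
  by move: rx; rewrite pc rootC (negbTE c0).
pose f (l : 'I_n.+1) := `|(p l).[x]|.
pose l := [arg max_(i > ord0 | true) f i]%O.
have fmax (i : 'I_n.+1) : f i <= f l.
  by rewrite /l; case: Order.TotalTheory.arg_maxP => // i0 _; apply.
have f0 : 0 < f l.
  apply: lt_le_trans (fmax ord0); rewrite /f normr_gt0.
  have := size_op p_on 0; move=> /eqP /size_poly1P[c c0 /= ->].
  by rewrite hornerC.
have M0 : 0 <= M by exact: le_trans (normr_ge0 _) (aM 0).
have [b0 _ rec] := ab_rec.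
have := congr1 (fun q => q.[x]) (rec l).
rewrite /= hornerM hornerX !hornerD !hornerZ => e.
have h1 : `|b l.+1 * (p l.+1).[x]| <= M * f l.
  rewrite normrM; have [ln|ln] := ltnP l.+1 n.+1.
    by rewrite ler_pM// (fmax (Ordinal ln)).
  have -> : l.+1 = n.+1 by apply/eqP; rewrite eqn_leq ln andbT ltn_ord.
  by rewrite (rootP rx) normr0 mulr0 mulr_ge0// normr_ge0.
have h2 : `|a l * (p l).[x]| <= M * f l by rewrite normrM ler_pM.
have h3 : `|b l * (match nat_of_ord l with 0%N => 0 | l'.+1 => p l' end).[x]| <= M * f l.
  move: (ltn_ord l) (bM l); case: (nat_of_ord l) => [|l'] ll bl.
    by rewrite horner0 mulr0 normr0 mulr_ge0// normr_ge0.
  by rewrite normrM ler_pM// (fmax (Ordinal (ltnW ll))).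
rewrite -(ler_pM2r f0) /f -normrM e.
apply: (le_trans (ler_normD _ _)).
have -> : 3 * M * `|(p l).[x]| = M * f l + M * f l + M * f l by rewrite /f; ring.
by rewrite lerD// (le_trans (ler_normD _ _))// lerD.
Qed.

Lemma op_functional_eq0 (D : {poly R} -> R) n :
  (forall q r, D (q + r) = D q + D r) -> (forall c q, D (c *: q) = c * D q) ->
  (forall l, (l < n)%N -> D (p l) = 0) ->
  forall q : {poly R}, (size q <= n)%N -> D q = 0.
Proof.
move=> DD DZ Dp q; move: {2}(size q) (leqnn (size q)) => m.
elim: m q => [|m IH] q qm qn.
  by move: qm; rewrite leqn0 size_poly_eq0 => /eqP ->; rewrite -(scale0r 0) DZ mul0r.
have [/IH->//|mq] := leqP (size q) m.
have sq : size q = m.+1 by apply/eqP; rewrite eqn_leq qm mq.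
have mn : (m < n)%N by rewrite -sq.
have [r rm ->] := op_reduce p_on sq.
by rewrite DD DZ Dp// mulr0 add0r IH// (leq_trans rm)// ltnW.
Qed.

(** Gauss quadrature at the roots of [p n]. The weights solve a linear system with
    matrix [V], invertible because a nonzero combination of [p 0, ..., p n.-1] has
    fewer than [n] roots; division by [p n] extends exactness to degree [2 n - 1].
    Applied to [p l * p k], exactness says that [V] diag [lam] is inverse to the
    transpose of [V]; on the other side this identifies the weights as Christoffel
    numbers, which are positive. *)
Lemma gauss_quadrature n (x : 'I_n -> R) : injective x ->
  (forall j, root (p n) (x j)) ->
  exists lam : 'I_n -> R,
    [/\ (forall q : {poly R}, (size q <= n.*2)%N -> I q = \sum_j lam j * q.[x j]),
        (forall j, 0 <= lam j) &
        forall j, lam j * \sum_(l < n) (p l).[x j] ^+ 2 = 1].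
Proof.
move=> xi xr; pose V : 'M[R]_n := \matrix_(l, j) (p l).[x j].
have Vu : V \in unitmx.
  rewrite unitmxE unitfE; apply/negP => /det0P[v v0 vV].
  pose q := \sum_(l < n) v 0 l *: p l.
  have q0 : q = 0.
    apply/eqP; apply: contraT => q0.
    have /max_poly_roots : q != 0 := q0.
    move=> /(_ [seq x j | j <- enum 'I_n]); rewrite size_map size_enum_ord => mpr.
    have : (n < size q)%N.
      apply: mpr; last by rewrite map_inj_uniq ?enum_uniq.
      apply/allP => _ /mapP[j _ ->]; rewrite rootE horner_sum; apply/eqP.
      have h := congr1 (fun A : 'rV_n => A 0 j) vV; rewrite !mxE in h; rewrite -[RHS]h.
      by apply: eq_bigr => l _; rewrite hornerZ !mxE.
    rewrite ltnNge; suff -> : (size q <= n)%N by [].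
    rewrite (leq_trans (size_sum _ _ _))//; apply/bigmax_leqP => l _.
    by rewrite (leq_trans (size_scale_leq _ _))// (size_op p_on).
  move/negP: v0; apply; apply/eqP/rowP => l; rewrite !mxE.
  have : I (q * p l) = 0 by rewrite q0 mul0r (poly_int0 mu_adm).
  rewrite mulr_suml (poly_int_sum mu_adm) (bigD1 l)//= big1 ?addr0.
    by rewrite -scalerAl (poly_intZ mu_adm) (poly_int_op p_on) eqxx mulr1.
  move=> k kl; rewrite -scalerAl (poly_intZ mu_adm) (poly_int_op p_on).
  by rewrite (_ : (k == l :> nat) = false) ?mulr0//; apply/negbTE.
pose lam : 'rV[R]_n := (\row_l I (p l)) *m invmx V^T.
have lamV : lam *m V^T = \row_l I (p l) by rewrite mulmxKV// unitmx_tr.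
pose D q := I q - \sum_j lam 0 j * q.[x j].
have DD q r : D (q + r) = D q + D r.
  rewrite /D (poly_intD mu_adm).
  have -> : \sum_j lam 0 j * (q + r).[x j] =
      \sum_j lam 0 j * q.[x j] + \sum_j lam 0 j * r.[x j].
    by rewrite -big_split/=; apply: eq_bigr => j _; rewrite hornerD mulrDr.
  by rewrite opprD addrACA.
have DZ c q : D (c *: q) = c * D q.
  rewrite /D (poly_intZ mu_adm) mulrBr mulr_sumr; congr (_ - _).
  by apply: eq_bigr => j _; rewrite hornerZ mulrCA.
have Dp l : (l < n)%N -> D (p l) = 0.
  move=> ln; have := congr1 (fun A : 'rV_n => A 0 (Ordinal ln)) lamV.
  rewrite !mxE /= /D => <-; apply/eqP; rewrite subr_eq0; apply/eqP.
  by apply: eq_bigr => j _; rewrite !mxE.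
have small := op_functional_eq0 DD DZ Dp.
have quad (q : {poly R}) : (size q <= n.*2)%N -> I q = \sum_j lam 0 j * q.[x j].
  move=> qn; rewrite {1}(divp_eq q (p n)) (poly_intD mu_adm).
  rewrite (op_orthogonal mu_adm p_on) ?add0r; last first.
    by rewrite size_divp ?op_neq0// (size_op p_on)/= leq_subLR addnn.
  have sm : (size (q %% p n)%R <= n)%N.
    by have := ltn_modp q (p n); rewrite op_neq0 (size_op p_on) ltnS.
  have /eqP := small _ sm; rewrite /D subr_eq0 => /eqP ->.
  apply: eq_bigr => j _; rewrite [in RHS](divp_eq q (p n)) hornerD hornerM.
  by rewrite (rootP (xr j)) mulr0 add0r.
pose VL : 'M[R]_n := \matrix_(l, j) (lam 0 j * V l j).
have VV : VL *m V^T = 1%:M.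
  apply/matrixP => l k; rewrite !mxE.
  have := quad (p l * p k).
  rewrite (poly_int_op p_on) (_ : (l == k)%:R = (l == k :> nat)%:R)// => ->.
    by apply: eq_bigr => j _; rewrite !mxE hornerM mulrA.
  rewrite (leq_trans (size_polyMleq _ _))// !(size_op p_on) addSn/=.
  by rewrite -addnn leq_add// ltnW.
have K1 j : lam 0 j * \sum_(l < n) (p l).[x j] ^+ 2 = 1.
  have := congr1 (fun A : 'M[R]_n => A j j) (mulmx1C VV) => h.
  rewrite !mxE eqxx in h; rewrite -[RHS]/(1 *+ true) -h.
  by rewrite mulr_sumr; apply: eq_bigr => l _; rewrite !mxE expr2 mulrCA.
exists (fun j => lam 0 j); split => // j.
rewrite leNgt; apply/negP => l0; have := K1 j; apply/eqP; rewrite lt_eqF//.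
by rewrite (le_lt_trans _ ltr01)// mulr_le0_ge0 ?(ltW l0)// sumr_ge0// => l _; exact: sqr_ge0.
Qed.

(** The power sums of the roots of [p n] are the traces of the powers of the
    truncated Jacobi matrix, which differ from the partial traces of the infinite
    matrix only in the last [m] diagonal entries. *)
Lemma power_sum_roots n m (s : seq R) : uniq s -> size s = n ->
  (forall x, root (p n) x = (x \in s)) ->
  `|\sum_(y <- s) y ^+ m - \sum_(l < n) jacobi_entry mu p m l l| <=
    m%:R * (2 * (3 * M) ^+ m).
Proof.
move=> us sn rs; pose x (j : 'I_n) := s`_j.
have xs j : x j \in s by rewrite mem_nth// sn.
have xi : injective x.
  by move=> i j /eqP; rewrite nth_uniq ?sn// => /eqP/val_inj.
have xr j : root (p n) (x j) by rewrite rs.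
have [lam [quad lam0 K1]] := gauss_quadrature xi xr.
have M0 : 0 <= M by exact: le_trans (normr_ge0 _) (aM 0).
pose G l := \sum_j lam j * ((x j) ^+ m * (p l).[x j] ^+ 2).
have -> : \sum_(y <- s) y ^+ m = \sum_(l < n) G l.
  rewrite exchange_big/= (big_nth 0) sn big_mkord; apply: eq_bigr => j _.
  rewrite -[LHS]mulr1 -(K1 j) mulrCA mulr_sumr mulr_sumr.
  by apply: eq_bigr => l _.
have lamK l : (l < n)%N -> \sum_j lam j * (p l).[x j] ^+ 2 = 1.
  move=> ln; have sz : (size (p l * p l)%R <= n.*2)%N.
    rewrite (leq_trans (size_polyMleq _ _))// !(size_op p_on) addSn/=.
    by rewrite -addnn leq_add// ltnW.
  have := quad _ sz; rewrite (poly_int_op p_on) eqxx => h; rewrite -[RHS]/(true%:R) h.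
  by apply: eq_bigr => j _; rewrite hornerM expr2.
have GB l : (l < n)%N -> `|G l| <= (3 * M) ^+ m.
  move=> ln; apply: (le_trans (ler_norm_sum _ _ _)).
  rewrite -[leRHS]mulr1 -[X in _ * X](lamK l ln) mulr_sumr; apply: ler_sum => j _.
  have lp0 : 0 <= lam j * (p l).[x j] ^+ 2 by rewrite mulr_ge0 ?sqr_ge0.
  rewrite mulrCA normrM (ger0_norm lp0) ler_wpM2r// normrX lerXn2r ?nnegrE ?mulr_ge0//.
  exact: op_root_le (xr j).
have GE l : (l < n - m)%N -> G l = jacobi_entry mu p m l l.
  move=> ln; rewrite /jacobi_entry quad.
    by apply: eq_bigr => j _; rewrite !hornerM hornerXn expr2 !mulrA.
  rewrite (leq_trans (size_polyMleq _ _))// (size_op p_on).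
  have : (size (('X^m : {poly R}) * p l)%R <= m + l.+1)%N.
    by rewrite (leq_trans (size_polyMleq _ _))// size_polyXn (size_op p_on) addSn.
  by move: ln; lia.
rewrite -sumrB; apply: (le_trans (ler_norm_sum _ _ _)).
rewrite (bigID (fun l : 'I_n => (n - m <= l)%N))/=.
rewrite [X in _ + X]big1 ?addr0; last first.
  by move=> l; rewrite -ltnNge => /GE ->; rewrite subrr normr0.
apply: (@le_trans _ _ (\sum_(l < n | (n - m <= l)%N) (2 * (3 * M) ^+ m))).
  apply: ler_sum => l _; apply: (le_trans (ler_normB _ _)).
  by rewrite mulr2n mulrDl mul1r lerD ?GB// (jacobi_entry_le mu_adm p_on ab_rec aM bM).
rewrite -(big_geq_mkord _ _ xpredT (fun=> 2 * (3 * M) ^+ m)) sumr_const_nat -[leLHS]mulr_natl.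
rewrite ler_wpM2r ?mulr_ge0 ?exprn_ge0 ?mulr_ge0// ler_nat; lia.
Qed.

End OrthogonalPolynomialRoots.

(** * From polynomials to continuous functions *)

Section PolynomialApproximation.
Context {R : realType}.

(** The Bernstein polynomial with nodes [f 0, ..., f n], that is, the expectation
    of [f] under the binomial law with parameters [n] and [X]. *)
Fixpoint bernstein (n : nat) (f : nat -> R) : {poly R} :=
  if n is n'.+1 then
    'X * bernstein n' (fun k => f k.+1) + (1 - 'X) * bernstein n' f
  else (f 0%N)%:P.

(** The binomial law has mean [n t] and variance [n t (1 - t)]. The centre [c] is
    arbitrary because the induction moves it. *)
Lemma bernstein_dist_le n (f : nat -> R) (w u v c t : R) : 0 <= t <= 1 ->
  (forall k, (k <= n)%N -> `|f k - w| <= u + v * (k%:R - c) ^+ 2) ->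
  `|(bernstein n f).[t] - w| <=
    u + v * ((n%:R * t - c) ^+ 2 + n%:R * t * (1 - t)).
Proof.
move=> /andP[t0 t1]; have t'0 : 0 <= 1 - t by rewrite subr_ge0.
elim: n f c => [|n IH] f c h.
  have := h 0%N isT; rewrite /= hornerC !mul0r addr0.
  exact.
have h1 : forall k, (k <= n)%N -> `|f k.+1 - w| <= u + v * (k%:R - (c - 1)) ^+ 2.
  by move=> k kn; have := h k.+1 kn; rewrite -natr1 opprB addrA addrAC.
have h2 : forall k, (k <= n)%N -> `|f k - w| <= u + v * (k%:R - c) ^+ 2.
  by move=> k kn; apply: h; exact: leqW.
have := IH _ _ h1; have := IH _ _ h2.
rewrite [bernstein n.+1 f]/= hornerD !hornerM hornerD hornerN hornerX hornerC.
move: (bernstein n f).[t] (bernstein n (fun k => f k.+1)).[t] => q r hq hr.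
have -> : t * r + (1 - t) * q - w = t * (r - w) + (1 - t) * (q - w) by ring.
apply: (le_trans (ler_normD _ _)); rewrite !normrM (ger0_norm t0) (ger0_norm t'0).
apply: le_trans (lerD (ler_wpM2l t0 hr) (ler_wpM2l t'0 hq)) _.
rewrite -natr1 le_eqVlt; apply/orP; left; apply/eqP; ring.
Qed.

(** A uniformly continuous function is approximated on [`[- L, L]] by the
    Bernstein polynomials of [t |-> F (- L + 2 L t)]. *)
Lemma bernstein_approximation (F : R -> R) (L B : R) : 0 < L ->
  (forall x, `|F x| <= B) ->
  (forall e : R, 0 < e -> exists2 d : R, 0 < d & forall s t : R, `|s - t| < d -> `|F s - F t| <= e) ->
  forall e : R, 0 < e -> exists q : {poly R}, forall x : R, - L <= x <= L -> `|q.[x] - F x| <= e.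
Proof.
move=> L0 FB Fu e e0; have e20 : 0 < e / 2 by rewrite divr_gt0.
have [d d0 dF] := Fu _ e20.
have B0 : 0 <= B by exact: le_trans (normr_ge0 _) (FB 0).
pose d' := d / (2 * L); have d'0 : 0 < d' by rewrite divr_gt0 ?mulr_gt0.
(* Large enough for the variance term of [bernstein_dist_le] to be at most [e / 2]. *)
pose N := (Num.truncn (4 * B / (d' ^+ 2 * e))).+1.
have N0 : 0 < N%:R :> R by rewrite ltr0n.
pose f k := F (- L + 2 * L * (k%:R / N%:R)).
pose q := bernstein N f \Po ((2 * L)^-1 *: ('X + L%:P)).
exists q => x xL; pose t := (2 * L)^-1 * (x + L).
have L2 : 0 < 2 * L by rewrite mulr_gt0.
have xE : x = - L + 2 * L * t by rewrite /t mulrA divff ?gt_eqF// mul1r; ring.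
have t01 : 0 <= t <= 1.
  move: xL => /andP[x1 x2]; rewrite /t mulr_ge0 ?invr_ge0 ?(ltW L2)//=; last by lra.
  by rewrite mulrC ler_pdivrMr// mul1r; lra.
have qx : q.[x] = (bernstein N f).[t].
  rewrite /q horner_comp; congr (_.[_]).
  by rewrite hornerZ hornerD hornerX hornerC.
pose v := 2 * B / (d' ^+ 2 * N%:R ^+ 2).
have h k : (k <= N)%N -> `|f k - F x| <= e / 2 + v * (k%:R - N%:R * t) ^+ 2.
  move=> kN; pose y := k%:R / N%:R - t.
  have yE : (k%:R - N%:R * t) ^+ 2 = N%:R ^+ 2 * y ^+ 2.
    by rewrite /y; field; rewrite gt_eqF.
  have vy : v * (k%:R - N%:R * t) ^+ 2 = 2 * B * (y / d') ^+ 2.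
    rewrite yE /v; have n1 := gt_eqF N0; have n2 := gt_eqF d'0.
    by field; rewrite n1 n2.
  rewrite vy; have [yd|dy] := ltP `|y| d'.
    rewrite -[leLHS]addr0 lerD//; last by rewrite mulr_ge0 ?sqr_ge0 ?mulr_ge0.
    apply: dF; rewrite xE.
    have -> : - L + 2 * L * (k%:R / N%:R) - (- L + 2 * L * t) = 2 * L * y by rewrite /y; ring.
    by rewrite normrM (gtr0_norm L2) mulrC -ltr_pdivlMr.
  apply: (@le_trans _ _ (2 * B)).
    apply: (le_trans (ler_normB _ _)); have -> : 2 * B = B + B by ring.
    exact: lerD (FB _) (FB _).
  rewrite -[leLHS]add0r lerD ?(ltW e20)// -[leLHS]mulr1 ler_wpM2l ?mulr_ge0//.
  rewrite -(real_normK (num_real _)) exprn_ege1// normrM normfV (gtr0_norm d'0).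
  by rewrite ler_pdivlMr// mul1r.
have := bernstein_dist_le t01 h; rewrite -qx => /le_trans; apply.
rewrite subrr expr0n/= add0r.
have v0 : 0 <= v.
  by apply: divr_ge0; [exact: mulr_ge0 | apply: mulr_ge0; exact: sqr_ge0].
have tt : N%:R * t * (1 - t) <= N%:R.
  rewrite -mulrA ler_piMr ?(ltW N0)//; move: t01 => /andP[t0 t1]; nra.
have : v * (N%:R * t * (1 - t)) <= e / 2.
  apply: (le_trans (ler_wpM2l v0 tt)).
  have -> : v * N%:R = 2 * B / d' ^+ 2 / N%:R.
    by rewrite /v; have n1 := gt_eqF N0; have n2 := gt_eqF d'0; field; rewrite n1 n2.
  rewrite ler_pdivrMr//.
  have hN : 4 * B / (d' ^+ 2 * e) <= N%:R by exact: ltW (truncnS_gt _).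
  have d2 : 0 < d' ^+ 2 by exact: exprn_gt0.
  rewrite (ler_pdivrMr _ _ (mulr_gt0 d2 e0)) in hN.
  rewrite (ler_pdivrMr _ _ d2); lra.
lra.
Qed.

(** Heine's theorem, by extracting convergent subsequences from counterexamples. *)
Lemma within_continuous_unif (f : R -> R) : {within `[-1, 1], continuous f} ->
  forall e : R, 0 < e -> exists2 d : R, 0 < d & forall s t : R, -1 <= s <= 1 -> -1 <= t <= 1 ->
    `|s - t| < d -> `|f s - f t| <= e.
Proof.
move=> cf e e0; apply: contrapT => nd.
have bad n : exists st : R * R, [/\ -1 <= st.1 <= 1, -1 <= st.2 <= 1,
    `|st.1 - st.2| < harmonic n & e < `|f st.1 - f st.2|].
  apply: contrapT => nst; apply: nd; exists (harmonic n); first by rewrite invr_gt0.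
  move=> s t s1 t1 st; rewrite leNgt; apply/negP => h; apply: nst.
  by exists (s, t).
have [st hst] := choice bad.
have bs : bounded_fun (fun n => (st n).1).
  exists 1; split => // M M1 n _ /=; have [h _ _ _] := hst n.
  by rewrite (le_trans _ (ltW M1))// ler_norml.
(* The points [s] and [t] have the same limit [l], where [f] is continuous. *)
have [phi iphi /cvg_ex[l cl]] := bolzano_weierstrass bs.
have cs : (st (phi n)).1 @[n --> \oo] --> l by exact: cl.
have phin n : (n <= phi n)%N.
  elim: n => // n IH; rewrite (leq_ltn_trans IH)//.
  by have := iphi n.+1 n; rewrite ltnn leEnat => /negbT; rewrite -ltnNge.
have ct : (st (phi n)).2 @[n --> \oo] --> l.
  have cd : ((st (phi n)).1 - (st (phi n)).2) @[n --> \oo] --> 0.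
    have ch := @cvg_harmonic R; have chN := cvgnZ (-1) ch; rewrite mulr0 in chN.
    apply: (squeezen _ chN ch) => n.
    have [_ _ h _] := hst (phi n).
    have h' : `|(st (phi n)).1 - (st (phi n)).2| <= harmonic n.
      rewrite (le_trans (ltW h))// lef_pV2 ?posrE// ler_nat ltnS; exact: phin.
    by rewrite mulN1r -ler_norml.
  by have := cvgnB cs cd; rewrite subr0; apply: cvgn_ext => n; rewrite opprB subrKC.
have l1 : -1 <= l <= 1.
  apply/andP; split.
    by apply: (cvgn_ge cs) => n; have [/andP[]] := hst (phi n).
  by apply: (cvgn_le cs) => n; have [/andP[]] := hst (phi n).
have /subspace_continuousP/(_ l) := cf.
rewrite /= in_itv/= => /(_ l1) /cvgrPdist_lt/(_ (e / 2)).
rewrite divr_gt0// => /(_ isT); rewrite near_withinE => -[d /= d0 hd].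
have [n [ns nt]] : exists n, `|l - (st (phi n)).1| < d /\ `|l - (st (phi n)).2| < d.
  have /cvgrPdist_lt/(_ d d0) h1 := cs; have /cvgrPdist_lt/(_ d d0) h2 := ct.
  by have [n _ /(_ n (leqnn n))] := filterI h1 h2; exists n.
have [s1 t1 _ h] := hst (phi n).
have fs : `|f l - f (st (phi n)).1| < e / 2 by apply: hd => //=; rewrite in_itv.
have ft : `|f l - f (st (phi n)).2| < e / 2 by apply: hd => //=; rewrite in_itv.
have : `|f (st (phi n)).1 - f (st (phi n)).2| < e.
  have -> : f (st (phi n)).1 - f (st (phi n)).2 =
    (f l - f (st (phi n)).2) - (f l - f (st (phi n)).1) by ring.
  by rewrite (le_lt_trans (ler_normB _ _))// [e]splitr ltrD.
by rewrite ltNge (ltW h).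
Qed.

(** The retraction of the line onto [`[-1, 1]], through which functions on the
    segment are extended continuously. *)
Definition clamp (x : R) : R := Num.max (-1) (Num.min 1 x).

Lemma clamp_id x : -1 <= x <= 1 -> clamp x = x.
Proof. by move=> /andP[x0 x1]; rewrite /clamp (min_idPr x1) (max_idPr x0). Qed.

Lemma clamp_le x : x <= -1 -> clamp x = -1.
Proof. by move=> x1; rewrite /clamp min_r ?max_l//; lra. Qed.

Lemma clamp_ge x : 1 <= x -> clamp x = 1.
Proof. by move=> x1; rewrite /clamp min_l// max_r//; lra. Qed.

Lemma clamp_in x : -1 <= clamp x <= 1.
Proof.
have [x1|x1] := leP x (-1); first by rewrite (clamp_le x1); lra.
have [x2|x2] := leP 1 x; first by rewrite (clamp_ge x2); lra.
by rewrite clamp_id; lra.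
Qed.

Lemma clamp_lipschitz x y : `|clamp x - clamp y| <= `|x - y|.
Proof.
wlog xy : x y / x <= y.
  by move=> wl; have [/wl//|/ltW/wl] := leP x y; rewrite distrC [leRHS]distrC.
rewrite [leRHS]ler0_norm ?subr_le0// opprB ler_norml.
have [x1|x1] := leP x (-1); [rewrite (clamp_le x1)|have [x2|x2] := leP 1 x; [rewrite (clamp_ge x2)|rewrite (@clamp_id x); last by lra]];
(have [y1|y1] := leP y (-1); [rewrite (clamp_le y1)|have [y2|y2] := leP 1 y; [rewrite (clamp_ge y2)|rewrite (@clamp_id y); last by lra]]); lra.
Qed.

Lemma within_continuous_approximation (f : R -> R) (L : R) :
  {within `[-1, 1], continuous f} -> 0 < L ->
  forall e : R, 0 < e -> exists q : {poly R}, forall x : R, - L <= x <= L ->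
    `|q.[x] - f (clamp x)| <= e.
Proof.
move=> cf L0.
have [B fB] : exists B : R, forall x : R, -1 <= x <= 1 -> `|f x| <= B.
  have cpt := @segment_compact R (-1) 1; have := continuous_compact cf cpt.
  move=> /compact_bounded[B [_ hB]]; exists (B + 1) => x x1.
  by apply: (hB (B + 1)); rewrite ?ltrDl//; exists x => //=; rewrite in_itv.
apply: (@bernstein_approximation _ L B L0) => [x|e e0]; first exact/fB/clamp_in.
have [d d0 dP] := within_continuous_unif cf e0; exists d => // s t st.
apply: dP; rewrite ?clamp_in//; exact: le_lt_trans (clamp_lipschitz _ _) st.
Qed.

End PolynomialApproximation.

Section Sandwich.
Context {R : realType}.
Variable alpha : R.
Hypothesis alpha_gt0 : 0 < alpha.
Notation leb := (@lebesgue_measure R).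
Notation E := (equilibrium_poly alpha).

Lemma equilibrium_moment_small (e : R) : 0 < e -> exists N, equilibrium_moment alpha N.*2 <= e.
Proof.
move=> e0; exists (Num.truncn (e ^+ 2)^-1); set N := Num.truncn _.
have := equilibrium_moment_sqr_le alpha_gt0 N; set m := equilibrium_moment _ _ => mN.
rewrite leNgt; apply/negP => em.
have h : (e ^+ 2)^-1 < N.*2.+1%:R.
  apply: (lt_le_trans (truncnS_gt _)); rewrite ler_nat ltnS -/N; lia.
have e2 : 0 < e ^+ 2 by rewrite exprn_gt0.
have : 1 < e ^+ 2 * N.*2.+1%:R by rewrite -ltr_pdivrMl// mulr1.
apply/negP; rewrite -leNgt; apply: le_trans mN; rewrite ler_wpM2r//.
by rewrite lerXn2r ?nnegrE ?(ltW e0)// ?(ltW em) ?equilibrium_moment_ge0.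
Qed.

(** The correction [2 B x ^ (2 N)] dominates [h] outside [`[-1, 1]], while its
    equilibrium integral is as small as desired. *)
Lemma polynomial_sandwich (f h : R -> R) (L B : R) :
  {within `[-1, 1], continuous f} -> {in `[-1, 1], h =1 f} -> 1 <= L ->
  (forall x : R, - L <= x <= L -> `|h x| <= B) ->
  forall e : R, 0 < e -> exists q1 q2 : {poly R},
    (forall x : R, - L <= x <= L -> q1.[x] <= h x <= q2.[x]) /\ E q2 - E q1 <= e.
Proof.
move=> cf hf L1 hB e e0; have L0 : 0 < L := lt_le_trans ltr01 L1.
have B0 : 0 <= B by apply: le_trans (hB 0 _); rewrite // oppr_le0 ltW.
have d0 : 0 < e / 4 by rewrite divr_gt0.
have [P HP] := within_continuous_approximation cf L0 d0.
have B1 : 0 < 4 * B + 1 by rewrite ltr_wpDl// mulr_ge0.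
have [N HN] := @equilibrium_moment_small (e / 2 / (4 * B + 1)) (divr_gt0 (divr_gt0 e0 (ltr0Sn _ _)) B1).
pose T : {poly R} := (2 * B) *: 'X^(N.*2) + (e / 4) *: 'X^0.
have TE x : T.[x] = 2 * B * x ^+ N.*2 + e / 4.
  by rewrite /T hornerD !hornerZ !hornerXn expr0 mulr1.
exists (P + (-1) *: T), (P + T); split => [x xL|]; last first.
  have ET : E T = 2 * B * equilibrium_moment alpha N.*2 + e / 4.
    rewrite /T (equilibrium_polyD alpha_gt0) !(equilibrium_polyZ alpha_gt0) !equilibrium_polyXn.
    by rewrite equilibrium_moment0// mulr1.
  rewrite (equilibrium_polyD alpha_gt0 P T) (equilibrium_polyD alpha_gt0 P (-1 *: T)).
  rewrite (equilibrium_polyZ alpha_gt0 (-1) T) ET.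
  move: HN; set mN := equilibrium_moment _ _ => HN.
  have mN0 : 0 <= mN by rewrite equilibrium_moment_ge0.
  have : mN * (4 * B + 1) <= e / 2 by rewrite -ler_pdivlMr.
  rewrite mulrDr mulr1 => hm.
  have -> : E P + (2 * B * mN + e / 4) - (E P + -1 * (2 * B * mN + e / 4)) = mN * (4 * B) + e / 2 by field.
  lra.
have := HP x xL; rewrite ler_norml => /andP[p1 p2].
have := hB x xL; rewrite ler_norml => /andP[h1 h2].
have x20 : 0 <= x ^+ N.*2 by rewrite -mul2n exprM exprn_ge0// sqr_ge0.
rewrite (hornerD P T) (hornerD P (-1 *: T)) (hornerZ (-1) T) TE.
have [x1|x1] := boolP (-1 <= x <= 1).
  have := clamp_id x1 => cx; rewrite cx in p1 p2.
  have hx : h x = f x by apply: hf; rewrite in_itv.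
  by rewrite hx; apply/andP; split; nra.
have Bf : `|f (clamp x)| <= B.
  have ci := clamp_in x; rewrite -hf ?in_itv//; apply: hB.
  by move: ci => /andP[c1 c2]; apply/andP; split; lra.
move: Bf; rewrite ler_norml => /andP[f1 f2].
have x2 : 1 <= x ^+ N.*2.
  rewrite -mul2n exprM exprn_ege1// -(real_normK (num_real x)) exprn_ege1//.
  by move: x1; rewrite -ler_norml -ltNge => /ltW.
have BB : B <= B * x ^+ N.*2 by rewrite ler_peMr.
by apply/andP; split; lra.
Qed.

Lemma equilibrium_le (h1 h2 : R -> R) (B1 B2 : R) :
  measurable_fun (`]-1, 1[%classic : set (measurableTypeR R)) h1 ->
  measurable_fun (`]-1, 1[%classic : set (measurableTypeR R)) h2 ->
  (forall x : R, -1 < x < 1 -> `|h1 x| <= B1) ->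
  (forall x : R, -1 < x < 1 -> `|h2 x| <= B2) ->
  (forall x : R, -1 < x < 1 -> h1 x <= h2 x) ->
  (wmoment alpha 0)^-1 * \int[leb]_(x in `]-1, 1[) (h1 x * equilibrium_weight alpha x) <=
  (wmoment alpha 0)^-1 * \int[leb]_(x in `]-1, 1[) (h2 x * equilibrium_weight alpha x).
Proof.
move=> m1 m2 b1 b2 h12; rewrite ler_wpM2l ?invr_ge0 ?(ltW (wmoment0_gt0 alpha_gt0))//.
have mD : measurable (`]-1, 1[%classic : set (measurableTypeR R)) by exact: measurable_itv.
have i1 := equilibrium_integrable alpha_gt0 m1 b1.
have i2 := equilibrium_integrable alpha_gt0 m2 b2.
apply: (le_Rintegral mD i1 i2) => x; rewrite /= in_itv/= => x1.
by rewrite ler_wpM2r ?powR_ge0// h12.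
Qed.

(** Passage from polynomials to functions. [F n q] stands for a mean of integrals
    of [q] or of sums of [q] over roots, and [u n] for the same mean of [h]: such
    means are monotone, and see [h] on [`[- L, L]] only. *)
Lemma equilibrium_squeeze (f h : R -> R) (L B : R)
    (F : nat -> {poly R} -> R) (u : R^nat) :
  {within `[-1, 1], continuous f} -> {in `[-1, 1], h =1 f} -> 1 <= L ->
  (forall x : R, - L <= x <= L -> `|h x| <= B) ->
  (forall q, F n q @[n --> \oo] --> E q) ->
  (forall q1 q2 n, (forall x : R, - L <= x <= L -> q1.[x] <= h x <= q2.[x]) ->
     F n q1 <= u n <= F n q2) ->
  u n @[n --> \oo] --> (wmoment alpha 0)^-1 *
    \int[leb]_(x in `]-1, 1[) (f x * equilibrium_weight alpha x).
Proof.
move=> cf hf L1 hB FE Fu.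
pose v : R := (wmoment alpha 0)^-1 *
    \int[leb]_(x in `]-1, 1[) (f x * equilibrium_weight alpha x).
rewrite -/v.
apply/cvgrPdist_le => e e0; have e20 : 0 < e / 2 by rewrite divr_gt0.
have [q1 [q2 [q12 Eq]]] := polynomial_sandwich cf hf L1 hB e20.
have mf : measurable_fun (`]-1, 1[%classic : set (measurableTypeR R)) f.
  have m1 : measurable (`[-1, 1]%classic : set (measurableTypeR R)) by exact: measurable_itv.
  have mf1 : measurable_fun (`[-1, 1]%classic : set (measurableTypeR R)) f.
    exact: subspace_continuous_measurable_fun.
  apply: (measurable_funS m1 _ mf1) => x; rewrite /= !in_itv/= => /andP[x1 x2].
  by rewrite !ltW.
have xL (x : R) : -1 < x < 1 -> - L <= x <= L.
  by move=> /andP[x1 x2]; apply/andP; split; lra.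
have hx (x : R) : -1 < x < 1 -> h x = f x.
  by move=> /andP[x1 x2]; apply: hf; rewrite in_itv/= !ltW.
have fB (x : R) : -1 < x < 1 -> `|f x| <= B by move=> x1; rewrite -hx// hB// xL.
have mq (q : {poly R}) : measurable_fun (`]-1, 1[%classic : set (measurableTypeR R)) (fun x => q.[x]).
  by apply: measurable_funTS; exact: measurable_horner.
have bq (q : {poly R}) : exists B' : R, forall x : R, -1 < x < 1 -> `|q.[x]| <= B'.
  have [B' hB'] := horner_bounded q (-1) 1; exists B' => x /andP[x1 x2].
  by apply: hB'; rewrite !ltW.
have [B1 hB1] := bq q1; have [B2 hB2] := bq q2.
have v1 : E q1 <= v.
  apply: (equilibrium_le (mq q1) mf hB1 fB) => x x1.
  by rewrite -hx//; have /andP[] := q12 x (xL x x1).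
have v2 : v <= E q2.
  apply: (equilibrium_le mf (mq q2) fB hB2) => x x1.
  by rewrite -hx//; have /andP[] := q12 x (xL x x1).
have /cvgrPdist_le/(_ _ e20) c1 := FE q1; have /cvgrPdist_le/(_ _ e20) c2 := FE q2.
near=> n.
have : `|E q1 - F n q1| <= e / 2 by near: n.
have : `|E q2 - F n q2| <= e / 2 by near: n.
rewrite !ler_norml => /andP[a1 a2] /andP[b1 b2].
by have /andP[u1 u2] := Fu _ _ n q12; apply/andP; split; lra.
Unshelve. all: by end_near. Qed.

End Sandwich.

(** * Integration against the mean and equilibrium measures *)

Section DensityMeasures.
Local Open Scope ereal_scope.
Context d (T : measurableType d) (R : realType).
Variables (m nu : {measure set T -> \bar R}) (w : T -> R).
Hypothesis mw : measurable_fun [set: T] w.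
Hypothesis w_ge0 : forall x, (0 <= w x)%R.
Hypothesis nuE : forall A, measurable A -> nu A = \int[m]_(x in A) (w x)%:E.

Import HBNNSimple.

Let integral_density_indic (A : set T) : measurable A ->
  \int[nu]_x (\1_A x)%:E = \int[m]_x (\1_A x * w x)%:E.
Proof.
move=> mA; rewrite integral_indic// setIT nuE// integral_mkcond.
apply: eq_integral => x _; rewrite patchE indicE.
by case: ifPn => xA; rewrite ?mul1r ?mul0r.
Qed.

Let integral_density_nnsfun (h : {nnsfun T >-> R}) :
  \int[nu]_x (h x)%:E = \int[m]_x (h x * w x)%:E.
Proof.
under [LHS]eq_integral do rewrite fimfunE -fsumEFin//.
rewrite [LHS]ge0_integral_fsum//; last 2 first.
  - by move=> r; exact/measurable_EFinP/measurableT_comp.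
  - by move=> n x _; rewrite EFinM nnfun_muleindic_ge0.
under [RHS]eq_integral.
  move=> x xD; rewrite fimfunE EFinM muleC -fsumEFin// ge0_mule_fsumr; last first.
    by move=> r; rewrite EFinM nnfun_muleindic_ge0.
  over.
have mi r : measurable_fun [set: T] (fun x => (r * \1_(h @^-1` [set r]) x)%R).
  exact: measurableT_comp.
rewrite [RHS]ge0_integral_fsum//; last 2 first.
  - by move=> r; apply/measurable_EFinP/measurable_funM.
  - by move=> n x _; rewrite mule_ge0 ?lee_fin// -lee_fin EFinM nnfun_muleindic_ge0.
apply: eq_fsbigr => r _; rewrite integralZl_indic_nnsfun// integral_density_indic//.
have [r0|r0] := ltP r 0%R.
  rewrite preimage_nnfun0// !integral0_eq ?mule0// => x _;
  by rewrite indic0 ?mulr0 ?mul0r ?mule0.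
rewrite -ge0_integralZl//.
- by apply: eq_integral => x _; rewrite -!EFinM; congr (_%:E); rewrite mulrA mulrC.
- by apply/measurable_EFinP/measurable_funM.
- by move=> x _; rewrite lee_fin mulr_ge0// indicE.
Qed.

Lemma ge0_integral_density (f : T -> \bar R) :
  measurable_fun [set: T] f -> (forall x, 0 <= f x) ->
  \int[nu]_x f x = \int[m]_x (f x * (w x)%:E).
Proof.
move=> mf f0; pose h := nnsfun_approx measurableT mf.
transitivity (limn (fun n => \int[nu]_x (h n x)%:E)).
  rewrite -monotone_convergence//=.
  - apply: eq_integral => x _; apply/esym/cvg_lim => //=; exact: cvg_nnsfun_approx.
  - by move=> n; exact/measurable_EFinP/measurable_funTS.
  - by move=> n x _; rewrite lee_fin.
  - by move=> x _ a b ab; rewrite lee_fin; exact/lefP/nd_nnsfun_approx.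
transitivity (limn (fun n => \int[m]_x (h n x * w x)%:E)).
  by congr (limn _); apply/funext => n; rewrite integral_density_nnsfun.
rewrite -monotone_convergence//=.
- apply: eq_integral => x _; apply/cvg_lim => //=.
  under eq_fun do rewrite EFinM.
  by apply: cvgeZr => //; exact: cvg_nnsfun_approx.
- by move=> n; apply/measurable_EFinP/measurable_funM.
- by move=> n x _; rewrite lee_fin mulr_ge0.
- by move=> x _ a b ab; rewrite lee_fin ler_wpM2r//; exact/lefP/nd_nnsfun_approx.
Qed.

(** The positive part of [f * w] is the product of that of [f] with [w]. *)
Lemma integral_density (f : T -> R) : measurable_fun [set: T] f ->
  \int[nu]_x (f x)%:E = \int[m]_x (f x * w x)%:E.
Proof.
move=> mf; have mf' : measurable_fun [set: T] (EFin \o f) by exact/measurable_EFinP.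
rewrite integralE [RHS]integralE; congr (_ - _).
- rewrite ge0_integral_density//; last exact: measurable_funepos.
  apply: eq_integral => x _; rewrite !funeposE -!EFin_max -EFinM; congr (_%:E).
  by rewrite maxr_pMl// mul0r.
- rewrite ge0_integral_density//; last exact: measurable_funeneg.
  apply: eq_integral => x _; rewrite !funenegE -!EFinN -!EFin_max -EFinM; congr (_%:E).
  by rewrite maxr_pMl// mul0r mulNr.
Qed.

End DensityMeasures.

Section MeanMeasureIntegral.
Context {R : realType}.
Variable alpha : R.
Variable mu : nat -> {finite_measure set (measurableTypeR R) -> \bar R}.
Variables (p : nat -> nat -> {poly R}) (n : nat).
Hypothesis mu_adm : forall i, exists c d : R, mu i (~` `[c, d]) = 0%E.

Lemma integrable_mul_horner i (h : measurableTypeR R -> R) (B : R) (q : {poly R}) :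
  measurable_fun [set: measurableTypeR R] h ->
  (forall x, `|h x| <= B) ->
  (mu i).-integrable [set: measurableTypeR R] (EFin \o (fun x => h x * q.[x])).
Proof.
move=> mh hB; have [L muL] := symmetric_support (mu_adm i).
have [B' hB'] := horner_bounded q (- L) L.
apply: (integrable_supported muL (measurable_funM mh (measurable_horner q))) => x xL.
by rewrite normrM; apply: ler_pM (hB x) (hB' x xL).
Qed.

Let mean_measure_ge0 (f : measurableTypeR R -> R) (B : R) :
  measurable_fun [set: measurableTypeR R] f ->
  (forall x, 0 <= f x) -> (forall x, f x <= B) ->
  (\int[mean_measure alpha mu p n]_x (f x)%:E =
  (cesaro_mean alpha (fun i k => \int[mu i]_x (f x * (p i k).[x] ^+ 2)) n)%:E)%E.
Proof.
move=> mf f0 fB; have mf' : measurable_fun [set: measurableTypeR R] (EFin \o f).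
  exact/measurable_EFinP.
rewrite ge0_integral_measure_sum//; last by move=> x _; rewrite lee_fin.
rewrite /cesaro_mean -sumEFin; apply: eq_bigr => k _.
rewrite ge0_integral_mscale//; last by move=> x _; rewrite lee_fin.
rewrite [RHS]EFinM; congr (_ * _)%E.
rewrite (@integral_density _ _ _ (mu (n - k)%N) _ (fun x => (p (n - k)%N k).[x] ^+ 2))//.
- rewrite /Rintegral fineK//.
  have i : (mu (n - k)%N).-integrable [set: measurableTypeR R]
      (EFin \o (fun x => f x * ((p (n - k)%N k) ^+ 2).[x])).
    by apply: (@integrable_mul_horner _ _ B) => // x; rewrite ger0_norm.
  have := integrable_fin_num measurableT i.
  by under eq_integral do rewrite /= horner_exp.
- by apply: measurable_funX; exact: measurable_horner.
- by move=> x; exact: sqr_ge0.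
Qed.

(** Adding the constant [B] reduces to nonnegative functions, for which integrals
    against sums of measures split without integrability conditions. *)
Lemma Rintegral_mean_measure (f : measurableTypeR R -> R) (B : R) :
  measurable_fun [set: measurableTypeR R] f -> (forall x, `|f x| <= B) ->
  \int[mean_measure alpha mu p n]_x f x =
  cesaro_mean alpha (fun i k => \int[mu i]_x (f x * (p i k).[x] ^+ 2)) n.
Proof.
move=> mf fB; have B0 : 0 <= B by exact: le_trans (normr_ge0 _) (fB 0).
have f1 x : 0 <= f x + B by have := fB x; rewrite ler_norml => /andP[]; lra.
have f2 x : f x + B <= 2 * B by have := fB x; rewrite ler_norml => /andP[]; lra.
have mB : measurable_fun [set: measurableTypeR R] (fun=> B) by exact: measurable_cst.
have mfB := measurable_funD mf mB.
have e1 := mean_measure_ge0 mfB f1 f2.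
have e2 := mean_measure_ge0 mB (fun=> B0) (fun=> lexx B).
have int (g : measurableTypeR R -> R) : measurable_fun [set: measurableTypeR R] g -> (forall x, 0 <= g x) ->
    (\int[mean_measure alpha mu p n]_x (g x)%:E < +oo)%E ->
    (mean_measure alpha mu p n).-integrable [set: measurableTypeR R] (EFin \o g).
  move=> mg g0 gi; apply/integrableP; split; first exact/measurable_EFinP.
  by under eq_integral do rewrite gee0_abs ?lee_fin//.
have i1 := int _ mfB f1; rewrite e1 ltry in i1.
have i2 := int _ mB (fun=> B0); rewrite e2 ltry in i2.
have -> : \int[mean_measure alpha mu p n]_x f x =
    \int[mean_measure alpha mu p n]_x ((f x + B) - B).
  by apply: eq_Rintegral => x _; rewrite addrK.
rewrite (RintegralB measurableT (i1 isT) (i2 isT)) {1 2}/Rintegral e1 e2/=.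
rewrite -mulN1r -cesaro_meanZ -cesaro_meanD; apply: eq_bigr => k _; congr (_ * _).
have j (h : measurableTypeR R -> R) C : measurable_fun [set: measurableTypeR R] h ->
    (forall x, `|h x| <= C) -> (mu (n - k)%N).-integrable [set: measurableTypeR R]
      (EFin \o (fun x => h x * (p (n - k)%N k).[x] ^+ 2)).
  move=> mh hC; have := @integrable_mul_horner (n - k)%N h C ((p (n - k)%N k) ^+ 2) mh hC.
  by congr (integrable _ _ _); apply/funext => x; rewrite /= horner_exp.
have j1 := j _ B mf fB; have j2 := j _ B mB (fun=> (eq_ind _ (fun y => y <= B) (lexx B) _ (esym (ger0_norm B0)))).
rewrite mulN1r; have -> : \int[mu (n - k)%N]_x ((f x + B) * (p (n - k)%N k).[x] ^+ 2) =
   \int[mu (n - k)%N]_x (f x * (p (n - k)%N k).[x] ^+ 2 + B * (p (n - k)%N k).[x] ^+ 2).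
  by apply: eq_Rintegral => x _; rewrite mulrDl.
by rewrite (RintegralD measurableT j1 j2) addrK.
Qed.

End MeanMeasureIntegral.

Section EquilibriumIntegral.
Context {R : realType}.
Variable alpha : R.
Hypothesis alpha_gt0 : 0 < alpha.
Notation leb := (@lebesgue_measure R).

Lemma Rintegral_equilibrium_segment (f : R -> R) :
  measurable_fun (`]-1, 1[%classic : set (measurableTypeR R)) f ->
  \int[leb]_(x in `[-1, 1]) (f x * equilibrium_weight alpha x) =
  \int[leb]_(x in `]-1, 1[) (f x * equilibrium_weight alpha x).
Proof.
move=> mf; rewrite /Rintegral integral_itv_bndoo//.
apply/measurable_EFinP; apply: measurable_funM => //.
have -> : equilibrium_weight alpha = moment_integrand alpha 0.
  by apply/funext => x; rewrite /moment_integrand expr0 mul1r.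
by apply: measurable_funTS; exact: measurable_moment_integrand.
Qed.

Lemma Rintegral_equilibrium_measure (f : R -> R) (B : R) :
  measurable_fun [set: measurableTypeR R] f -> (forall x, `|f x| <= B) ->
  \int[equilibrium_measure alpha]_x f x = (wmoment alpha 0)^-1 *
    \int[leb]_(x in `]-1, 1[) (f x * equilibrium_weight alpha x).
Proof.
move=> mf fB; have mD : measurable (`]-1, 1[%classic : set (measurableTypeR R)).
  exact: measurable_itv.
have mD' : measurable (`[-1, 1]%classic : set (measurableTypeR R)).
  exact: measurable_itv.
have mw : measurable_fun [set: measurableTypeR R] (equilibrium_weight alpha).
  have -> : equilibrium_weight alpha = moment_integrand alpha 0.
    by apply/funext => x; rewrite /moment_integrand expr0 mul1r.
  exact: measurable_moment_integrand.
have mi : measurable_fun [set: measurableTypeR R] (\1_(`[-1, 1]%classic) : R -> R).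
  exact: measurable_indic.
have md : measurable_fun [set: measurableTypeR R] (equilibrium_density alpha).
  by apply: measurable_funM => //; exact: measurable_funM.
have d0 x : 0 <= equilibrium_density alpha x.
  rewrite mulr_ge0 ?mulr_ge0 ?powR_ge0// ?indicE ?ler0n// invr_ge0.
  by rewrite equilibrium_massE// ltW// wmoment0_gt0.
have i := equilibrium_integrable alpha_gt0 (measurable_funTS mf) (fun x _ => fB x).
rewrite -(RintegralZl _ mD i) /Rintegral.
rewrite (@integral_density _ _ _ leb _ (equilibrium_density alpha))//.
rewrite -(@integral_itv_bndoo _ _ _ _ true false); last first.
  apply/measurable_EFinP; apply: measurable_funM => //.
  by apply: measurable_funTS; exact: measurable_funM.
congr fine; rewrite [RHS]integral_mkcond; apply: eq_integral => x _.
rewrite patchE /equilibrium_density indicE equilibrium_massE//.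
by case: ifPn => _; rewrite ?mul1r ?mul0r ?mulr0// mulrCA.
Qed.

End EquilibriumIntegral.

(** * Mean asymptotics *)

Section AveragedCesaroMeans.
Context {R : realType}.
Variable alpha : R.
Hypothesis alpha_gt0 : 0 < alpha.
Local Notation A := (cesaro_number alpha).

Let a1 : -1 < alpha - 1. Proof. by rewrite ltrBrDr addrC subrr. Qed.
Let a0 : -1 < alpha. Proof. by rewrite (lt_trans _ alpha_gt0)// oppr_lt0. Qed.
Let a2 : -1 < alpha + 1. Proof. by rewrite (lt_trans a0)// ltrDl. Qed.
Let a11 : alpha - 1 + 1 = alpha. Proof. by rewrite subrK. Qed.

Lemma cesaro_number_ge1 n : 1 <= A n.
Proof.
elim: n => [|n IH]; first by rewrite cesaro_number0.
rewrite (cesaro_numberS _ a0); apply: (le_trans IH).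
rewrite ler_peMl ?(le_trans ler01 IH)//.
have n1 : 0 < n.+1%:R :> R by rewrite ltr0n.
by rewrite (ler_pdivlMr _ _ n1) mul1r -[n.+1%:R]natr1 lerD2r lerDl ltW.
Qed.

(** The numbers of order [alpha + 1] tend to infinity, because those of order
    [alpha] are at least 1 and of smaller order of growth. *)
Lemma cesaro_weight_cvg0 (c : R) : c / cesaro_number (alpha + 1) n @[n --> \oo] --> (0 : R).
Proof.
rewrite -[X in _ --> X](mulr0 c); apply: cvgnZ.
apply: (squeezen _ (cvgn_cst 0) (cesaro_ratio_cvg a0)) => n.
have A0 := cesaro_number_gt0 n a2.
by rewrite invr_ge0 (ltW A0) ler_peMl ?(cesaro_number_ge1 n)// invr_ge0 (ltW A0).
Qed.

(** A regular summation method: by [cesaro_number_sum] the weights sum to 1, and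
    each of them tends to 0. *)
Lemma cesaro_toeplitz (x : R^nat) (l : R) : x n @[n --> \oo] --> l ->
  (\sum_(N < n.+1) A N * x N) / cesaro_number (alpha + 1) n @[n --> \oo] --> l.
Proof.
move=> xl; apply/cvgrPdist_le => e e0; have e20 : 0 < e / 2 by rewrite divr_gt0.
have /cvgrPdist_le/(_ _ e20)[N0 _ HN] := xl.
pose C := \sum_(0 <= i < N0) A i * `|l - x i|.
have /cvgrPdist_le/(_ _ e20) c0 := cesaro_weight_cvg0 C.
near=> n.
have N0n : (N0 <= n.+1)%N by apply: leqW; near: n; exact: nbhs_infty_ge.
have S0 := cesaro_number_gt0 n a2.
have Cn : C / cesaro_number (alpha + 1) n <= e / 2.
  have : `|0 - C / cesaro_number (alpha + 1) n| <= e / 2 by near: n.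
  by rewrite sub0r normrN => /(le_trans (ler_norm _)).
have sE := cesaro_number_sum n a0.
have -> : l - (\sum_(N < n.+1) A N * x N) / cesaro_number (alpha + 1) n =
    (\sum_(N < n.+1) A N * (l - x N)) / cesaro_number (alpha + 1) n.
  rewrite -[l in LHS](mulfK (lt0r_neq0 S0)) -mulrBl -sE mulr_sumr -sumrB; congr (_ / _).
  by apply: eq_bigr => N _; rewrite mulrBr mulrC.
rewrite normrM normfV (gtr0_norm S0) ler_pdivrMr//.
apply: (le_trans (ler_norm_sum _ _ _)).
rewrite ler_pdivrMr// in Cn.
rewrite -(big_mkord xpredT (fun N => `|A N * (l - x N)|)) (big_cat_nat (n := N0))//=.
have -> : \sum_(0 <= i < N0) `|A i * (l - x i)| = C.
  by apply: eq_bigr => i _; rewrite normrM (gtr0_norm (cesaro_number_gt0 i a0)).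
rewrite [e in leRHS]splitr mulrDl lerD//.
have -> : cesaro_number (alpha + 1) n = \sum_(0 <= i < N0) A i + \sum_(N0 <= i < n.+1) A i.
  by rewrite -sE -(big_mkord xpredT A) -big_cat_nat.
have A_ge0 : 0 <= \sum_(0 <= i < N0) A i.
  by apply: sumr_ge0 => i _; exact: ltW (cesaro_number_gt0 i a0).
rewrite mulrDr -[leLHS]add0r lerD//; first by rewrite mulr_ge0// ltW.
rewrite mulr_sumr big_nat [leRHS]big_nat; apply: ler_sum => i /andP[Ni _].
have Ai := cesaro_number_gt0 i a0.
by rewrite normrM (gtr0_norm Ai) mulrC ler_wpM2r ?(ltW Ai)//; exact: HN.
Unshelve. all: by end_near. Qed.

Lemma antidiagonal_sum (g : nat -> nat -> R) n :
  \sum_(k < n.+1) g (n - k)%N k = \sum_(i < n.+1) g i (n - i)%N.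
Proof.
rewrite (reindex_inj rev_ord_inj)/=; apply: eq_bigr => i _.
by rewrite subSS subKn// -ltnS.
Qed.

(** Both sides sum [c i * v i l] over [i + l <= n]. *)
Lemma triangle_sum (c : nat -> R) (v : nat -> nat -> R) n :
  \sum_(k < n.+1) c (n - k)%N * \sum_(l < k.+1) v (n - k)%N l =
  \sum_(N < n.+1) \sum_(k < N.+1) c (N - k)%N * v (N - k)%N k.
Proof.
rewrite (antidiagonal_sum (fun i k => c i * \sum_(l < k.+1) v i l)).
under [RHS]eq_bigr do rewrite (antidiagonal_sum (fun i k => c i * v i k)).
elim: n => [|n IH]; first by rewrite !big_ord1.
rewrite [LHS]big_ord_recr/= [RHS]big_ord_recr/= -IH.
rewrite [X in _ = _ + X]big_ord_recr/= !subnn big_ord1 addrA; congr (_ + _).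
rewrite -big_split/=; apply: eq_bigr => i _.
have ni : (i <= n)%N by rewrite -ltnS.
by rewrite (subSn ni) [in LHS]big_ord_recr mulrDr.
Qed.

Lemma cesaro_mean_partial_sums (v : nat -> nat -> R) n :
  \sum_(k < n.+1) cesaro_number (alpha - 1) (n - k) * \sum_(l < k.+1) v (n - k)%N l =
  \sum_(N < n.+1) A N * cesaro_mean alpha v N.
Proof.
rewrite triangle_sum; apply: eq_bigr => N _; rewrite /cesaro_mean mulr_sumr.
apply: eq_bigr => k _; rewrite cesaroE.
have := gt_eqF (cesaro_number_gt0 N a0); move: (cesaro_number alpha N) => B B0.
by field; rewrite B0.
Qed.

Lemma averaged_partial_sums_cvg (v : nat -> nat -> R) (l : R) :
  cesaro_mean alpha v n @[n --> \oo] --> l ->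
  (\sum_(k < n.+1) cesaro_number (alpha - 1) (n - k) / cesaro_number (alpha + 1) n *
     \sum_(j < k.+1) v (n - k)%N j) @[n --> \oo] --> l.
Proof.
move=> vl; apply: (cvgn_ext _ (cesaro_toeplitz vl)) => n.
rewrite -cesaro_mean_partial_sums mulr_suml.
by apply: eq_bigr => k _; rewrite mulrAC.
Qed.

(** A bounded perturbation of the partial sums is negligible, as the weights
    sum up to [A_n / S_n], which tends to 0; here
    [A_n] and [S_n] are the Cesaro numbers of orders [alpha] and [alpha + 1]. *)
Lemma averaged_perturbation (u v : nat -> nat -> R) (C l : R) :
  (forall i k, `|u i k - v i k| <= C) ->
  (\sum_(k < n.+1) cesaro_number (alpha - 1) (n - k) / cesaro_number (alpha + 1) n *
     v (n - k)%N k) @[n --> \oo] --> l ->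
  (\sum_(k < n.+1) cesaro_number (alpha - 1) (n - k) / cesaro_number (alpha + 1) n *
     u (n - k)%N k) @[n --> \oo] --> l.
Proof.
move=> uv vl; pose w n k := cesaro_number (alpha - 1) (n - k) / cesaro_number (alpha + 1) n.
have w0 n k : 0 <= w n k by rewrite ltW// divr_gt0 ?cesaro_number_gt0.
have h := cvgnZ C (cesaro_ratio_cvg a0); rewrite mulr0 in h.
have hN := cvgnZ (-1) h; rewrite mulr0 in hN.
have c0 : \sum_(k < n.+1) w n k * (u (n - k)%N k - v (n - k)%N k) @[n --> \oo] --> (0 : R).
  apply: (squeezen _ hN h) => n; rewrite mulN1r -ler_norml.
  apply: (le_trans (ler_norm_sum _ _ _)).
  have -> : C * (A n / cesaro_number (alpha + 1) n) = \sum_(k < n.+1) w n k * C.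
    rewrite -mulr_suml mulrC; congr (_ * _); rewrite -mulr_suml; congr (_ / _).
    have -> : A n = \sum_(k < n.+1) cesaro_number (alpha - 1) k.
      by rewrite (cesaro_number_sum n a1) a11.
    rewrite (reindex_inj rev_ord_inj)/=.
    by apply: eq_bigr => i _; rewrite subSS.
  by apply: ler_sum => k _; rewrite normrM (ger0_norm (w0 _ _)) ler_wpM2l.
have := cvgnD c0 vl; rewrite add0r; apply: cvgn_ext => n.
by rewrite -big_split/=; apply: eq_bigr => k _; rewrite /w; ring.
Qed.

End AveragedCesaroMeans.

Section MeanAsymptotics.
Context {R : realType}.
Variable alpha : R.
Hypothesis alpha_gt0 : 0 < alpha.
Variable mu : nat -> {finite_measure set (measurableTypeR R) -> \bar R}.
Variables (p : nat -> nat -> {poly R}) (a b : nat -> nat -> R) (M : R).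
Hypothesis mu_adm : forall i, exists c d : R, mu i (~` `[c, d]) = 0%E.
Hypothesis p_on : forall i, orthonormal_polynomials (mu i) (p i).
Hypothesis ab_rec : forall i, recurrence_coefficients (p i) (a i) (b i).
Hypothesis aM : forall i k, `|a i k| <= M.
Hypothesis bM : forall i k, `|b i k| <= M.
Hypothesis a_null : forall l, (0 < l)%N ->
  mean_null alpha (fun i k => a i (k + l)%N - a i k).
Hypothesis b_null : forall l, (0 < l)%N ->
  mean_null alpha (fun i k => b i (k + l)%N - b i k).
Hypothesis ab_mean : forall la lb,
  cesaro_mean alpha (fun i k => a i k ^+ la * b i k ^+ lb) n @[n --> \oo] -->
    (la == 0%N)%:R * (2 ^- lb * (rbinom ((alpha + lb%:R) / 2) (alpha / 2))^-1).
Local Notation L := (3 * M + 1).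
Local Notation leb := (@lebesgue_measure R).

Let M0 : 0 <= M. Proof. exact: le_trans (normr_ge0 _) (aM 0 0). Qed.
Let L1 : 1 <= L. Proof. by rewrite lerDr mulr_ge0. Qed.
Let muL i : mu i (~` `[- L, L]) = 0%E.
Proof. exact: (support_bound (mu_adm i) (p_on i) (ab_rec i) (aM i) (bM i)). Qed.

(** The moments of the mean measures converge to those of the equilibrium measure. *)
Lemma jacobi_diagonal_equilibrium m :
  cesaro_mean alpha (fun i k => jacobi_entry (mu i) (p i) m k k) n @[n --> \oo] -->
    equilibrium_moment alpha m.
Proof.
rewrite -(walks_equilibrium_moment alpha_gt0).
exact: (jacobi_diagonal_mean alpha_gt0 mu_adm p_on ab_rec aM bM a_null b_null ab_mean).
Qed.

Let F n (q : {poly R}) :=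
  cesaro_mean alpha (fun i k => poly_int (mu i) (q * p i k * p i k)) n.

Let F_cvg q : F n q @[n --> \oo] --> equilibrium_poly alpha q.
Proof.
apply: (@poly_functional_cvg R F (equilibrium_poly alpha)).
- move=> n r s; rewrite /F -cesaro_meanD; apply: eq_bigr => k _; congr (_ * _).
  by rewrite -(poly_intD (mu_adm _)) !mulrDl.
- move=> n c r; rewrite /F -cesaro_meanZ; apply: eq_bigr => k _; congr (_ * _).
  by rewrite -(poly_intZ (mu_adm _)) !scalerAl.
- exact: equilibrium_polyD.
- exact: equilibrium_polyZ.
- by move=> j; rewrite equilibrium_polyXn; exact: jacobi_diagonal_equilibrium.
Qed.

Section Functions.
Variables (f h : R -> R) (B : R).
Hypothesis cf : {within `[-1, 1], continuous f}.
Hypothesis hf : {in `[-1, 1], h =1 f}.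
Hypothesis hB : forall x : R, - L <= x <= L -> `|h x| <= B.
Local Notation lim_value := ((wmoment alpha 0)^-1 *
  \int[leb]_(x in `]-1, 1[) (f x * equilibrium_weight alpha x)).

(** For a monomial, the sum over the roots of [p i k.+1] is a partial trace of a
    power of the Jacobi matrix up to a bounded error, by [power_sum_roots]; partial
    traces are partial sums of diagonal entries, whose means are known. *)
Lemma mean_roots_cvg :
  \sum_(k < n.+1) cesaro_number (alpha - 1) (n - k) / cesaro_number (alpha + 1) n *
    (\sum_(1 <= j < k.+2) h (ordered_root (p (n - k)%N) k.+1 j))
    @[n --> \oo] --> lim_value.
Proof.
pose w n k := cesaro_number (alpha - 1) (n - k) / cesaro_number (alpha + 1) n.
have w0 n k : 0 <= w n k.
  by rewrite ltW// divr_gt0 ?cesaro_number_gt0//; have := alpha_gt0; lra.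
have /choice[s hs] : forall ik : nat * nat, exists s : seq R,
    [/\ uniq s, size s = ik.2.+1 & forall x, root (p ik.1 ik.2.+1) x = (x \in s)].
  by move=> ik; exact: (op_split (mu_adm _) (p_on _)).
pose G n (q : R -> R) := \sum_(k < n.+1) w n k * \sum_(y <- s ((n - k)%N, nat_of_ord k)) q y.
have GE n : \sum_(k < n.+1) w n k * (\sum_(1 <= j < k.+2) h (ordered_root (p (n - k)%N) k.+1 j)) =
    G n h.
  apply: eq_bigr => k _; congr (_ * _); have [us ss rs] := hs ((n - k)%N, nat_of_ord k).
  exact: (sum_ordered_roots (p_on _) h us rs ss).
under eq_fun do rewrite GE.
apply: (@equilibrium_squeeze R alpha alpha_gt0 f h L B (fun n q => G n (horner q))) => //.
  apply: (@poly_functional_cvg R (fun n q => G n (horner q))).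
  - move=> n q r; rewrite /G -big_split/=; apply: eq_bigr => k _.
    by rewrite -mulrDr -big_split/=; congr (_ * _); apply: eq_bigr => y _; rewrite hornerD.
  - move=> n c q; rewrite /G mulr_sumr; apply: eq_bigr => k _.
    by rewrite [RHS]mulrCA; congr (_ * _); rewrite mulr_sumr; apply: eq_bigr => y _; rewrite hornerZ.
  - exact: equilibrium_polyD.
  - exact: equilibrium_polyZ.
  move=> m; rewrite equilibrium_polyXn.
  apply: (@averaged_perturbation R alpha alpha_gt0
    (fun i k => \sum_(y <- s (i, k)) ('X^m : {poly R}).[y])
    (fun i k => \sum_(l < k.+1) jacobi_entry (mu i) (p i) m l l)
    (m%:R * (2 * (3 * M) ^+ m))).
    move=> i k; have [us ss rs] := hs (i, k).
    under eq_bigr do rewrite hornerXn.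
    exact: (power_sum_roots (mu_adm i) (p_on i) (ab_rec i) (aM i) (bM i) m us ss rs).
  exact: (averaged_partial_sums_cvg alpha_gt0 (@jacobi_diagonal_equilibrium m)).
move=> q1 q2 n q12.
have yL k y : y \in s ((n - k)%N, k) -> - L <= y <= L.
  have [us ss rs] := hs ((n - k)%N, k); rewrite -rs => ry.
  have := op_root_le (p_on (n - k)%N) (ab_rec (n - k)%N) (aM (n - k)%N) (bM (n - k)%N) ry.
  by rewrite -ler_norml => /le_trans; apply; rewrite lerDl.
apply/andP; split; apply: ler_sum => k _; apply: ler_wpM2l => //;
  rewrite big_seq [leRHS]big_seq; apply: ler_sum => y ys;
  by have /andP[] := q12 y (yL _ _ ys).
Qed.

Hypothesis mh : measurable_fun [set: measurableTypeR R] h.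

(** For polynomials this is the convergence of the Jacobi diagonal; the supports of
    all the measures lie in one segment [`[- L, L]]. *)
Lemma mean_integral_cvg :
  cesaro_mean alpha (fun i k => \int[mu i]_x (h x * (p i k).[x] ^+ 2)) n
    @[n --> \oo] --> lim_value.
Proof.
apply: (@equilibrium_squeeze R alpha alpha_gt0 f h L B F) => //.
have mp i k : measurable_fun [set: measurableTypeR R] (fun x : measurableTypeR R => (p i k).[x] ^+ 2).
  by apply: measurable_funX; exact: measurable_horner.
move=> q1 q2 n q12.
have bq (q : {poly R}) := horner_bounded q (- L) L.
have hpB i k : exists C : R, forall x : R, - L <= x <= L -> `|h x * (p i k).[x] ^+ 2| <= C.
  have [C HC] := bq (p i k ^+ 2); exists (B * C) => x xL.
  by rewrite normrM -horner_exp; apply: ler_pM (hB xL) (HC x xL).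
apply/andP; split; apply: cesaro_mean_le => i k; rewrite /poly_int.
- have [B1 HB1] := bq (q1 * p i k * p i k); have [C HC] := hpB i k.
  apply: (le_Rintegral_supported (muL i) _ _ HB1 HC) => [| |x xL].
  + exact: measurable_horner.
  + exact: measurable_funM.
  + rewrite !hornerM -mulrA -expr2 ler_wpM2r ?sqr_ge0//.
    by have /andP[] := q12 x xL.
- have [B1 HB1] := bq (q2 * p i k * p i k); have [C HC] := hpB i k.
  apply: (le_Rintegral_supported (muL i) _ _ HC HB1) => [| |x xL].
  + exact: measurable_funM.
  + exact: measurable_horner.
  + rewrite !hornerM -mulrA -expr2 ler_wpM2r ?sqr_ge0//.
    by have /andP[] := q12 x xL.
Qed.

Lemma integral_CD_kernel i k :
  \int[mu i]_x (h x * CD_kernel (p i) k x x) =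
  \sum_(l < k.+1) \int[mu i]_x (h x * (p i l).[x] ^+ 2).
Proof.
pose J (q : {poly R}) := \int[mu i]_x (h x * q.[x]).
have int (q : {poly R}) : (mu i).-integrable [set: measurableTypeR R] (EFin \o (fun x => h x * q.[x])).
  have [C HC] := horner_bounded q (- L) L.
  apply: (integrable_supported (muL i) (measurable_funM mh (measurable_horner q))) => x xL.
  by rewrite normrM; apply: ler_pM (hB xL) (HC x xL).
have JD q r : J (q + r) = J q + J r.
  rewrite /J -(RintegralD measurableT (int q) (int r)).
  by apply: eq_Rintegral => x _; rewrite hornerD mulrDr.
have J0 : J 0 = 0 by have /eqP := JD 0 0; rewrite addr0 -subr_eq0 opprD addNKr oppr_eq0 => /eqP.
transitivity (J (\sum_(l < k.+1) p i l ^+ 2)).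
  apply: eq_Rintegral => x _; congr (_ * _); rewrite horner_sum.
  by apply: eq_bigr => l _; rewrite horner_exp expr2.
rewrite (big_morph J JD J0); apply: eq_bigr => l _.
by apply: eq_Rintegral => x _; rewrite horner_exp.
Qed.

(** On the diagonal the kernel is a partial sum of squares, and averaging partial
    sums raises the order of the Cesaro method by one. *)
Lemma mean_CD_kernel_cvg :
  \sum_(k < n.+1) cesaro_number (alpha - 1) (n - k) / cesaro_number (alpha + 1) n *
    \int[mu (n - k)%N]_x (h x * CD_kernel (p (n - k)%N) k x x)
    @[n --> \oo] --> lim_value.
Proof.
apply: (cvgn_ext _ (averaged_partial_sums_cvg alpha_gt0 mean_integral_cvg)) => n.
by apply: eq_bigr => k _; rewrite integral_CD_kernel.
Qed.

End Functions.
End MeanAsymptotics.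

(** * The weak limits *)

Theorem theorem8 (R : realType) (alpha : R)
    (mu : nat -> {finite_measure set (measurableTypeR R) -> \bar R})
    (p : nat -> nat -> {poly R}) (a b : nat -> nat -> R)
    (alpha_gt0 : 0 < alpha)
    (mu_adm : forall k, admissible_measure (mu k))
    (p_on : forall k, orthonormal_polynomials (mu k) (p k))
    (ab_rec : forall k, recurrence_coefficients (p k) (a k) (b k))
    (ab_nevai : mean_nevai_class alpha a b
       (fun la lb => (la == 0%N)%:R * 2 ^- lb
                     * (rbinom ((alpha + lb%:R) / 2) (alpha / 2))^-1)) :
  [/\ weakly_converges (mean_measure alpha mu p) (equilibrium_measure alpha),
      equilibrium_mass alpha
        = pi * 2 `^ (1 - alpha) * rbinom (alpha - 1) (alpha / 2) &
      forall f : R -> R, {within `[-1, 1], continuous f} ->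
        let lim_value := (equilibrium_mass alpha)^-1 *
          \int[lebesgue_measure]_(x in `[-1, 1])
             (f x * (1 - x ^+ 2) `^ ((alpha - 1) / 2)) in
        [/\ (\sum_(k < n.+1)
               rbinom ((n - k)%:R + alpha - 1) (n - k)%:R
                 / rbinom (n%:R + alpha) n%:R
               * \int[mu (n - k)%N]_(x in `[-1, 1])
                    (f x * `|(p (n - k)%N k).[x]| ^+ 2))
              @[n --> \oo] --> lim_value,
            (\sum_(k < n.+1)
               rbinom ((n - k)%:R + alpha - 1) (n - k)%:R
                 / rbinom (n%:R + alpha + 1) n%:R
               * \int[mu (n - k)%N]_(x in `[-1, 1])
                    (f x * CD_kernel (p (n - k)%N) k x x))
              @[n --> \oo] --> lim_value &
            (* the roots may lie outside [-1, 1], where f is not given: any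
               extension g of f mapping bounded sets to bounded sets will do *)
            forall g : R -> R, {in `[-1, 1], g =1 f} ->
              (forall A : set R, bounded_set A -> bounded_set (g @` A)) ->
              (\sum_(k < n.+1)
                 rbinom ((n - k)%:R + alpha - 1) (n - k)%:R
                   / rbinom (n%:R + alpha + 1) n%:R
                 * \sum_(1 <= j < k.+2) g (ordered_root (p (n - k)%N) k.+1 j))
                @[n --> \oo] --> lim_value]].
Proof.
have cvx : forall k, exists c d : R, mu k (~` `[c, d]) = 0%E by move=> k; have [] := mu_adm k.
case: ab_nevai => -[Ma aMa] [Mb bMb] null mean.
pose M := Num.max Ma Mb.
have aM i k : `|a i k| <= M by rewrite le_max aMa.
have bM i k : `|b i k| <= M by rewrite le_max bMb orbT.
have a_null l : (0 < l)%N -> mean_null alpha (fun i k => a i (k + l)%N - a i k).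
  by move=> /null[].
have b_null l : (0 < l)%N -> mean_null alpha (fun i k => b i (k + l)%N - b i k).
  by move=> /null[].
have ab_mean la lb :
    cesaro_mean alpha (fun i k => a i k ^+ la * b i k ^+ lb) n @[n --> \oo] -->
    (la == 0%N)%:R * (2 ^- lb * (rbinom ((alpha + lb%:R) / 2) (alpha / 2))^-1).
  by rewrite mulrA; exact: mean.
split; last 1 first.
- move=> f cf lim_value.
  have mseg : measurable (`[-1, 1]%classic : set (measurableTypeR R)) by exact: measurable_itv.
  have mf : measurable_fun (`[-1, 1]%classic : set (measurableTypeR R)) f.
    exact: subspace_continuous_measurable_fun.
  have mf' : measurable_fun (`]-1, 1[%classic : set (measurableTypeR R)) f.
    apply: (measurable_funS mseg _ mf) => x; rewrite /= !in_itv/= => /andP[x1 x2].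
    by rewrite (ltW x1) (ltW x2).
  have limE : lim_value = (wmoment alpha 0)^-1 *
      \int[lebesgue_measure]_(x in `]-1, 1[) (f x * equilibrium_weight alpha x).
    by rewrite /lim_value equilibrium_massE// -(Rintegral_equilibrium_segment alpha mf').
  (* Extended by zero, the function can be integrated over the whole line. *)
  pose h : measurableTypeR R -> R := f \_ `[-1, 1].
  have hf : {in `[-1, 1], h =1 f}.
    by move=> x x1; rewrite /h patchE mem_set.
  have [B hB] : exists B : R, forall x : R, `|h x| <= B.
    have /compact_bounded[B0 [_ HB]] := continuous_compact cf (@segment_compact R (-1) 1).
    exists (Num.max 0 (B0 + 1)) => x; rewrite /h patchE.
    case: ifPn => [|_]; last by rewrite normr0 le_max lexx.
    rewrite inE => x1; rewrite le_max; apply/orP; right.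
    by apply: (HB (B0 + 1)); [rewrite ltrDl|exists x].
  have mh : measurable_fun [set: measurableTypeR R] h.
    by apply/(measurable_restrictT _ mseg).
  have restrict i (g : R -> R) :
      \int[mu i]_(x in `[-1, 1]) (f x * g x) = \int[mu i]_x (h x * g x).
    rewrite /Rintegral integral_mkcond; congr fine; apply: eq_integral => x _.
    by rewrite /h !patchE; case: ifPn => // _; rewrite mul0r.
  rewrite limE; split.
  + apply: (cvgn_ext _ (mean_integral_cvg alpha_gt0 cvx p_on ab_rec aM bM
      a_null b_null ab_mean cf hf (fun x _ => hB x) mh)) => n.
    apply: eq_bigr => k _; congr (_ * _); rewrite restrict.
    by apply: eq_Rintegral => x _; rewrite real_normK// num_real.
  + apply: (cvgn_ext _ (mean_CD_kernel_cvg alpha_gt0 cvx p_on ab_rec aM bM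
      a_null b_null ab_mean cf hf (fun x _ => hB x) mh)) => n.
    apply: eq_bigr => k _; rewrite (restrict _ (fun x => CD_kernel _ k x x)).
    by rewrite /cesaro_number !addrA.
  + move=> g gf gb.
    have [C gC] : exists C : R, forall x : R, - (3 * M + 1) <= x <= 3 * M + 1 -> `|g x| <= C.
      have /gb[C [_ HC]] : bounded_set (`[- (3 * M + 1), 3 * M + 1]%classic : set R).
        exists (3 * M + 1); split; first exact: num_real.
        move=> y My x; rewrite /= in_itv/= -ler_norml => /le_trans; apply; exact: ltW.
      exists (C + 1) => x xM; apply: (HC (C + 1)); first by rewrite ltrDl.
      by exists x => //=; rewrite in_itv.
    apply: (cvgn_ext _ (mean_roots_cvg alpha_gt0 cvx p_on ab_rec aM bM
      a_null b_null ab_mean cf gf gC)) => n.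
    by apply: eq_bigr => k _; rewrite /cesaro_number !addrA.
- move=> f cf fb.
  have mf : measurable_fun [set: measurableTypeR R] f by exact: continuous_measurable_fun.
  have [B fB] : exists B : R, forall x : R, `|f x| <= B.
    by have [B [_ HB]] := fb; exists (B + 1) => x; apply: HB; rewrite ?ltrDl.
  rewrite (Rintegral_equilibrium_measure alpha_gt0 mf fB).
  have cf' : {within `[-1, 1], continuous f} by exact: continuous_subspaceT.
  apply: (cvgn_ext _ (mean_integral_cvg alpha_gt0 cvx p_on ab_rec aM bM
    a_null b_null ab_mean cf' (fun x _ => erefl (f x)) (fun x _ => fB x) mf)) => n.
  by rewrite (Rintegral_mean_measure alpha p n cvx mf fB).
- exact: equilibrium_mass_formula.
Qed.
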